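(* Let $\lambda>0$, $1<p<\infty$, $\Lambda\in(0,1)$, $\mathcal S$ a $\Lambda$-sparse family of dyadic cubes in $(\mathbb R_+,|\cdot|,\mu)$, and $b\in{\rm BMO}_{\triangle_\lambda}(\mathbb R_+)$. Then for every $w\in\widetilde A_{p,\lambda-\frac12}$, $$\|\mathcal A_{\mathcal S,b}\|_{L^p(w\,dx)\to L^p(w\,dx)},\ \|\mathcal A^*_{\mathcal S,b}\|_{L^p(w\,dx)\to L^p(w\,dx)}\le C\,\|b\|_{{\rm BMO}_{\triangle_\lambda}(\mathbb R_+)}\,[w]_{\widetilde A_{p,\lambda-\frac12}}^{2\max\{1,\frac1{p-1}\}},$$ with $C$ depending only on $p,\lambda,\Lambda$ (and the dyadic system).
   Context: Fix $\lambda>0$. On $\mathbb R_+=(0,\infty)$ let $d\mu(x)=x^{2\lambda}dx$; intervals are $B=(a,b)\subset\mathbb R_+$; $p'=p/(p-1)$; $L^p(w\,dx)=L^p(\mathbb R_+,w\,dx)$. For $1<p<\infty$, $w\ge0$ measurable belongs to $\widetilde A_{p,\lambda-\frac12}$ if $[w]_{\widetilde A_{p,\lambda-\frac12}}:=\sup_{B}\big(\frac1{\mu(B)}\int_B w(t)dt\big)\big(\frac1{\mu(B)}\int_B t^{2\lambda p'}w(t)^{-\frac1{p-1}}dt\big)^{p-1}<\infty$. ${\rm BMO}_{\triangle_\lambda}(\mathbb R_+)$ is the set of $f\in L^1_{loc}(\mathbb R_+,\mu)$ with $\|f\|_{{\rm BMO}_{\triangle_\lambda}}:=\sup_B\frac1{\mu(B)}\int_B|f-f_B|\,d\mu<\infty$,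 $f_B=\frac1{\mu(B)}\int_Bf\,d\mu$. $\mathcal D$ is a fixed system of dyadic cubes on the space of homogeneous type $(\mathbb R_+,|\cdot|,\mu)$. $\mathcal S\subset\mathcal D$ is $\Lambda$-sparse if for each $Q\in\mathcal S$ there is measurable $E_Q\subset Q$ with $\mu(E_Q)\ge\Lambda\mu(Q)$ and the $E_Q$ have finite overlap. $\mathcal A_{\mathcal S,b}f(x)=\sum_{Q\in\mathcal S}\frac{1}{\mu(Q)}|b(x)-b_Q|\int_Q f\,d\mu\cdot\chi_Q(x)$ and $\mathcal A^*_{\mathcal S,b}f(x)=\sum_{Q\in\mathcal S}\frac1{\mu(Q)}\int_Q|b(t)-b_Q|f(t)\,d\mu(t)\cdot\chi_Q(x)$.
   Formalization: ''Finite overlap'' is read as: every point lies in at most N of the sets E_Q, and C may depend on N as well as on p, λ, Λ and the dyadic system; independence of N fails (N nested generations of cubes with E_Q = Q). *)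

(* Defs.v *)
From HB Require Import structures.
From mathcomp Require Import all_boot all_order all_algebra.
From mathcomp Require Import all_classical all_reals all_analysis.
Set Implicit Arguments. Unset Strict Implicit. Unset Printing Implicit Defensive.
Import Order.TTheory GRing.Theory Num.Theory.
Local Open Scope classical_set_scope.
Local Open Scope ring_scope.

Section Defs.
Context {R : realType}.

Definition Rp : set R := `]0, +oo[%classic.

Definition rball (z r : R) : set R := [set y | Rp y /\ `|z - y| < r].

Definition dens (lam : R) (x : R) : R := x `^ (2 * lam).

Definition muI (lam : R) (A : set R) : \bar R :=
  (\int[lebesgue_measure]_(x in A) (dens lam x)%:E)%E.

Definition intmu (lam : R) (A : set R) (f : R -> R) : \bar R :=
  (\int[lebesgue_measure]_(x in A) (f x * dens lam x)%:E)%E.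

Definition avg (lam : R) (A : set R) (f : R -> R) : R :=
  fine (intmu lam A f) / fine (muI lam A).

Definition interval_Rp (B : set R) : Prop :=
  exists a c : R, 0 <= a /\ a < c /\ B = `]a, c[%classic.

Definition bmo_norm (lam : R) (f : R -> R) : \bar R :=
  ereal_sup [set ((fine (muI lam B))^-1)%:E *
                 (\int[lebesgue_measure]_(x in B) (`|f x - avg lam B f| * dens lam x)%:E)
            | B in interval_Rp]%E.

(* f in BMO_{triangle_lambda}(R_+): measurable, mu-integrable on every interval
   of R_+ (so that f_B is defined), and finite BMO norm *)
Definition BMO (lam : R) (f : R -> R) : Prop :=
  [/\ measurable_fun Rp f,
      (forall B, interval_Rp B ->
         lebesgue_measure.-integrable B (fun x => (f x * dens lam x)%:E))
    & (bmo_norm lam f < +oo)%E].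

(* t^{2 lambda p'} w(t)^{-1/(p-1)}, with the convention 0^{-1/(p-1)} = +oo *)
Definition sigmaw (lam p : R) (w : R -> R) (t : R) : \bar R :=
  if w t == 0 then +oo%E
  else ((t `^ (2 * lam * (p / (p - 1)))) * (w t `^ (- (p - 1)^-1)))%:E.

Definition Ap_const (lam p : R) (w : R -> R) : \bar R :=
  ereal_sup [set (((fine (muI lam B))^-1)%:E *
                   (\int[lebesgue_measure]_(x in B) (w x)%:E)) *
                 poweR (((fine (muI lam B))^-1)%:E *
                   (\int[lebesgue_measure]_(x in B) sigmaw lam p w x)) (p - 1)
            | B in interval_Rp]%E.

Definition Ap_weight (lam p : R) (w : R -> R) : Prop :=
  [/\ measurable_fun Rp w, (forall x, Rp x -> 0 <= w x) & (Ap_const lam p w < +oo)%E].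

(* A system of dyadic cubes on the space of homogeneous type (R_+, |.|, mu)
   in the sense of Hytonen--Kairema (Theorem 2.2): D k is the set of cubes of
   generation k (k : int), z k Q is the "center" of the cube Q of generation k. *)
Definition dyadic_system (D : int -> set (set R)) (z : int -> set R -> R)
    (delta c0 C0 : R) : Prop :=
  [/\ 0 < delta < 1, 0 < c0 <= C0,
      (forall k Q, D k Q -> measurable Q /\ Q `<=` Rp),
      (forall k x, Rp x -> exists Q, D k Q /\ Q x)
    & [/\ (forall k Q Q', D k Q -> D k Q' -> Q <> Q' -> Q `&` Q' = set0),
      (forall (k l : int) Q P, k <= l -> D k Q -> D l P -> P `<=` Q \/ P `&` Q = set0),
      (forall k Q, D k Q ->
         [/\ Rp (z k Q), rball (z k Q) (c0 * delta ^ k) `<=` Q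
           & Q `<=` rball (z k Q) (C0 * delta ^ k)])
    & (forall (k l : int) Q P, k <= l -> D k Q -> D l P -> P `<=` Q ->
         rball (z l P) (C0 * delta ^ l) `<=` rball (z k Q) (C0 * delta ^ k))]].

Definition dcube (D : int -> set (set R)) (Q : set R) : Prop := exists k, D k Q.

Definition sparse (lam : R) (D : int -> set (set R)) (Lam : R) (N : nat)
    (S : set (set R)) : Prop :=
  S `<=` dcube D /\
  exists E : set R -> set R,
    (forall Q, S Q ->
       [/\ measurable (E Q), E Q `<=` Q & (Lam%:E * muI lam Q <= muI lam (E Q))%E]) /\
    (forall x, ([set Q | S Q /\ E Q x] #<= `I_N)%card).

(* the series sum_{Q in S} t Q, defined as (sum of positive parts) - (sum of
   negative parts), i.e. the usual value whenever the series converges absolutely *)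
Definition ssum (S : set (set R)) (t : set R -> R) : \bar R :=
  (esum S (fun Q => (Num.max (t Q) 0)%:E) - esum S (fun Q => (Num.max (- t Q) 0)%:E))%E.

Definition AS (lam : R) (S : set (set R)) (b f : R -> R) (x : R) : \bar R :=
  ssum S (fun Q => (fine (muI lam Q))^-1 * `|b x - avg lam Q b| *
                   fine (intmu lam Q f) * \1_Q x).

Definition ASstar (lam : R) (S : set (set R)) (b f : R -> R) (x : R) : \bar R :=
  ssum S (fun Q => (fine (muI lam Q))^-1 *
                   fine (intmu lam Q (fun t => `|b t - avg lam Q b| * f t)) * \1_Q x).

Definition LpwE (p : R) (w : R -> R) (g : R -> \bar R) : \bar R :=
  (\int[lebesgue_measure]_(x in Rp) (poweR `|g x| p * (w x)%:E))%E.

Definition Lpw (p : R) (w : R -> R) (f : R -> R) : \bar R :=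
  (\int[lebesgue_measure]_(x in Rp) (`|f x| `^ p * w x)%:E)%E.

End Defs.

(* Main.v *)
(* Write u = x^(2 lam) and s = u^(p') w^(-1/(p-1)), so that u = w^(1/p) s^(1/p')
   and the hypothesis on w reads w(B) s(B)^(p-1) <= W u(B)^p.  By duality both
   operators are controlled by the form
     sum_Q u(Q)^(-1) (int_Q f u) (int_Q |b - b_Q| g u).
   A stopping time argument on the dyadic averages of b bounds the last factor by
   ||b||_BMO times int_Q M(g) u, where M is the dyadic maximal operator of u: this
   replaces the John-Nirenberg inequality.  What remains is the form of the sparse
   operator without commutator, tested on f and M(g).  It costs
   W^(max(1, 1/(p-1))): for p >= 2 one has
   s(Q) w(Q) / u(Q) <= C W s(E_Q)^(1/p) w(E_Q)^(1/p'), the averages of f u / s and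
   g u / w are then absorbed in the maximal operators of s and w, and the case p < 2
   follows by exchanging the two weights.
   The missing power is the bound of M on L^(p')(s), obtained from
   M(g) <= W (M_s ((M_w (g u / w))^(p'-1) u / s))^(p-1) together with the
   dimension-free L^r bound for the dyadic maximal operator of a measure. *)
Require Import Defs.
From HB Require Import structures.
From mathcomp Require Import all_boot all_order all_algebra.
From mathcomp Require Import all_classical all_reals all_analysis.
From mathcomp Require Import measurable_realfun zify ring lra.
Set Implicit Arguments. Unset Strict Implicit. Unset Printing Implicit Defensive.
Import Order.TTheory GRing.Theory Num.Theory.
Import numFieldNormedType.Exports.
Local Open Scope classical_set_scope.
Local Open Scope ring_scope.

(** * Integrals of nonnegative measurable functions *)

Section nonnegative_measurable.
Context d (T : measurableType d) (R : realType) (m : {measure set T -> \bar R}).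
Local Open Scope ereal_scope.
Implicit Types (f g : T -> \bar R) (A B : set T).

(** Integrals take values in the extended reals, so bilinear estimates are kept as sums of p-th and
    q-th power integrals, as Young's inequality gives them, and not as products of norms.
    Homogeneity makes up for this: the form is unchanged under (f, g) -> (c f, g / c), which puts a
    free parameter c into the sum, and c is fixed only when the form is tested. The test function
    must give a finite integral that can be absorbed, hence the truncations. The adjoint has the
    oscillation on the other function of the form, so it obeys the same estimates with the two
    weights exchanged.

    Two mismatches shape the passage to the half-line. Cubes need not be intervals, while the BMO
    norm and the A_p constant see only intervals: both are read on an interval that contains the
    cube and has comparable measure. And w may vanish, where s is infinite: then either the zeros
    are negligible, and w can be altered there, or w vanishes almost everywhere and there is nothing
    to prove. The abstract part may thus assume weights that are strictly positive on the whole
    space, which lets all quotients such as u / s be formed freely. *)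

Definition nnmf f := measurable_fun [set: T] f /\ forall x, 0 <= f x.

Lemma nnmf_ge0 f x : nnmf f -> 0 <= f x. Proof. by case. Qed.

Lemma nnmf_cst (k : \bar R) : 0 <= k -> nnmf (fun=> k).
Proof. by split. Qed.

Lemma nnmf_EFin (u : T -> R) : measurable_fun [set: T] u ->
  (forall x, (0 <= u x)%R) -> nnmf (fun x => (u x)%:E).
Proof. by move=> mu u0; split=> [|x]; [exact/measurable_EFinP|rewrite lee_fin]. Qed.

Lemma nnmfD f g : nnmf f -> nnmf g -> nnmf (fun x => f x + g x).
Proof.
move=> [mf f0] [mg g0]; split=> [|x]; [exact: emeasurable_funD|exact: adde_ge0].
Qed.

Lemma nnmfM f g : nnmf f -> nnmf g -> nnmf (fun x => f x * g x).
Proof.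
move=> [mf f0] [mg g0]; split=> [|x]; [exact: emeasurable_funM|exact: mule_ge0].
Qed.

Lemma nnmf_poweR f r : nnmf f -> nnmf (fun x => poweR (f x) r).
Proof.
move=> [mf f0]; split=> [|x]; last exact: poweR_ge0.
by apply: measurableT_comp (measurable_poweR r) mf.
Qed.

Lemma nnmf_indic A : measurable A -> nnmf (fun x => (\1_A x)%:E).
Proof.
move=> mA; apply: nnmf_EFin => [|x]; first exact: measurable_indic.
by rewrite indicE; case: (_ \in _).
Qed.

Lemma nnmf_nneseries (f : nat -> T -> \bar R) (P : pred nat) :
  (forall i, nnmf (f i)) -> nnmf (fun x => \sum_(i <oo | P i) f i x).
Proof.
move=> nf; split=> [|x].
  by apply: ge0_emeasurable_sum => [i x _ _|i _]; [case: (nf i)|case: (nf i)].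
by apply: nneseries_ge0 => i _ _; case: (nf i).
Qed.

Lemma nnmf_ereal_sup (f : nat -> T -> \bar R) :
  (forall i, nnmf (f i)) -> nnmf (fun x => ereal_sup (range (f ^~ x))).
Proof.
move=> nf; split=> [|x].
  have := @measurable_fun_esups _ _ _ setT f (fun i => (nf i).1) 0%N.
  apply: eq_measurable_fun => x _; rewrite /esups /sdrop; congr ereal_sup.
  by apply/seteqP; split => [y [i _ <-]|y [i _ <-]]; exists i.
by apply: le_trans ((nf 0%N).2 x) _; apply: ereal_sup_ubound; exists 0%N.
Qed.

Lemma nnmfS f A : nnmf f -> measurable_fun A f.
Proof. by move=> [mf _]; exact: measurable_funTS. Qed.

Lemma int_le A f g : measurable A -> nnmf f -> nnmf g ->
  (forall x, A x -> f x <= g x) -> \int[m]_(x in A) f x <= \int[m]_(x in A) g x.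
Proof.
move=> mA nf ng; apply: ge0_le_integral => //; try exact: nnmfS.
by move=> x _; case: nf.
Qed.

Lemma int_ge0 A f : nnmf f -> 0 <= \int[m]_(x in A) f x.
Proof. by move=> [_ f0]; apply: integral_ge0. Qed.

Lemma intD A f g : measurable A -> nnmf f -> nnmf g ->
  \int[m]_(x in A) (f x + g x) = \int[m]_(x in A) f x + \int[m]_(x in A) g x.
Proof.
move=> mA nf ng; apply: ge0_integralD => //; try exact: nnmfS.
- by move=> x _; case: nf.
- by move=> x _; case: ng.
Qed.

Lemma intZl A f k : measurable A -> nnmf f -> 0 <= k ->
  \int[m]_(x in A) (k * f x) = k * \int[m]_(x in A) f x.
Proof.
move=> mA nf k0; apply: ge0_integralZl => //; first exact: nnmfS.
by move=> x _; case: nf.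
Qed.

Lemma int_subset A B f : measurable A -> measurable B -> nnmf f -> A `<=` B ->
  \int[m]_(x in A) f x <= \int[m]_(x in B) f x.
Proof.
move=> mA mB nf; apply: ge0_subset_integral => //; first exact: nnmfS.
by move=> x _; case: nf.
Qed.

Lemma int_nneseries A (f : nat -> T -> \bar R) : measurable A ->
  (forall i, nnmf (f i)) ->
  \int[m]_(x in A) (\sum_(i <oo) f i x) = \sum_(i <oo) \int[m]_(x in A) f i x.
Proof.
move=> mA nf; apply: integral_nneseries => // i; first exact: nnmfS.
by move=> x _; case: (nf i).
Qed.

Lemma int_setU A B f : measurable A -> measurable B -> nnmf f ->
  A `&` B = set0 ->
  \int[m]_(x in A `|` B) f x = \int[m]_(x in A) f x + \int[m]_(x in B) f x.
Proof.
move=> mA mB nf AB0; apply: ge0_integral_setU => //; first exact: nnmfS.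
  by move=> x _; case: nf.
by rewrite disj_set2E AB0 eqxx.
Qed.

Lemma int_indic A B f : measurable A -> measurable B -> nnmf f ->
  \int[m]_(x in B) (f x * (\1_A x)%:E) = \int[m]_(x in A `&` B) f x.
Proof.
move=> mA mB nf; rewrite setIC integral_mkcondr; apply: eq_integral => x _.
rewrite patchE indicE; case: (x \in A); first by rewrite mule1.
by rewrite mule0.
Qed.

Lemma nnmf_int_indic A f : measurable A -> nnmf f ->
  \int[m]_x (f x * (\1_A x)%:E) = \int[m]_(x in A) f x.
Proof. by move=> mA nf; rewrite int_indic// setIT. Qed.

Lemma int_setD A B f : measurable A -> measurable B -> nnmf f -> A `<=` B ->
  \int[m]_(x in B) f x = \int[m]_(x in A) f x + \int[m]_(x in B `\` A) f x.
Proof.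
move=> mA mB nf AB; rewrite -int_setU// ?setDUK//; first exact: measurableD.
by rewrite setDIK.
Qed.

Lemma int_gt0 A (u : T -> R) : measurable A -> measurable_fun [set: T] u ->
  (forall x, (0 < u x)%R) -> 0 < m A -> 0 < \int[m]_(x in A) (u x)%:E.
Proof.
move=> mA mu u0 A0; rewrite lt_neqAle eq_sym; apply/andP; split; last first.
  by apply: integral_ge0 => x _; rewrite lee_fin ltW.
apply/eqP => I0; move: A0; rewrite lt0e => /andP[/eqP + _]; apply.
have : \int[m]_(x in A) `|(u x)%:E| = 0.
  by rewrite -[RHS]I0; apply: eq_integral => x _; rewrite gee0_abs// lee_fin ltW.
move/ae_eq_integral_abs => /(_ mA) h.
have /h [N [mN N0 subN]] : measurable_fun A (fun x => (u x)%:E).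
  by apply/measurable_funTS/measurable_EFinP.
apply: (subset_measure0 mA mN _ N0) => x Ax; apply: subN => /= /(_ Ax) [] /eqP.
by rewrite gt_eqF.
Qed.

End nonnegative_measurable.

(* Structural rules come first, and hypotheses are compared syntactically before
   any unification is attempted: conversion unfolds [mule] and [poweR]. *)
Ltac nnmf_step :=
  lazymatch goal with
  | |- nnmf (fun _ => ?k) => apply: nnmf_cst
  | |- nnmf (fun x => GRing.add _ _) => apply: nnmfD
  | |- nnmf (fun x => mule _ _) => apply: nnmfM
  | |- nnmf (fun x => poweR _ _) => apply: nnmf_poweR
  | |- nnmf (fun x => EFin (indic _ x)) => apply: nnmf_indic
  | |- nnmf (fun x => ?f x) => change (nnmf f)
  | H : nnmf ?f |- nnmf ?f => exact H
  | |- nnmf _ => match goal with H : forall _, _ |- _ => solve [apply: H => //] end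
  | |- _ => done
  end.
Ltac nnmf := repeat nnmf_step.

Definition nested T (F : nat -> set T) := forall i j,
  [\/ F i `<=` F j, F j `<=` F i | F i `&` F j = set0].

(** * Conjugate exponents and Young's inequality *)

Section conjugate_exponents.
Variables (R : realType) (p q : R).
Hypotheses (p1 : 1 < p) (pq : p^-1 + q^-1 = 1).

Lemma conjugate_gt0 : 0 < q.
Proof.
have p0 : 0 < p by exact: lt_trans p1.
rewrite -invr_gt0; have : p^-1 < 1 by rewrite invf_lt1.
by move: pq; set a := p^-1; set b := q^-1; lra.
Qed.

Lemma conjugate_mul : (p - 1) * q = p.
Proof.
have pn : p != 0 by rewrite gt_eqF// (lt_trans _ p1).
have qn : q != 0 by rewrite gt_eqF// conjugate_gt0.
have : p * q * (p^-1 + q^-1) = p * q by rewrite pq mulr1.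
rewrite mulrDr (mulrC p q) mulfK// -(mulrC p q) mulfK// mulrBl mul1r.
by move=> <-; rewrite addrC addKr.
Qed.

Lemma conjugate_gt1 : 1 < q.
Proof.
have p0 : 0 < p by exact: lt_trans p1.
have := conjugate_mul; have := conjugate_gt0.
by move: p1 p0; set pp := p; set qq := q; nra.
Qed.

Lemma conjugate_mulC : (q - 1) * p = q.
Proof. by have := conjugate_mul; set pp := p; set qq := q; lra. Qed.

Lemma conjugate_inv : (p - 1)^-1 = q - 1.
Proof.
have p10 : p - 1 != 0 by rewrite gt_eqF// subr_gt0.
apply: (mulfI p10); rewrite divff//.
by have := conjugate_mul; set pp := p; set qq := q; lra.
Qed.

Lemma conjugate_sym : q^-1 + p^-1 = 1. Proof. by rewrite addrC. Qed.

Local Open Scope ereal_scope.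

Lemma young_poweR (x y : \bar R) : 0 <= x -> 0 <= y ->
  x * y <= p^-1%:E * poweR x p + q^-1%:E * poweR y q.
Proof.
have p0 : (0 < p)%R by exact: lt_trans p1.
have q0 := conjugate_gt0.
have pV : 0 < p^-1%:E by rewrite lte_fin invr_gt0.
have qV : 0 < q^-1%:E by rewrite lte_fin invr_gt0.
case: x => [x| |]// x0; last first.
  rewrite [poweR +oo p]/= (gt_eqF p0) (gt0_muley pV) addye ?leey// gt_eqF//.
  by rewrite (lt_le_trans _ (mule_ge0 (ltW qV) (poweR_ge0 y q))).
case: y => [y| |]// y0; last first.
  rewrite [poweR +oo q]/= (gt_eqF q0) (gt0_muley qV) addey ?leey// gt_eqF//.
by rewrite /= -!EFinM -EFinD lee_fin (mulrC p^-1)%R (mulrC q^-1)%R conjugate_powR.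
Qed.

End conjugate_exponents.

Lemma exists_min_mem (R : realDomainType) (v0 : R) (vs : seq R) :
  exists2 c, c \in v0 :: vs & forall v, v \in v0 :: vs -> c <= v.
Proof.
elim: vs v0 => [|v1 vs IH] v0.
  by exists v0; [rewrite mem_head|move=> v; rewrite inE => /eqP ->].
have [c cin cmin] := IH v1; have [v0c|cv0] := leP v0 c.
  exists v0; first by rewrite mem_head.
  by move=> v; rewrite inE => /predU1P[->//|/cmin]; exact: le_trans.
exists c => [|v]; first by rewrite inE cin orbT.
by rewrite inE => /predU1P[->|/cmin//]; exact: ltW.
Qed.

(** * The maximal operator of a nested family of sets *)

Section Doob.
Context d (T : measurableType d) (R : realType) (m : {measure set T -> \bar R}).
Local Open Scope ereal_scope.
Implicit Types (f g : T -> \bar R) (A B : set T).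

(** The maximal members of a finite nested family are disjoint and have the same union. The
    induction on the list finds them: a head lying inside another member is dropped, and otherwise
    the members inside the head are dropped and what remains is disjoint from it. *)
Lemma int_le_nested_union (F : nat -> set T) f g (l : seq nat) :
  (forall i, measurable (F i)) -> nested F -> nnmf f -> nnmf g ->
  (forall i, i \in l -> \int[m]_(x in F i) f x <= \int[m]_(x in F i) g x) ->
  \int[m]_(x in \bigcup_(i in [set` l]) F i) f x <=
  \int[m]_(x in \bigcup_(i in [set` l]) F i) g x.
Proof.
move=> mF nF nf ng; have [n] := ubnP (size l); elim: n l => // n IH [|i l] /=.
  by move=> _ _; rewrite set_nil bigcup_set0 !integral_set0.
rewrite ltnS => ln fg; have mU (k : seq nat) : measurable (\bigcup_(j in [set` k]) F j).
  by rewrite bigcup_seq; apply: bigsetU_measurable.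
have cons_l : \bigcup_(j in [set` i :: l]) F j = F i `|` \bigcup_(j in [set` l]) F j.
  by rewrite !bigcup_seq big_cons.
have [[j [jl Fij]]|nFi] := pselect (exists j, j \in l /\ F i `<=` F j).
  rewrite cons_l setUidr; last by move=> x /Fij Fjx; exists j.
  by apply: IH => // k kl; apply: fg; rewrite inE kl orbT.
pose l' := [seq j <- l | ~~ `[< F j `<=` F i >]].
have -> : \bigcup_(j in [set` i :: l]) F j = F i `|` \bigcup_(j in [set` l']) F j.
  rewrite cons_l; apply/seteqP; split => [x [|[j /= jl Fjx]]|x [|[j /=]]]; try by left.
    have [ji|ji] := pselect (F j `<=` F i); first by left; apply: ji.
    by right; exists j => //=; rewrite mem_filter jl andbT; apply/asboolPn.
  by rewrite mem_filter => /andP[_ jl] Fjx; right; exists j.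
have dis : F i `&` \bigcup_(j in [set` l']) F j = set0.
  rewrite -subset0 => x [Fix [j /=]]; rewrite mem_filter => /andP[/asboolPn ji jl] Fjx.
  have [ij|//|ij0] := nF i j; first by apply: nFi; exists j.
  by have : (F i `&` F j) x by []; rewrite ij0.
rewrite !int_setU//; apply: leeD; first by apply: fg; rewrite mem_head.
apply: IH => [|j]; first by rewrite (leq_ltn_trans _ ln)// size_filter count_size.
by rewrite mem_filter => /andP[_ jl]; apply: fg; rewrite inE jl orbT.
Qed.

Variables (p q : R).
Hypotheses (p1 : (1 < p)%R) (pq : (p^-1 + q^-1 = 1)%R).

Let p0 : (0 < p)%R. Proof. exact: lt_trans p1. Qed.
Let q0 : (0 < q)%R. Proof. exact: conjugate_gt0 pq. Qed.
Let p1q : ((p - 1) * q = p)%R. Proof. exact: conjugate_mul. Qed.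

Lemma powR_diff_le (a c : R) : (0 <= a)%R -> (0 <= c)%R ->
  (c `^ p - a `^ p <= q * (c * (c `^ (p - 1) - a `^ (p - 1))))%R.
Proof.
move=> a0 c0; have := conjugate_powR c0 (powR_ge0 a (p - 1)) p0 q0 pq.
rewrite -powRrM p1q -(ler_pM2l q0).
rewrite !mulrBr (mulr_powRB1 c0 p0) mulrDr (mulrCA q (a `^ p)%R) divff ?gt_eqF// mulr1.
have -> : (q * (c `^ p / p) = (q - 1) * c `^ p)%R.
  rewrite mulrCA mulrC; congr (_ * _)%R.
  have pn : p != 0%R by rewrite gt_eqF.
  apply: (mulIf pn); rewrite divfK//.
  by move: p1q; set pp := p; set qq := q; lra.
rewrite mulrBl mul1r; lra.
Qed.

(* For a function [Y] with finitely many values and [a >= 0], the layers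
   {Y >= c} above the level [a] telescope. *)
Lemma int_powR_levels (Y : T -> R) (vals : seq R) (s : T -> \bar R) f :
  (forall x, 0 <= Y x)%R -> measurable_fun [set: T] Y -> (forall x, Y x \in vals) ->
  nnmf s -> nnmf f ->
  (forall c : R, (0 < c)%R ->
    \int[m]_(x in [set x | (c <= Y x)%R]) (c%:E * s x) <=
    \int[m]_(x in [set x | (c <= Y x)%R]) (f x * s x)) ->
  forall a : R, (0 <= a)%R ->
  \int[m]_x ((Num.max (Y x `^ p - a `^ p) 0)%:E * s x) <=
  q%:E * \int[m]_x (f x * (Num.max (Y x `^ (p - 1) - a `^ (p - 1)) 0)%:E * s x).
Proof.
move=> Y0 mY Yv ns nf weak a.
have npow r b : nnmf (fun x => (Num.max (Y x `^ r - b `^ r) 0)%:E).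
  apply: nnmf_EFin => [|x]; last by rewrite le_max lexx orbT.
  apply: measurable_maxr => //; apply: measurable_funB => //.
  by apply: measurableT_comp (measurable_powR r) mY.
have mYge c : measurable [set x | (c <= Y x)%R].
  rewrite -[X in measurable X]setTI.
  by apply: (measurable_fun_le measurableT (measurable_cst c) mY).
have p10 : (0 < p - 1)%R by rewrite subr_gt0.
have [n] := ubnP (size [seq v <- vals | (a < v)%R]); elim: n a => // n IH a.
rewrite ltnS => ln a0.
case E : [seq v <- vals | (a < v)%R] => [|v0 vs].
  have Ya x : (Y x <= a)%R.
    rewrite leNgt; apply/negP => aY.
    have : Y x \in [seq v <- vals | (a < v)%R] by rewrite mem_filter aY Yv.
    by rewrite E.
  rewrite [X in X <= _](_ : _ = 0).
    by apply: mule_ge0; [rewrite lee_fin ltW|apply: int_ge0; nnmf].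
  apply: integral0_eq => x _; rewrite max_r ?mul0e// subr_le0.
  by apply: ge0_ler_powR; rewrite ?nnegrE// (ltW p0).
(* With [c] the smallest value of [Y] above [a], the sets {Y > a} and {Y >= c} coincide, so exactly
   one layer splits off both integrals and the induction continues from [c]. *)
have [c [cv ca cmin]] : exists c, [/\ c \in vals, (a < c)%R &
    forall v, v \in vals -> (a < v)%R -> (c <= v)%R].
  have [c] := exists_min_mem v0 vs.
  rewrite -E mem_filter => /andP[ac cv] cmin; exists c; split=> // v vv av.
  by apply: cmin; rewrite mem_filter av vv.
have c0 : (0 <= c)%R by rewrite (le_trans a0)// ltW.
have cgt0 : (0 < c)%R by rewrite (le_lt_trans a0).
have ltc : (size [seq v <- vals | (c < v)%R] < n)%N.
  apply: leq_trans ln; rewrite (_ : [seq v <- vals | _] =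
      [seq v <- [seq v <- vals | (a < v)%R] | (c < v)%R]); last first.
    rewrite -filter_predI; apply: eq_filter => v /=.
    by case: ltP => // c_v; rewrite (lt_trans ca c_v).
  rewrite [ltnLHS]size_filter; move: (count_size (fun v => (c < v)%R)
    [seq v <- vals | (a < v)%R]); rewrite leq_eqVlt => /predU1P[|//].
  move/eqP; rewrite -all_count => /allP /(_ c); rewrite mem_filter ca cv ltxx.
  by move=> /(_ isT).
have Yge x : ((c <= Y x) = (a < Y x))%R.
  by apply/idP/idP => [cY|aY]; [exact: lt_le_trans cY|exact: cmin].
pose C := [set x | (c <= Y x)%R].
have split_max (r : R) : (0 < r)%R -> forall x, (Num.max (Y x `^ r - a `^ r) 0 =
    Num.max (Y x `^ r - c `^ r) 0 + (c `^ r - a `^ r) * \1_C x)%R.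
  move=> r0 x; rewrite indicE.
  have [cY|cY] := boolP (c <= Y x)%R.
    rewrite mem_set// mulr1 !max_l; first by rewrite addrA subrK.
      by rewrite subr_ge0 ge0_ler_powR ?nnegrE// ltW.
    by rewrite subr_ge0 ge0_ler_powR ?nnegrE ?(ltW r0)// (le_trans (ltW ca)).
  rewrite memNset; last by apply/negP.
  rewrite mulr0 addr0 !max_r//.
    by rewrite subr_le0 ge0_ler_powR ?nnegrE ?(ltW r0)// ltW// ltNge.
  by rewrite subr_le0 ge0_ler_powR ?nnegrE ?(ltW r0)// leNgt -Yge.
have ge0ca (r : R) : (0 < r)%R -> (0 <= c `^ r - a `^ r)%R.
  by move=> r0; rewrite subr_ge0 ge0_ler_powR ?nnegrE// ltW.
have mC : measurable C by exact: mYge.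
have nC : nnmf (fun x => (\1_C x : R)%:E) by exact: nnmf_indic.
have hmax (r : R) x : (0 <= Num.max (Y x `^ r - c `^ r) 0)%R.
  by rewrite le_max lexx orbT.
have hind (r : R) x : (0 < r)%R -> (0 <= (c `^ r - a `^ r) * \1_C x)%R.
  by move=> r0; rewrite mulr_ge0 ?ge0ca// indicE; case: (_ \in _).
have -> : \int[m]_x ((Num.max (Y x `^ p - a `^ p) 0)%:E * s x) =
    \int[m]_x ((Num.max (Y x `^ p - c `^ p) 0)%:E * s x) +
    (c `^ p - a `^ p)%:E * \int[m]_(x in C) s x.
  rewrite -(nnmf_int_indic m mC ns) -intZl//; [|by nnmf|by rewrite lee_fin ge0ca].
  rewrite -intD//; [|by nnmf|by nnmf; rewrite lee_fin ge0ca].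
  apply: eq_integral => x _; rewrite split_max// EFinD.
  rewrite ge0_muleDl ?lee_fin ?hmax ?hind//.
  by rewrite EFinM -muleA (muleC (s x)).
have -> : \int[m]_x (f x * (Num.max (Y x `^ (p - 1) - a `^ (p - 1)) 0)%:E * s x) =
    \int[m]_x (f x * (Num.max (Y x `^ (p - 1) - c `^ (p - 1)) 0)%:E * s x) +
    (c `^ (p - 1) - a `^ (p - 1))%:E * \int[m]_(x in C) (f x * s x).
  have nfs : nnmf (fun x => f x * s x) by nnmf.
  rewrite -(nnmf_int_indic m mC nfs) -intZl//; [|by nnmf|by rewrite lee_fin ge0ca].
  rewrite -intD//; [|by nnmf|by nnmf; rewrite lee_fin ge0ca].
  apply: eq_integral => x _; rewrite split_max// EFinD.
  rewrite ge0_muleDr ?ge0_muleDl ?lee_fin ?hmax ?hind//.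
  - by rewrite EFinM; congr (_ + _); rewrite -!muleA muleCA (muleC (s x)).
  - by rewrite mule_ge0 ?(nnmf_ge0 _ nf)// lee_fin hmax.
  - by rewrite mule_ge0 ?(nnmf_ge0 _ nf)// lee_fin hind.
rewrite [leRHS]ge0_muleDr; last 2 first.
- by apply: int_ge0; nnmf.
- by rewrite mule_ge0 ?lee_fin ?ge0ca//; apply: int_ge0; nnmf.
apply: leeD; first exact: IH.
have := weak _ cgt0; rewrite intZl// => wc.
apply: (@le_trans _ _ (q%:E * ((c `^ (p - 1) - a `^ (p - 1))%:E *
    (c%:E * \int[m]_(x in C) s x)))); last first.
  by rewrite lee_pmul2l// lee_wpmul2l// lee_fin ge0ca.
rewrite !muleA -!EFinM lee_wpmul2r//; first exact: int_ge0.
by rewrite lee_fin -mulrA (mulrC (_ - _)%R) powR_diff_le.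
Qed.

End Doob.

(** A finite stage of the maximal function. It is real and takes finitely many values, which turns
    the layer-cake formula into a finite telescoping sum. *)
Fixpoint fmax (T : Type) (R : realType) (F : nat -> set T) (a : nat -> R) n x : R :=
  if n is k.+1 then Num.max (fmax F a k x) (a k * \1_(F k) x) else 0.

Section weighted_average.
Context d (T : measurableType d) (R : realType) (m : {measure set T -> \bar R}).
Local Open Scope ereal_scope.

Definition mass (s : T -> R) (A : set T) : \bar R := \int[m]_(x in A) (s x)%:E.

(** Since [fine +oo = 0] and [0^-1 = 0], the average over a set of zero or infinite mass is 0; the
    empty set can thus be a member of the family. *)
Definition wavg (s : T -> R) (f : T -> \bar R) (A : set T) : \bar R :=
  (fine (mass s A))^-1%:E * \int[m]_(x in A) (f x * (s x)%:E).

Definition dmax (s : T -> R) (F : nat -> set T) (f : T -> \bar R) (x : T) : \bar R :=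
  ereal_sup (range (fun i => wavg s f (F i) * (\1_(F i) x)%:E)).

Definition weight (s : T -> R) := measurable_fun [set: T] s /\ forall x, (0 < s x)%R.

Lemma weight_nnmf s : weight s -> nnmf (fun x => (s x)%:E).
Proof. by move=> [ms s0]; apply: nnmf_EFin => // x; rewrite ltW. Qed.

Lemma mass_ge0 s A : weight s -> 0 <= mass s A.
Proof. by move=> /weight_nnmf ns; apply: int_ge0. Qed.

Lemma wavg_ge0 s f A : weight s -> nnmf f -> 0 <= wavg s f A.
Proof.
move=> ws nf; apply: mule_ge0; first by rewrite lee_fin invr_ge0 fine_ge0 ?mass_ge0.
have ns := weight_nnmf ws; by apply: int_ge0; nnmf.
Qed.

Lemma wavgK s f A : weight s -> mass s A < +oo -> 0 < mass s A ->
  mass s A * wavg s f A = \int[m]_(x in A) (f x * (s x)%:E).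
Proof.
move=> ws Aoo A0; rewrite /wavg muleA -[X in X * _ * _]fineK ?gt0_fin_numE//.
by rewrite -EFinM divff ?mul1e// gt_eqF// fine_gt0// A0.
Qed.

Lemma nnmf_dmax s F f : weight s -> (forall i, measurable (F i)) -> nnmf f ->
  nnmf (dmax s F f).
Proof.
move=> ws mF nf; apply: nnmf_ereal_sup => i; apply: nnmfM.
  by apply: nnmf_cst; exact: wavg_ge0.
exact: nnmf_indic.
Qed.

Lemma le_dmax s F f i x : F i x -> wavg s f (F i) <= dmax s F f x.
Proof.
by move=> Fx; apply: ereal_sup_ubound; exists i => //; rewrite indicE mem_set// mule1.
Qed.

End weighted_average.

Section fmax_lemmas.
Context d (T : measurableType d) (R : realType).
Variables (F : nat -> set T) (a : nat -> R).
Hypotheses (mF : forall i, measurable (F i)) (a0 : forall i, 0 <= a i).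

Lemma fmax_ge0 n x : 0 <= fmax F a n x.
Proof. by case: n => //= n; elim: n => [|n IH] /=; rewrite le_max ?lexx// IH. Qed.

Lemma measurable_fmax n : measurable_fun [set: T] (fmax F a n).
Proof.
elim: n => [|n IH] /=; first exact: measurable_cst.
by apply: measurable_maxr => //; apply: measurable_funM => //; exact: measurable_indic.
Qed.

Lemma fmax_mem n x : fmax F a n x \in 0 :: [seq a i | i <- iota 0 n].
Proof.
elim: n => [|n IH]; first by rewrite mem_head.
rewrite -addn1 iotaD map_cat -cat_cons mem_cat addn1 [fmax _ _ _ _]/= add0n.
rewrite /Num.max; case: ifP => _; last by rewrite IH.
rewrite indicE; case: (x \in F n); first by rewrite mulr1 mem_seq1 eqxx orbT.
by rewrite mulr0 mem_head.
Qed.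

Lemma fmax_ge n (c : R) x : 0 < c ->
  (c <= fmax F a n x) <-> exists i, [/\ (i < n)%N, c <= a i & F i x].
Proof.
move=> c0; elim: n => [|n IH] /=.
  by split=> [|[i []//]]; rewrite leNgt c0.
rewrite le_max; split=> [/orP[/IH[i [ni ci Fi]]|]|[i [ni ci Fi]]].
- by exists i; split => //; exact: ltnW.
- rewrite indicE; case: (boolP (x \in F n)) => [/set_mem Fx|_]; rewrite ?mulr1 ?mulr0.
    by move=> ca; exists n.
  by rewrite leNgt c0.
- move: ni; rewrite ltnS leq_eqVlt => /predU1P[ein|ni].
    by apply/orP; right; rewrite -ein indicE mem_set// mulr1.
  by apply/orP; left; apply/IH; exists i.
Qed.

Lemma fmax_nd n k x : (n <= k)%N -> fmax F a n x <= fmax F a k x.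
Proof.
move=> /subnK <-; elim: (k - n)%N => [|j IH]; first by rewrite add0n.
by rewrite addSn /= le_max IH.
Qed.

Lemma fmax_powR_le n (p : R) x : 0 < p ->
  (fmax F a n.+1 x) `^ p <= (fmax F a n x) `^ p + a n `^ p * \1_(F n) x.
Proof.
move=> p0 /=; rewrite indicE; case: (_ \in _); rewrite ?mulr1 ?mulr0; last first.
  by rewrite max_l ?fmax_ge0// addr0.
rewrite /Num.max; case: ifP => _; first by rewrite lerDr powR_ge0.
by rewrite lerDl powR_ge0.
Qed.

End fmax_lemmas.

Section Doob_inequality.
Context d (T : measurableType d) (R : realType) (m : {measure set T -> \bar R}).
Local Open Scope ereal_scope.
Variables (p q : R).
Hypotheses (p1 : (1 < p)%R) (pq : (p^-1 + q^-1 = 1)%R).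

Let p0 : (0 < p)%R. Proof. exact: lt_trans p1. Qed.
Let q0 : (0 < q)%R. Proof. exact: conjugate_gt0 pq. Qed.
Let p1q : ((p - 1) * q = p)%R. Proof. exact: conjugate_mul. Qed.

Variables (s : T -> R) (F : nat -> set T) (f : T -> \bar R).
Hypotheses (ws : weight s) (mF : forall i, measurable (F i)) (nF : nested F).
Hypotheses (Foo : forall i, mass m s (F i) < +oo) (nf : nnmf f).

Let ns : nnmf (fun x => (s x)%:E). Proof. exact: weight_nnmf. Qed.

(** A level set of [fmax] is a union of members whose average is at least the level, which gives the
    weak-type inequality that [int_powR_levels] needs at [a = 0]. Young's inequality for q f and
    fmax^(p-1) then returns the share 1/q of the left side; absorbing it leaves the constant q^p. *)
Lemma doob_fmax (a : nat -> R) n : (forall i, wavg m s f (F i) = (a i)%:E) ->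
  \int[m]_x (poweR (f x) p * (s x)%:E) < +oo ->
  \int[m]_x ((fmax F a n x `^ p)%:E * (s x)%:E) <=
  (q `^ p)%:E * \int[m]_x (poweR (f x) p * (s x)%:E).
Proof.
move=> aE foo.
have a0 i : (0 <= a i)%R by rewrite -lee_fin -aE wavg_ge0.
have mY := measurable_fmax a mF.
have npow k r : nnmf (fun x => (fmax F a k x `^ r)%:E).
  apply: nnmf_EFin => [|x]; last exact: powR_ge0.
  exact: measurableT_comp (measurable_powR r) (mY k).
pose X k := \int[m]_x ((fmax F a k x `^ p)%:E * (s x)%:E).
have X0 k : 0 <= X k by apply: int_ge0; nnmf.
(* Finiteness is what makes the later absorption legitimate; it holds because only finitely many
   sets of finite mass occur. *)
have Xoo k : X k < +oo.
  elim: k => [|k IH].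
    rewrite /X [X in X < _](_ : _ = 0)//; apply: integral0_eq => x _ /=.
    by rewrite powR0 ?mul0e// gt_eqF.
  have ap0 : 0 <= (a k `^ p)%:E by rewrite lee_fin powR_ge0.
  apply: (@le_lt_trans _ _ (X k + (a k `^ p)%:E * mass m s (F k))); last first.
    by rewrite lte_add_pinfty// lte_mul_pinfty// ge0_fin_numE//.
  rewrite /mass -(nnmf_int_indic m (mF k) ns) -intZl//; last by nnmf.
  rewrite -intD//; [|by nnmf|by nnmf].
  apply: int_le => //; [by nnmf|by nnmf|move=> x _].
  rewrite (muleC (s x)%:E) muleA -EFinM -!EFinM -EFinD lee_fin -mulrDl.
  by rewrite ler_wpM2r ?fmax_powR_le//; case: ws => _ /(_ x)/ltW.
have weak (c : R) : (0 < c)%R ->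
    \int[m]_(x in [set x | (c <= fmax F a n x)%R]) (c%:E * (s x)%:E) <=
    \int[m]_(x in [set x | (c <= fmax F a n x)%R]) (f x * (s x)%:E).
  move=> c0; have cE0 : 0 <= c%:E by rewrite lee_fin ltW.
  have -> : [set x | (c <= fmax F a n x)%R] =
      \bigcup_(i in [set` [seq i <- iota 0 n | (c <= a i)%R]]) F i.
    apply/seteqP; split=> [x /= /(fmax_ge _ _ _ _ c0)[i [ni ci Fi]]|x [i /=]].
      by exists i => //=; rewrite mem_filter ci mem_iota.
    rewrite mem_filter mem_iota /= add0n => /andP[ci ni] Fi.
    by apply/fmax_ge => //; exists i.
  apply: int_le_nested_union => //; [by nnmf|by nnmf|move=> i].
  rewrite mem_filter => /andP[ci _].
  have Fi0 : 0 < mass m s (F i).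
    rewrite lt0e mass_ge0// andbT; apply/eqP => Fi0.
    by move: (aE i); rewrite /wavg Fi0 /= invr0 mul0e => -[ai0]; move: ci; rewrite -ai0 leNgt c0.
  rewrite intZl// -(wavgK f ws (Foo i) Fi0) aE muleC.
  by rewrite -/(mass m s (F i)) lee_pmul2l ?gt0_fin_numE// lee_fin.
have := int_powR_levels p1 pq (fmax_ge0 F a n) (mY n) (fmax_mem F a n) ns nf weak (lexx 0%R).
rewrite !powR0 ?gt_eqF ?subr_gt0//.
under eq_integral => x _ do rewrite subr0 max_l ?powR_ge0//.
under [X in _ <= _ * X]eq_integral => x _ do rewrite subr0 max_l ?powR_ge0//.
rewrite -/(X n) => XB.
have nfp : nnmf (fun x => poweR (f x) p * (s x)%:E) by nnmf.
set I := \int[m]_x _ in foo *.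
have I0 : 0 <= I by exact: int_ge0.
have Ifin : I \is a fin_num by rewrite ge0_fin_numE.
have Xfin : X n \is a fin_num by rewrite ge0_fin_numE.
have qp0 : 0 <= (p^-1 * q `^ p)%:E by rewrite lee_fin mulr_ge0 ?powR_ge0// invr_ge0 ltW.
have qV0 : 0 <= (q^-1)%:E by rewrite lee_fin invr_ge0 ltW.
have : X n <= (p^-1 * q `^ p)%:E * I + (q^-1)%:E * X n.
  apply: (le_trans XB); rewrite -intZl//; [|by nnmf|by rewrite lee_fin ltW].
  rewrite -intZl// -intZl//; last by nnmf.
  rewrite -intD//; [|by nnmf|by nnmf].
  apply: int_le => //; [by nnmf; rewrite lee_fin ltW|by nnmf|move=> x _].
  rewrite !muleA -ge0_muleDl ?mule_ge0 ?poweR_ge0 ?lee_fin ?powR_ge0//.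
  rewrite lee_wpmul2r ?(nnmf_ge0 _ ns)//.
  have qf0 : 0 <= q%:E * f x by rewrite mule_ge0 ?(nnmf_ge0 _ nf)// lee_fin ltW.
  have Yp0 : 0 <= (fmax F a n x `^ (p - 1))%:E by rewrite lee_fin powR_ge0.
  apply: (le_trans (young_poweR p1 pq qf0 Yp0)).
  rewrite poweRM ?(nnmf_ge0 _ nf) ?lee_fin ?(ltW q0)//= -powRrM p1q.
  by rewrite muleA.
rewrite -(fineK Ifin) -(fineK Xfin) -!EFinM -EFinD !lee_fin.
have := pq; set x := fine (X n); set i := fine I; set b := (q `^ p)%R => pq1 h.
have h2 : (p^-1 * x <= p^-1 * (b * i))%R.
  have -> : (p^-1 * x = x - q^-1 * x)%R by rewrite -[X in (X - _)%R]mul1r -mulrBl -pq1 addrK.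
  by rewrite lerBlDr mulrA.
by rewrite ler_pM2l ?invr_gt0 in h2.
Qed.

Lemma poweR_ereal_sup_le (A : set \bar R) (B : \bar R) :
  (forall y, A y -> 0 <= y) -> A !=set0 -> (forall y, A y -> poweR y p <= B) ->
  poweR (ereal_sup A) p <= B.
Proof.
move=> A0 [y0 Ay0] AB; have B0 : 0 <= B by exact: le_trans (poweR_ge0 _ _) (AB _ Ay0).
have pn : p != 0%R by rewrite gt_eqF.
have BE : B = poweR (poweR B p^-1) p by rewrite -poweRrM mulVf// poweRe1.
have supB : ereal_sup A <= poweR B p^-1.
  apply: ge_ereal_sup => y Ay.
  have yE : y = poweR (poweR y p) p^-1 by rewrite -poweRrM mulfV// poweRe1// A0.
  rewrite yE; apply: gt0_ler_poweR; rewrite ?in_itv/= ?leey ?andbT ?poweR_ge0 ?AB//.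
  by rewrite invr_ge0 ltW.
rewrite BE; apply: gt0_ler_poweR; rewrite ?in_itv/= ?leey ?andbT ?poweR_ge0 ?(ltW p0)//.
by rewrite (le_trans (A0 _ Ay0))// ereal_sup_ubound.
Qed.

Lemma doob : \int[m]_x (poweR (dmax m s F f x) p * (s x)%:E) <=
  (q `^ p)%:E * \int[m]_x (poweR (f x) p * (s x)%:E).
Proof.
have nfp : nnmf (fun x => poweR (f x) p * (s x)%:E) by nnmf.
have [foo|] := ltP (\int[m]_x (poweR (f x) p * (s x)%:E)) +oo; last first.
  by rewrite leye_eq => /eqP ->; rewrite gt0_muley ?leey// lte_fin powR_gt0.
have s0 x : 0 <= (s x)%:E by exact: nnmf_ge0 ns.
have f0 x : 0 <= f x by exact: nnmf_ge0 nf.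
(* The bound f <= 1 + f^p makes [f] integrable on every set of the family, so that all averages are
   real numbers and [doob_fmax] applies. *)
have Ifin i : \int[m]_(x in F i) (f x * (s x)%:E) < +oo.
  apply: (@le_lt_trans _ _ (mass m s (F i) + \int[m]_x (poweR (f x) p * (s x)%:E))).
    apply: (@le_trans _ _ (mass m s (F i) + \int[m]_(x in F i) (poweR (f x) p * (s x)%:E))).
      rewrite -intD//; apply: int_le => //; [by nnmf|by nnmf|move=> x _].
      rewrite -[X in _ <= X + _]mul1e -ge0_muleDl ?poweR_ge0//.
      rewrite lee_wpmul2r//; have [f1|f1] := leP (f x) 1.
        by rewrite (le_trans f1)// leeDl ?poweR_ge0.
      case: (f x) (f0 x) f1 => [r r0|_ _|//]; last by rewrite poweRyr ?gt_eqF// addey.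
      rewrite lte_fin => r1; rewrite poweR_EFin -EFinD lee_fin.
      by rewrite (le_trans (le1r_powR (ltW r1) (ltW p1)))// lerDr.
    by rewrite leeD2l// int_subset.
  by rewrite lte_add_pinfty.
pose a i := fine (wavg m s f (F i)).
have aE i : wavg m s f (F i) = (a i)%:E.
  rewrite /a fineK// /wavg fin_numM// ge0_fin_numE//.
  by apply: int_ge0; nnmf.
have a0 i : (0 <= a i)%R by rewrite -lee_fin -aE wavg_ge0.
have nG n : nnmf (fun x => (fmax F a n x `^ p)%:E * (s x)%:E).
  apply: nnmfM => //; apply: nnmf_EFin => [|x]; last exact: powR_ge0.
  exact: measurableT_comp (measurable_powR p) (measurable_fmax a mF n).
have ndG x : nondecreasing_seq (fun n => (fmax F a n x `^ p)%:E * (s x)%:E).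
  move=> n k nk; rewrite lee_wpmul2r// lee_fin ge0_ler_powR ?nnegrE ?fmax_ge0 ?(ltW p0)//.
  exact: fmax_nd.
have cvg := @cvg_monotone_convergence _ _ _ m setT measurableT _ (fun n => (nG n).1)
  (fun n x _ => (nG n).2 x) (fun x _ => ndG x).
apply: (@le_trans _ _ (\int[m]_x limn (fun n => (fmax F a n x `^ p)%:E * (s x)%:E))).
  apply: ge0_le_integral => //.
  - by move=> x _; rewrite mule_ge0 ?poweR_ge0.
  - by apply: nnmfS; apply: nnmfM => //; apply: nnmf_poweR; exact: nnmf_dmax.
  - apply: emeasurable_fun_cvg (fun n => (nG n).1) _ => x _.
    by apply: ereal_nondecreasing_is_cvgn; exact: ndG.
  move=> x _; set L := limn _.
  have sx0 : (0 < s x)%R by case: ws.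
  have GL n : (fmax F a n x `^ p)%:E * (s x)%:E <= L.
    apply: lime_ge; first by apply: ereal_nondecreasing_is_cvgn; exact: ndG.
    by exists n => // k /= nk; exact: ndG.
  rewrite -lee_pdivlMr//; apply: poweR_ereal_sup_le => [_ [i _ <-]||_ [i _ <-]].
  - by rewrite mule_ge0 ?wavg_ge0// lee_fin indicE; case: (_ \in _).
  - by exists (wavg m s f (F 0) * (\1_(F 0) x)%:E); exists 0%N.
  rewrite lee_pdivlMr//; apply: le_trans (GL i.+1); rewrite lee_wpmul2r// aE -EFinM.
  rewrite poweR_EFin lee_fin ge0_ler_powR ?nnegrE ?(ltW p0) ?fmax_ge0//.
    by rewrite mulr_ge0 ?a0// indicE; case: (_ \in _).
  by rewrite /= le_max lexx orbT.
rewrite -(cvg_lim _ cvg)//; apply: lime_le; first by apply/cvg_ex; eexists; exact: cvg.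
by apply: nearW => n; exact: doob_fmax.
Qed.

End Doob_inequality.

Section mass_lemmas.
Context d (T : measurableType d) (R : realType) (m : {measure set T -> \bar R}).
Local Open Scope ereal_scope.

Lemma weight_div (u s : T -> R) : weight u -> weight s -> weight (fun x => u x / s x)%R.
Proof.
move=> [mu u0] [ms s0]; split=> [|x]; last by rewrite divr_gt0.
rewrite (_ : (fun x => _) = (fun x => u x * s x `^ (-1))%R); last first.
  by apply/funext => x; rewrite powR_inv1// ltW.
apply: measurable_funM => //.
exact: measurableT_comp (measurable_powR (-1)) ms.
Qed.

Lemma mass_gt0 (s : T -> R) A : measurable A -> weight s -> 0 < m A -> 0 < mass m s A.
Proof. by move=> mA [ms s0]; exact: int_gt0. Qed.

Lemma mass_gt0_measure (s : T -> R) A : measurable A -> weight s ->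
  0 < mass m s A -> 0 < m A.
Proof.
move=> mA [ms _] A0; rewrite lt0e measure_ge0 andbT; apply/eqP => mA0.
move: A0; rewrite /mass null_set_integral ?ltxx//.
by apply/measurable_funTS/measurable_EFinP.
Qed.

Lemma mass_le (s : T -> R) A B : measurable A -> measurable B -> weight s ->
  A `<=` B -> mass m s A <= mass m s B.
Proof. by move=> mA mB ws; apply: int_subset => //; exact: weight_nnmf. Qed.

End mass_lemmas.

(** * Sparse forms and maximal operators under the A_p condition *)

Section weight_triple.
Context d (T : measurableType d) (R : realType).
Variables (p q : R) (u w s : T -> R).
Hypotheses (p1 : (1 < p)%R) (pq : (p^-1 + q^-1 = 1)%R).
Hypotheses (wu : weight u) (ww : weight w) (ws : weight s).
Hypothesis uws : forall x, u x = w x `^ p^-1 * s x `^ q^-1.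

(** The exponents of [s] cancel, as p / q - p + 1 = 0. The identity turns the L^p(w) norm of f into
    the L^p(s) norm of f u / s, on which the maximal operator of [s] acts. *)
Lemma triple_powl x : (u x / s x) `^ p * s x = w x.
Proof.
have p0 : 0 < p by exact: lt_trans p1.
have [[_ /(_ x) w0] [_ /(_ x) s0]] := (ww, ws).
rewrite uws powRM ?mulr_ge0 ?powR_ge0 ?invr_ge0 ?(ltW s0)// powRM ?powR_ge0//.
rewrite -!powRrM mulVf ?gt_eqF// powRr1 ?(ltW w0)// -(powR_inv1 (ltW s0)) -powRrM.
rewrite -!mulrA -[in X in _ * (_ * (_ * X))](powRr1 (ltW s0)).
rewrite -!powRD ?(gt_eqF s0) ?implybT//.
suff -> : q^-1 * p + (-1 * p + 1) = 0 by rewrite powRr0 mulr1.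
have -> : q^-1 = 1 - p^-1 by rewrite -pq addrAC subrr add0r.
by rewrite mulrBl mulVf ?gt_eqF//; lra.
Qed.

End weight_triple.

Section weighted_bounds.
Context d (T : measurableType d) (R : realType) (m : {measure set T -> \bar R}).
Local Open Scope ereal_scope.
Variables (p q : R) (u w s : T -> R).
Hypotheses (p1 : (1 < p)%R) (pq : (p^-1 + q^-1 = 1)%R).
Hypotheses (wu : weight u) (ww : weight w) (ws : weight s).
Hypothesis uws : forall x, (u x = w x `^ p^-1 * s x `^ q^-1)%R.

Let p0 : (0 < p)%R. Proof. exact: lt_trans p1. Qed.
Let q0 : (0 < q)%R. Proof. exact: conjugate_gt0 pq. Qed.
Let q1 : (1 < q)%R. Proof. exact: conjugate_gt1 pq. Qed.
Let qp : (q^-1 + p^-1 = 1)%R. Proof. exact: conjugate_sym. Qed.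
Let suw x : (u x = s x `^ q^-1 * w x `^ p^-1)%R. Proof. by rewrite mulrC. Qed.
Let nu := weight_nnmf wu.
Let nw := weight_nnmf ww.
Let ns := weight_nnmf ws.

Variables (F : nat -> set T) (W : R).
Hypotheses (mF : forall i, measurable (F i)) (nF : nested F).
Hypotheses (uoo : forall i, mass m u (F i) < +oo) (woo : forall i, mass m w (F i) < +oo)
  (soo : forall i, mass m s (F i) < +oo).
Hypothesis W0 : (0 <= W)%R.
Hypothesis Ap : forall i, (fine (mass m w (F i)) * fine (mass m s (F i)) `^ (p - 1)
  <= W * fine (mass m u (F i)) `^ p)%R.

Let pos i : 0 < mass m u (F i) ->
  [/\ (0 < fine (mass m u (F i)))%R, (0 < fine (mass m w (F i)))%R &
      (0 < fine (mass m s (F i)))%R].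
Proof.
move=> /(mass_gt0_measure (mF i) wu) F0.
by split; rewrite fine_gt0// ?uoo ?woo ?soo andbT; exact: mass_gt0.
Qed.

Let massE (v : T -> R) i : weight v -> mass m v (F i) < +oo ->
  mass m v (F i) = (fine (mass m v (F i)))%:E.
Proof. by move=> wv voo; rewrite fineK// ge0_fin_numE// mass_ge0. Qed.

Lemma triple_int (g : T -> \bar R) : nnmf g ->
  \int[m]_x (poweR (g x * (u x / s x)%:E) p * (s x)%:E) =
  \int[m]_x (poweR (g x) p * (w x)%:E).
Proof.
move=> ng; apply: eq_integral => x _.
have us0 : 0 <= (u x / s x)%:E.
  by have [_ /(_ x) us0] := weight_div wu ws; rewrite lee_fin ltW.
rewrite poweRM ?(nnmf_ge0 _ ng)// -muleA poweR_EFin -EFinM.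
by rewrite (triple_powl p1 pq ww ws uws).
Qed.

Lemma mass_div (v v' : T -> R) (g : T -> \bar R) A : weight v' ->
  \int[m]_(x in A) (g x * (v x / v' x)%:E * (v' x)%:E) =
  \int[m]_(x in A) (g x * (v x)%:E).
Proof.
move=> [_ v'0]; apply: eq_integral => x _.
by rewrite -muleA -EFinM divfK ?gt_eqF.
Qed.

Let psi (g : T -> \bar R) x := g x * (u x / w x)%:E.
Let phi (g : T -> \bar R) x :=
  poweR (dmax m w F (psi g) x) (q - 1) * (u x / s x)%:E.

Let npsi g : nnmf g -> nnmf (psi g).
Proof.
by move=> ng; have nuw := weight_nnmf (weight_div wu ww); rewrite /psi; nnmf.
Qed.

Let nphi g : nnmf g -> nnmf (phi g).
Proof.
move=> ng; have nus := weight_nnmf (weight_div wu ws).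
by have nd := nnmf_dmax m ww mF (npsi ng); rewrite /phi; nnmf.
Qed.

Let pq1 : ((q - 1) * (p - 1) = 1)%R.
Proof. by rewrite -(conjugate_inv p1 pq) mulVf// gt_eqF// subr_gt0. Qed.

(** Lerner's argument. On one set Q of the family, the u-average of g is w(Q) / u(Q) times the
    w-average d of [psi g]. As d is at most M_w(psi g) on Q, the s-average of [phi g] is at least
    u(Q) / s(Q) times d^(q-1). Raise this to the power p - 1, use (p - 1)(q - 1) = 1, and compare
    w(Q) / u(Q) with W (u(Q) / s(Q))^(p-1) by [Ap]. *)
Lemma dmax_le_iterated g x : nnmf g ->
  dmax m u F g x <= W%:E * poweR (dmax m s F (phi g) x) (p - 1).
Proof.
move=> ng; apply: ge_ereal_sup => _ [i _ <-].
have rhs0 : 0 <= W%:E * poweR (dmax m s F (phi g) x) (p - 1).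
  by rewrite mule_ge0// poweR_ge0.
rewrite indicE; have [/set_mem Fx|_] := boolP (x \in F i); last by rewrite mule0.
rewrite mule1; have [ui0|ui0] := leP (mass m u (F i)) 0.
  have -> : wavg m u g (F i) = 0.
    by rewrite /wavg (_ : mass _ _ _ = 0) ?invr0 ?mul0e//; apply/eqP; rewrite eq_le ui0 mass_ge0.
  by [].
have [U0 Wi0 S0] := pos ui0; have := Ap i.
have := massE wu (uoo i); have := massE ww (woo i); have := massE ws (soo i).
set U := fine _ in U0 *; set Wi := fine _ in Wi0 *; set S := fine _ in S0 *.
move=> SE WiE UE Api.
pose dd := wavg m w (psi g) (F i).
have dd0 : 0 <= dd by apply: wavg_ge0 => //; exact: npsi.
have ugE : wavg m u g (F i) = (Wi / U)%:E * dd.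
  have -> : wavg m u g (F i) = U^-1%:E * \int[m]_(x in F i) (psi g x * (w x)%:E).
    by rewrite mass_div.
  rewrite -(wavgK (psi g) ww (woo i)) ?WiE ?lte_fin//.
  by rewrite muleA -EFinM mulrC.
have SU : (U / S)%:E * poweR dd (q - 1) <= wavg m s (phi g) (F i).
  rewrite /wavg SE [fine _]/= mulrC EFinM -muleA lee_pmul2l// ?lte_fin ?invr_gt0//.
  rewrite mass_div// -UE muleC -intZl//; last exact: poweR_ge0.
  apply: int_le => //; first by nnmf; exact: poweR_ge0.
    by apply: nnmfM => //; apply: nnmf_poweR; apply: nnmf_dmax => //; exact: npsi.
  move=> y Fy; rewrite lee_wpmul2r ?(nnmf_ge0 _ nu)//.
  apply: gt0_ler_poweR; first by rewrite subr_ge0 ltW.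
  - by rewrite in_itv /= leey dd0.
  - by rewrite in_itv /= leey andbT (nnmf_ge0 _ (nnmf_dmax m ww mF (npsi ng))).
  - exact: le_dmax.
have US0 : (0 <= U / S)%R by rewrite divr_ge0 ?ltW.
have SU2 : (U / S)%:E * poweR dd (q - 1) <= dmax m s F (phi g) x.
  by apply: (le_trans SU); exact: le_dmax.
have : poweR ((U / S)%:E * poweR dd (q - 1)) (p - 1) <= poweR (dmax m s F (phi g) x) (p - 1).
  apply: gt0_ler_poweR; rewrite ?in_itv/= ?leey ?andbT//.
  - by rewrite subr_ge0 ltW.
  - by rewrite mule_ge0 ?poweR_ge0// lee_fin.
  - by rewrite (le_trans _ SU2)// mule_ge0 ?poweR_ge0// lee_fin.
rewrite poweRM ?poweR_ge0 ?lee_fin// -poweRrM pq1 poweRe1// => h.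
have W0e : 0 <= W%:E by rewrite lee_fin.
apply: le_trans (lee_wpmul2l W0e h); rewrite muleA ugE lee_wpmul2r//.
rewrite poweR_EFin -EFinM lee_fin ler_pdivrMr//.
rewrite powRM ?invr_ge0 ?(ltW U0) ?(ltW S0)// -(powR_inv1 (ltW S0)) -powRrM mulN1r.
have Sp : (0 < S `^ (p - 1))%R by rewrite powR_gt0.
rewrite -(ler_pM2r Sp); apply: (le_trans Api).
rewrite powRN -!mulrA; rewrite ler_wpM2l//.
by rewrite [(_^-1 * _)%R]mulrCA mulVf ?gt_eqF// mulr1 mulrC mulr_powRB1// ltW.
Qed.

(** Buckley's sharp exponent: [s] has A_q constant W^(q-1), and the power 1/(q-1) of it is W. The
    factors q^p and p^q come from the maximal operators of [s] on L^p(s) and of [w] on L^q(w). *)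
Lemma buckley g : nnmf g ->
  \int[m]_x (poweR (dmax m u F g x) q * (s x)%:E) <=
  (W `^ q * (q `^ p * p `^ q))%:E * \int[m]_x (poweR (g x) q * (s x)%:E).
Proof.
move=> ng; have nds := nnmf_dmax m ws mF (nphi ng).
have ndu := nnmf_dmax m wu mF ng.
have Wq0 : 0 <= (W `^ q)%:E by rewrite lee_fin powR_ge0.
apply: (@le_trans _ _ ((W `^ q)%:E *
    \int[m]_x (poweR (dmax m s F (phi g) x) p * (s x)%:E))).
  rewrite -intZl//; last by nnmf.
  apply: int_le => //; [by nnmf|by nnmf|move=> x _].
  rewrite muleA lee_wpmul2r ?(nnmf_ge0 _ ns)//.
  have -> : (W `^ q)%:E * poweR (dmax m s F (phi g) x) p =
      poweR (W%:E * poweR (dmax m s F (phi g) x) (p - 1)) q.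
    by rewrite poweRM ?poweR_ge0 ?lee_fin// -poweRrM (conjugate_mul p1 pq).
  apply: gt0_ler_poweR; rewrite ?in_itv/= ?leey ?andbT ?(ltW q0)//.
  - exact: nnmf_ge0.
  - by rewrite mule_ge0 ?poweR_ge0// lee_fin.
  - exact: dmax_le_iterated.
rewrite EFinM -muleA lee_wpmul2l//.
apply: (le_trans (doob p1 pq ws mF nF soo (nphi ng))).
rewrite EFinM -muleA lee_wpmul2l ?lee_fin ?powR_ge0//.
have -> : \int[m]_x (poweR (phi g x) p * (s x)%:E) =
    \int[m]_x (poweR (dmax m w F (psi g) x) q * (w x)%:E).
  have nd := nnmf_poweR (q - 1) (nnmf_dmax m ww mF (npsi ng)).
  rewrite /phi (triple_int nd); apply: eq_integral => x _.
  by rewrite -poweRrM (conjugate_mulC p1 pq).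
apply: (le_trans (doob q1 qp ww mF nF woo (npsi ng))).
rewrite lee_wpmul2l ?lee_fin ?powR_ge0//.
rewrite le_eqVlt; apply/orP; left; apply/eqP; apply: eq_integral => x _.
have uw0 : 0 <= (u x / w x)%:E.
  by have [_ /(_ x) uw0] := weight_div wu ww; rewrite lee_fin ltW.
rewrite poweRM ?(nnmf_ge0 _ ng)// -muleA poweR_EFin -EFinM.
by rewrite (triple_powl q1 qp ws ww suw).
Qed.

End weighted_bounds.

(** * Inequalities between the masses of a cube and of its large part *)

Section sparse_arithmetic.
Variables (R : realType) (p q : R).
Hypotheses (p2 : 2 <= p) (pq : p^-1 + q^-1 = 1).

(** [U], [V], [S] are the u-, w- and s-masses of a cube, the primed letters those of its large part.
    The A_p condition gives S V / U <= W U^(p-1) S^(2-p). Sparseness and Hölder bound U by the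
    primed masses, and p >= 2 makes S^(2-p) decreasing in S, so that S may be replaced by S'. The
    powers of S' add up to (p - 1) / q + 2 - p = 1 / p. *)
Lemma sparse_arith (L W U V S U' V' S' : R) : 0 <= L -> 0 <= W -> 0 < U -> 0 < S ->
  0 < U' -> 0 < V' -> 0 < S' ->
  U <= L * U' -> U' <= V' `^ p^-1 * S' `^ q^-1 -> S' <= S ->
  V * S `^ (p - 1) <= W * U `^ p ->
  U^-1 * S * V <= W * L `^ (p - 1) * (S' `^ p^-1 * V' `^ q^-1).
Proof.
move=> L0 W0 U0 S0 U'0 V'0 S'0 UL U'VS S'S VS.
have p1 : 1 < p by apply: lt_le_trans p2; rewrite ltr1n.
have p0 : 0 < p by apply: lt_trans p1.
have p10 : 0 <= p - 1 by rewrite subr_ge0 ltW.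
have Sp : 0 < S `^ (p - 1) by rewrite powR_gt0.
have h1 : U^-1 * S * V <= W * (U `^ (p - 1) * S `^ (2 - p)).
  have -> : S `^ (2 - p) = S / S `^ (p - 1).
    rewrite (_ : 2 - p = 1 - (p - 1)); last by lra.
    by rewrite powRB ?(gt_eqF S0) ?implybT// powRr1// ltW.
  have US0 : 0 <= U^-1 * S / S `^ (p - 1).
    by rewrite !mulr_ge0 ?invr_ge0 ?powR_ge0 ?ltW.
  have := ler_wpM2l US0 VS.
  rewrite -(mulr_powRB1 (ltW U0) p0).
  have -> : U^-1 * S / S `^ (p - 1) * (V * S `^ (p - 1)) = U^-1 * S * V.
    by field; rewrite !gt_eqF.
  move=> /le_trans; apply; rewrite le_eqVlt; apply/orP; left; apply/eqP.
  by field; rewrite !gt_eqF.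
apply: (le_trans h1); rewrite -mulrA ler_wpM2l//.
have h2 : U `^ (p - 1) <= L `^ (p - 1) * (V' `^ q^-1 * S' `^ ((p - 1) / q)).
  have -> : V' `^ q^-1 * S' `^ ((p - 1) / q) = (V' `^ p^-1 * S' `^ q^-1) `^ (p - 1).
    rewrite powRM ?powR_ge0// -!powRrM; congr (_ `^ _ * _ `^ _); last by rewrite mulrC.
    by rewrite mulrBr mulVf ?gt_eqF// mulr1 -pq addrAC subrr add0r.
  rewrite -powRM ?mulr_ge0 ?powR_ge0//.
  apply: ge0_ler_powR; rewrite ?nnegrE ?mulr_ge0 ?powR_ge0 ?(ltW U0)//.
  by rewrite (le_trans UL)// ler_wpM2l.
have h3 : S `^ (2 - p) <= S' `^ (2 - p).
  rewrite -(opprB p 2) !powRN lef_pV2 ?posrE ?powR_gt0//.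
  by rewrite ge0_ler_powR ?nnegrE ?subr_ge0 ?(ltW S0) ?(ltW S'0).
have h4 : S' `^ ((p - 1) / q) * S' `^ (2 - p) = S' `^ p^-1.
  rewrite -powRD ?(gt_eqF S'0) ?implybT//; congr (_ `^ _).
  have -> : q^-1 = 1 - p^-1 by rewrite -pq addrAC subrr add0r.
  by field; rewrite gt_eqF.
apply: (le_trans (ler_pM (powR_ge0 _ _) (powR_ge0 _ _) h2 h3)).
by rewrite -!mulrA h4 (mulrC (V' `^ _)).
Qed.

End sparse_arithmetic.

(** Raise to the power q - 1 and use (p - 1)(q - 1) = 1: the exchanged pair of weights satisfies the
    A_q condition with constant W^(q-1). *)
Lemma dual_arith (R : realType) (p q V S U W : R) :
  1 < p -> p^-1 + q^-1 = 1 -> 0 <= V -> 0 <= S -> 0 <= U -> 0 <= W ->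
  V * S `^ (p - 1) <= W * U `^ p -> S * V `^ (q - 1) <= W `^ (q - 1) * U `^ q.
Proof.
move=> p1 pq V0 S0 U0 W0 VS; have q1 : 0 <= q - 1.
  by rewrite subr_ge0 ltW// (conjugate_gt1 p1 pq).
have pq1 : (p - 1) * (q - 1) = 1.
  by rewrite -(conjugate_inv p1 pq) mulfV// gt_eqF// subr_gt0.
have lhs0 : V * S `^ (p - 1) \is Num.nneg by rewrite nnegrE mulr_ge0 ?powR_ge0.
have rhs0 : W * U `^ p \is Num.nneg by rewrite nnegrE mulr_ge0 ?powR_ge0.
have := ge0_ler_powR q1 lhs0 rhs0 VS.
rewrite (powRM _ V0) ?powR_ge0// (powRM _ W0) ?powR_ge0//.
by rewrite -!powRrM pq1 (powRr1 S0) mulrC (mulrC p) (conjugate_mulC p1 pq).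
Qed.

Lemma mule_EFin_regroup (R : realType) (x y z : R) (a b : \bar R) :
  (x%:E * (y%:E * a * (z%:E * b)) = (x * y * z)%:E * (a * b))%E.
Proof. by rewrite 2!EFinM -!muleA; do 2 congr (_ * _)%E; exact: muleCA. Qed.

(** Each mass is distributed inside the Young product, so that it ends up multiplying the power of
    its own average; the factors 1/p and 1/q are simply dropped. *)
Lemma young_scaled (R : realType) (p q : R) (a b : \bar R) (S V : R) :
  1 < p -> p^-1 + q^-1 = 1 -> (0 <= a)%E -> (0 <= b)%E -> 0 <= S -> 0 <= V ->
  ((S `^ p^-1 * V `^ q^-1)%:E * (a * b) <= poweR a p * S%:E + poweR b q * V%:E)%E.
Proof.
move=> p1 pq a0 b0 S0 V0.
have p0 : 0 < p by exact: lt_trans p1.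
have q0 : 0 < q by exact: conjugate_gt0 pq.
have q1 : 1 < q by exact: conjugate_gt1 pq.
have S1 : (0 <= (S `^ p^-1)%:E)%E by rewrite lee_fin powR_ge0.
have V1 : (0 <= (V `^ q^-1)%:E)%E by rewrite lee_fin powR_ge0.
rewrite EFinM muleACA (muleC _ a) (muleC _ b).
apply: (le_trans (young_poweR p1 pq (mule_ge0 a0 S1) (mule_ge0 b0 V1))).
have powVK (r x : R) : 0 < r -> 0 <= x -> poweR (x `^ r^-1)%:E r = x%:E.
  by move=> r0 x0; rewrite poweR_EFin -powRrM mulVf ?gt_eqF// powRr1.
rewrite (poweRM p a0 S1) (poweRM q b0 V1) (powVK p S)// (powVK q V)//.
have le1 (r : R) (y : \bar R) : 1 < r -> (0 <= y)%E -> (r^-1%:E * y <= y)%E.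
  move=> r1 y0; rewrite -[leRHS]mul1e lee_wpmul2r// lee_fin invf_le1 ?ltW//.
  exact: lt_trans r1.
by apply: leeD; apply: le1 => //; rewrite mule_ge0 ?poweR_ge0// lee_fin.
Qed.

Section sparse_form.
Context d (T : measurableType d) (R : realType) (m : {measure set T -> \bar R}).
Local Open Scope ereal_scope.
Variables (p q : R) (u w s : T -> R).
Hypotheses (p1 : (1 < p)%R) (pq : (p^-1 + q^-1 = 1)%R).
Hypotheses (wu : weight u) (ww : weight w) (ws : weight s).
Hypothesis uws : forall x, (u x = w x `^ p^-1 * s x `^ q^-1)%R.

Let p0 : (0 < p)%R. Proof. exact: lt_trans p1. Qed.
Let q0 : (0 < q)%R. Proof. exact: conjugate_gt0 pq. Qed.
Let q1 : (1 < q)%R. Proof. exact: conjugate_gt1 pq. Qed.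
Let qp : (q^-1 + p^-1 = 1)%R. Proof. exact: conjugate_sym. Qed.
Let suw x : (u x = s x `^ q^-1 * w x `^ p^-1)%R. Proof. by rewrite mulrC. Qed.
Let nu := weight_nnmf wu.
Let nw := weight_nnmf ww.
Let ns := weight_nnmf ws.

(** Hölder's inequality from the pointwise Young inequality for w / w(A) and s / s(A), whose
    integrals over A are 1. Null sets are set aside first because the two masses are divided by. *)
Lemma mass_hoelder A : measurable A -> mass m w A < +oo -> mass m s A < +oo ->
  mass m u A <= (fine (mass m w A) `^ p^-1 * fine (mass m s A) `^ q^-1)%:E.
Proof.
move=> mA woo soo; have [mA0|mA0] := eqVneq (m A) 0.
  have -> : mass m u A = 0 by apply: null_set_integral => //; exact: nnmfS.
  by rewrite lee_fin mulr_ge0 ?powR_ge0.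
have {}mA0 : 0 < m A by rewrite lt0e mA0 measure_ge0.
have wA0 := mass_gt0 mA ww mA0; have sA0 := mass_gt0 mA ws mA0.
have wE : mass m w A = (fine (mass m w A))%:E by rewrite fineK// gt0_fin_numE.
have sE : mass m s A = (fine (mass m s A))%:E by rewrite fineK// gt0_fin_numE.
have a0 : (0 < fine (mass m w A))%R by rewrite fine_gt0// wA0.
have b0 : (0 < fine (mass m s A))%R by rewrite fine_gt0// sA0.
move: wE sE a0 b0; set a := fine (mass m w A); set b := fine (mass m s A).
move=> wE sE a0 b0; pose c := (a `^ p^-1 * b `^ q^-1)%R.
have c0 : (0 < c)%R by rewrite mulr_gt0 ?powR_gt0.
have c1 : (0 <= c / (a * p))%R by apply: divr_ge0; [exact: ltW|apply: mulr_ge0; exact: ltW].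
have c2 : (0 <= c / (b * q))%R by apply: divr_ge0; [exact: ltW|apply: mulr_ge0; exact: ltW].
have -> : c%:E = (c / (a * p))%:E * mass m w A + (c / (b * q))%:E * mass m s A.
  rewrite wE sE -!EFinM -EFinD; congr EFin.
  have -> : (c / (a * p) * a + c / (b * q) * b = c * (p^-1 + q^-1))%R.
    by field; rewrite !gt_eqF.
  by rewrite pq mulr1.
rewrite /mass -!intZl ?lee_fin// -intD//; [|by nnmf|by nnmf].
apply: int_le => //; [by nnmf|move=> x _].
rewrite -!EFinM -EFinD lee_fin uws.
have [[_ /(_ x) w0] [_ /(_ x) s0]] := (ww, ws).
have wa0 : (0 <= w x / a)%R by rewrite divr_ge0 ?ltW.
have sb0 : (0 <= s x / b)%R by rewrite divr_ge0 ?ltW.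
have := conjugate_powR (powR_ge0 (w x / a) p^-1) (powR_ge0 (s x / b) q^-1) p0 q0 pq.
rewrite -!powRrM !mulVf ?gt_eqF// !powRr1//.
move=> /(ler_wpM2l (ltW c0)).
have -> : (c * ((w x / a) `^ p^-1 * (s x / b) `^ q^-1) = w x `^ p^-1 * s x `^ q^-1)%R.
  rewrite /c mulrACA -!powRM ?(ltW a0) ?(ltW b0)//.
  by rewrite (mulrC a) (mulrC b) !divfK ?gt_eqF.
move=> /le_trans; apply; rewrite le_eqVlt; apply/orP; left; apply/eqP.
by field; rewrite !gt_eqF.
Qed.

Lemma int_bounded_overlap (E : nat -> set T) (N : nat) (g : T -> \bar R) :
  (forall i, measurable (E i)) ->
  (forall x, \sum_(i <oo) (\1_(E i) x : R)%:E <= N%:R%:E) -> nnmf g ->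
  \sum_(i <oo) \int[m]_(x in E i) g x <= N%:R%:E * \int[m]_x g x.
Proof.
move=> mE ov ng.
have ni i : nnmf (fun x => g x * (\1_(E i) x)%:E) by nnmf.
rewrite (eq_eseriesr (g := fun i => \int[m]_x (g x * (\1_(E i) x)%:E))); last first.
  by move=> i _; rewrite nnmf_int_indic.
rewrite -int_nneseries// -intZl ?lee_fin//.
apply: int_le => //; [exact: nnmf_nneseries|by nnmf; rewrite lee_fin|move=> x _].
have i0 i : 0 <= (\1_(E i) x : R)%:E by rewrite lee_fin indicE; case: (_ \in _).
have g0 : 0 <= g x by exact: nnmf_ge0 ng.
apply: lime_le; first by apply: is_cvg_nneseries => i _ _; rewrite mule_ge0.
apply: nearW => n; rewrite -ge0_sume_distrr; last by move=> i _.
rewrite muleC lee_wpmul2r//; apply: le_trans (ov x).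
by apply: nneseries_lim_ge => i _ _.
Qed.

Variables (F : nat -> set T) (W : R).
Hypotheses (mF : forall i, measurable (F i)) (nF : nested F).
Hypotheses (uoo : forall i, mass m u (F i) < +oo) (woo : forall i, mass m w (F i) < +oo)
  (soo : forall i, mass m s (F i) < +oo).
Hypothesis W0 : (0 <= W)%R.
Hypothesis Ap : forall i, (fine (mass m w (F i)) * fine (mass m s (F i)) `^ (p - 1)
  <= W * fine (mass m u (F i)) `^ p)%R.

Variables (E : nat -> set T) (k : nat -> nat) (L : R) (N : nat).
Hypotheses (mE : forall i, measurable (E i)) (EF : forall i, E i `<=` F (k i)).
Hypothesis L0 : (0 <= L)%R.
Hypothesis EL : forall i, mass m u (F (k i)) <= L%:E * mass m u (E i).
Hypothesis ov : forall x, \sum_(i <oo) (\1_(E i) x : R)%:E <= N%:R%:E.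

(** [F] lists the whole family, over which the maximal operators run, while [k] picks the sparse
    members. The integrals of f u and h u are s(Q) a and w(Q) b, with a the s-average of f u / s and
    b the w-average of h u / w. After [sparse_arith] only masses of [E i] are left; there a and b
    lie below the maximal functions, and the bounded overlap sums the pieces. *)
Lemma sparse_form_ge2 (f h : T -> \bar R) : (2 <= p)%R -> nnmf f -> nnmf h ->
  \sum_(i <oo) (fine (mass m u (F (k i))))^-1%:E *
    (\int[m]_(x in F (k i)) (f x * (u x)%:E) *
     \int[m]_(x in F (k i)) (h x * (u x)%:E)) <=
  (W * L `^ (p - 1) * (N%:R * (q `^ p + p `^ q)))%:E *
  (\int[m]_x (poweR (f x) p * (w x)%:E) + \int[m]_x (poweR (h x) q * (s x)%:E)).
Proof.
move=> p2 nf nh.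
pose fs x := f x * (u x / s x)%:E; pose hw x := h x * (u x / w x)%:E.
have nfs : nnmf fs by have nus := weight_nnmf (weight_div wu ws); rewrite /fs; nnmf.
have nhw : nnmf hw by have nuw := weight_nnmf (weight_div wu ww); rewrite /hw; nnmf.
have nD1 := nnmf_dmax m ws mF nfs; have nD2 := nnmf_dmax m ww mF nhw.
set D1 := dmax m s F fs in nD1 *; set D2 := dmax m w F hw in nD2 *.
pose G x := poweR (D1 x) p * (s x)%:E + poweR (D2 x) q * (w x)%:E.
have nG : nnmf G by rewrite /G; nnmf.
have K0 : 0 <= (W * L `^ (p - 1))%:E by rewrite lee_fin mulr_ge0 ?powR_ge0.
have term i : (fine (mass m u (F (k i))))^-1%:E *
    (\int[m]_(x in F (k i)) (f x * (u x)%:E) *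
     \int[m]_(x in F (k i)) (h x * (u x)%:E)) <=
    (W * L `^ (p - 1))%:E * \int[m]_(x in E i) G x.
  have rhs0 : 0 <= (W * L `^ (p - 1))%:E * \int[m]_(x in E i) G x.
    by rewrite mule_ge0//; exact: int_ge0.
  have [ui0|ui0] := leP (mass m u (F (k i))) 0.
    have -> : mass m u (F (k i)) = 0 by apply/eqP; rewrite eq_le ui0 mass_ge0.
    by rewrite invr0 mul0e.
  have uE0 : 0 < mass m u (E i).
    rewrite lt0e mass_ge0// andbT; apply/eqP => uE0.
    by have := EL i; rewrite uE0 mule0 leNgt ui0.
  have mF0 := mass_gt0_measure (mF (k i)) wu ui0.
  have mE0 := mass_gt0_measure (mE i) wu uE0.
  have wi0 := mass_gt0 (mF (k i)) ww mF0; have si0 := mass_gt0 (mF (k i)) ws mF0.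
  have wE0 := mass_gt0 (mE i) ww mE0; have sE0 := mass_gt0 (mE i) ws mE0.
  have uEF := mass_le m (mE i) (mF (k i)) wu (@EF i).
  have wEF := mass_le m (mE i) (mF (k i)) ww (@EF i).
  have sEF := mass_le m (mE i) (mF (k i)) ws (@EF i).
  have fin (v : T -> R) A : 0 < mass m v A -> mass m v A < +oo ->
      mass m v A = (fine (mass m v A))%:E /\ (0 < fine (mass m v A))%R.
    by move=> v0 voo; rewrite fineK ?gt0_fin_numE// fine_gt0// v0.
  have hol := mass_hoelder (mE i) (le_lt_trans wEF (woo _)) (le_lt_trans sEF (soo _)).
  have := Ap (k i); have := EL i; move: hol.
  have [uE U0] := fin _ _ ui0 (uoo _); have [wE V0] := fin _ _ wi0 (woo _).
  have [sE S0] := fin _ _ si0 (soo _).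
  have [uE' U'0] := fin _ _ uE0 (le_lt_trans uEF (uoo _)).
  have [wE' V'0] := fin _ _ wE0 (le_lt_trans wEF (woo _)).
  have [sE' S'0] := fin _ _ sE0 (le_lt_trans sEF (soo _)).
  have sSE := sEF; rewrite sE' sE lee_fin in sSE.
  rewrite uE' uE -EFinM !lee_fin /=.
  move: U0 V0 S0 U'0 V'0 S'0 uE wE sE uE' wE' sE' sSE.
  set U := fine (mass m u (F _)); set V := fine (mass m w (F _)).
  set S := fine (mass m s (F _)); set U' := fine (mass m u (E _)).
  set V' := fine (mass m w (E _)); set S' := fine (mass m s (E _)).
  move=> U0 V0 S0 U'0 V'0 S'0 uE wE sE uE' wE' sE' sSE hol ELi Api.
  have key := sparse_arith p2 pq L0 W0 U0 S0 U'0 V'0 S'0 ELi hol sSE Api.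
  pose a := wavg m s fs (F (k i)); pose b := wavg m w hw (F (k i)).
  have a0 : 0 <= a by exact: wavg_ge0.
  have b0 : 0 <= b by exact: wavg_ge0.
  have -> : \int[m]_(x in F (k i)) (f x * (u x)%:E) = S%:E * a.
    by rewrite -(mass_div m u f (F (k i)) ws) -(wavgK fs ws (soo _) si0) sE.
  have -> : \int[m]_(x in F (k i)) (h x * (u x)%:E) = V%:E * b.
    by rewrite -(mass_div m u h (F (k i)) ww) -(wavgK hw ww (woo _) wi0) wE.
  have -> : U^-1%:E * (S%:E * a * (V%:E * b)) = (U^-1 * S * V)%:E * (a * b).
    exact: mule_EFin_regroup.
  apply: (@le_trans _ _ ((W * L `^ (p - 1) * (S' `^ p^-1 * V' `^ q^-1))%:E * (a * b))).
    by rewrite lee_wpmul2r ?lee_fin// mule_ge0.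
  rewrite EFinM -muleA lee_wpmul2l//.
  apply: (le_trans (young_scaled p1 pq a0 b0 (ltW S'0) (ltW V'0))).
  rewrite -sE' -wE' /G intD//; [|by nnmf|by nnmf].
  apply: leeD.
    rewrite /mass -intZl ?poweR_ge0//; apply: int_le => //; [by nnmf; exact: poweR_ge0|by nnmf|].
    move=> x Ex; rewrite lee_wpmul2r ?(nnmf_ge0 _ ns)//.
    apply: gt0_ler_poweR; rewrite ?in_itv/= ?leey ?andbT ?(ltW p0) ?a0 ?(nnmf_ge0 _ nD1)//.
    by apply: le_dmax; exact: EF.
  rewrite /mass -intZl ?poweR_ge0//; apply: int_le => //; [by nnmf; exact: poweR_ge0|by nnmf|].
  move=> x Ex; rewrite lee_wpmul2r ?(nnmf_ge0 _ nw)//.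
  apply: gt0_ler_poweR; rewrite ?in_itv/= ?leey ?andbT ?(ltW q0) ?b0 ?(nnmf_ge0 _ nD2)//.
  by apply: le_dmax; exact: EF.
have Vge0 i : 0 <= (fine (mass m u (F (k i))))^-1%:E.
  by rewrite lee_fin invr_ge0 fine_ge0// mass_ge0.
have fu0 i : 0 <= \int[m]_(x in F (k i)) (f x * (u x)%:E) by apply: int_ge0; nnmf.
have hu0 i : 0 <= \int[m]_(x in F (k i)) (h x * (u x)%:E) by apply: int_ge0; nnmf.
apply: (@le_trans _ _ (\sum_(i <oo) (W * L `^ (p - 1))%:E * \int[m]_(x in E i) G x)).
  by apply: lee_nneseries => [i _ _|i _]; [rewrite !mule_ge0|exact: term].
rewrite nneseriesZl; last by move=> i _; exact: int_ge0.
have nfw : nnmf (fun x => poweR (f x) p * (w x)%:E) by nnmf.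
have nhs : nnmf (fun x => poweR (h x) q * (s x)%:E) by nnmf.
have dsum : \int[m]_x G x <= (q `^ p + p `^ q)%:E *
    (\int[m]_x (poweR (f x) p * (w x)%:E) + \int[m]_x (poweR (h x) q * (s x)%:E)).
  have /(le_trans (doob p1 pq ws mF nF soo nfs)) h1 :
      (q `^ p)%:E * \int[m]_x (poweR (fs x) p * (s x)%:E) <=
      (q `^ p + p `^ q)%:E * \int[m]_x (poweR (f x) p * (w x)%:E).
    rewrite (triple_int m p1 pq wu ww ws uws nf); apply: lee_wpmul2r; first exact: int_ge0.
    by rewrite lee_fin lerDl powR_ge0.
  have /(le_trans (doob q1 qp ww mF nF woo nhw)) h2 :
      (p `^ q)%:E * \int[m]_x (poweR (hw x) q * (w x)%:E) <=
      (q `^ p + p `^ q)%:E * \int[m]_x (poweR (h x) q * (s x)%:E).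
    rewrite (triple_int m q1 qp wu ws ww suw nh); apply: lee_wpmul2r; first exact: int_ge0.
    by rewrite lee_fin lerDr powR_ge0.
  have := leeD h1 h2; rewrite -ge0_muleDr; [|exact: int_ge0|exact: int_ge0].
  by apply: le_trans; rewrite /G intD//; nnmf.
have N0 : 0 <= (N%:R : R)%:E by rewrite lee_fin.
have tot := le_trans (int_bounded_overlap mE ov nG) (lee_wpmul2l N0 dsum).
apply: (le_trans (lee_wpmul2l K0 tot)).
by rewrite [in leRHS]EFinM [X in _ * X * _]EFinM -!muleA.
Qed.

End sparse_form.

Section sparse_form_all.
Context d (T : measurableType d) (R : realType) (m : {measure set T -> \bar R}).
Local Open Scope ereal_scope.
Variables (p q : R) (u w s : T -> R).
Hypotheses (p1 : (1 < p)%R) (pq : (p^-1 + q^-1 = 1)%R).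
Hypotheses (wu : weight u) (ww : weight w) (ws : weight s).
Hypothesis uws : forall x, (u x = w x `^ p^-1 * s x `^ q^-1)%R.
Variables (F : nat -> set T) (W : R).
Hypotheses (mF : forall i, measurable (F i)) (nF : nested F).
Hypotheses (uoo : forall i, mass m u (F i) < +oo) (woo : forall i, mass m w (F i) < +oo)
  (soo : forall i, mass m s (F i) < +oo).
Hypothesis W1 : (1 <= W)%R.
Hypothesis Ap : forall i, (fine (mass m w (F i)) * fine (mass m s (F i)) `^ (p - 1)
  <= W * fine (mass m u (F i)) `^ p)%R.
Variables (E : nat -> set T) (k : nat -> nat) (L : R) (N : nat).
Hypotheses (mE : forall i, measurable (E i)) (EF : forall i, E i `<=` F (k i)).
Hypothesis L0 : (0 <= L)%R.
Hypothesis EL : forall i, mass m u (F (k i)) <= L%:E * mass m u (E i).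
Hypothesis ov : forall x, \sum_(i <oo) (\1_(E i) x : R)%:E <= N%:R%:E.

Let W0 : (0 <= W)%R. Proof. exact: le_trans W1. Qed.
Let q1 : (1 < q)%R. Proof. exact: conjugate_gt1 pq. Qed.
Let qp : (q^-1 + p^-1 = 1)%R. Proof. exact: conjugate_sym. Qed.
Let suw x : (u x = s x `^ q^-1 * w x `^ p^-1)%R. Proof. by rewrite mulrC. Qed.
Let pq1 : ((p - 1) * (q - 1) = 1)%R.
Proof. by rewrite -(conjugate_inv p1 pq) mulfV// gt_eqF// subr_gt0. Qed.

Lemma Ap_dual i : (fine (mass m s (F i)) * fine (mass m w (F i)) `^ (q - 1)
  <= W `^ (q - 1) * fine (mass m u (F i)) `^ q)%R.
Proof.
have ge0 (v : T -> R) : weight v -> (0 <= fine (mass m v (F i)))%R.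
  by move=> wv; rewrite fine_ge0// mass_ge0.
by apply: (dual_arith p1 pq _ _ _ W0 (Ap i)); exact: ge0.
Qed.

(** The case p < 2 is [sparse_form_ge2] for the exponent q, with f and h exchanged and W^(q-1) in
    place of W. [W1] allows both powers of W to be replaced by the larger one, and the other
    constants are symmetric in p and q in order to serve both cases. *)
Lemma sparse_form (f h : T -> \bar R) : nnmf f -> nnmf h ->
  \sum_(i <oo) (fine (mass m u (F (k i))))^-1%:E *
    (\int[m]_(x in F (k i)) (f x * (u x)%:E) *
     \int[m]_(x in F (k i)) (h x * (u x)%:E)) <=
  (W `^ Num.max 1 (q - 1) *
    ((L `^ (p - 1) + L `^ (q - 1)) * (N%:R * (q `^ p + p `^ q))))%:E *
  (\int[m]_x (poweR (f x) p * (w x)%:E) + \int[m]_x (poweR (h x) q * (s x)%:E)).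
Proof.
move=> nf nh; have nw := weight_nnmf ww; have ns := weight_nnmf ws.
have rhs0 : 0 <= \int[m]_x (poweR (f x) p * (w x)%:E) + \int[m]_x (poweR (h x) q * (s x)%:E).
  by apply: adde_ge0; apply: int_ge0; nnmf.
have c0 : (0 <= N%:R * (q `^ p + p `^ q) :> R)%R by rewrite mulr_ge0 ?addr_ge0 ?powR_ge0.
have [p2|p2] := leP 2%R p.
  apply: (le_trans (sparse_form_ge2 p1 pq wu ww ws uws mF nF uoo woo soo W0 Ap
    mE EF L0 EL ov p2 nf nh)).
  apply: lee_wpmul2r => //; rewrite lee_fin -mulrA; apply: ler_pM => //.
  - by apply: mulr_ge0 => //; exact: powR_ge0.
  - by rewrite -[leLHS](powRr1 W0) ler_powR// le_max lexx.
  - by apply: ler_wpM2r => //; rewrite lerDl powR_ge0.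
have q2 : (2 <= q)%R.
  rewrite leNgt; apply/negP => q2; move: pq1 q2 p2 (ltW q1) (ltW p1).
  by set x := p; set y := q; nra.
have -> : \sum_(i <oo) (fine (mass m u (F (k i))))^-1%:E *
    (\int[m]_(x in F (k i)) (f x * (u x)%:E) *
     \int[m]_(x in F (k i)) (h x * (u x)%:E)) =
    \sum_(i <oo) (fine (mass m u (F (k i))))^-1%:E *
    (\int[m]_(x in F (k i)) (h x * (u x)%:E) *
     \int[m]_(x in F (k i)) (f x * (u x)%:E)).
  by apply: eq_eseriesr => i _; rewrite (muleC (\int[m]_(x in _) (f x * _))).
apply: (le_trans (sparse_form_ge2 q1 qp wu ws ww suw mF nF uoo soo woo (powR_ge0 W (q - 1))
    Ap_dual mE EF L0 EL ov q2 nh nf)).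
rewrite addeC (addrC (p `^ q)%R).
apply: lee_wpmul2r => //; rewrite lee_fin -mulrA; apply: ler_pM.
- exact: powR_ge0.
- by apply: mulr_ge0 => //; exact: powR_ge0.
- by rewrite ler_powR// le_max lexx orbT.
- by apply: ler_wpM2r => //; rewrite lerDr powR_ge0.
Qed.

End sparse_form_all.

(** * Dyadic oscillation and the maximal operator *)

Section dyadic_oscillation.
Context d (T : measurableType d) (R : realType) (m : {measure set T -> \bar R}).
Local Open Scope ereal_scope.
Variables (D : int -> set (set T)) (X : set T) (u b : T -> R).
Hypotheses (mD : forall k Q, D k Q -> measurable Q)
  (DX : forall k Q, D k Q -> Q `<=` X)
  (coverD : forall k x, X x -> exists Q, D k Q /\ Q x)
  (disjD : forall k Q Q', D k Q -> D k Q' -> Q <> Q' -> Q `&` Q' = set0)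
  (nestD : forall k l Q P, (k <= l)%R -> D k Q -> D l P -> P `<=` Q \/ P `&` Q = set0)
  (enumD : forall k, exists G : nat -> set T,
     [/\ forall i, G i = set0 \/ D k (G i), trivIset [set: nat] G &
         forall Q, D k Q -> exists i, G i = Q]).
Hypotheses (wu : weight u) (u_gt0 : forall k Q, D k Q -> 0 < mass m u Q)
  (u_lty : forall k Q, D k Q -> mass m u Q < +oo).
Hypotheses (mb : measurable_fun [set: T] b)
  (bint : forall k Q, D k Q -> m.-integrable Q (fun x => (b x * u x)%:E)).

Let nu := weight_nnmf wu.

Definition bavg (Q : set T) : R :=
  (fine (\int[m]_(x in Q) (b x * u x)%:E) / fine (mass m u Q))%R.

Lemma nnmf_dist (c : R) : nnmf (fun x => `|b x - c|%:E).
Proof.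
apply: nnmf_EFin => // ; apply: measurableT_comp => //.
by apply: measurable_funB => //; exact: measurable_cst.
Qed.

Lemma bavg_dist k P (c : R) : D k P ->
  `|bavg P - c|%:E * mass m u P <= \int[m]_(x in P) (`|b x - c|%:E * (u x)%:E).
Proof.
move=> DP; have mP := mD DP.
have uP : m.-integrable P (fun x => (u x)%:E).
  apply/integrableP; split; first exact: nnmfS.
  under eq_integral => x _ do rewrite gee0_abs ?(nnmf_ge0 _ nu)//.
  exact: u_lty DP.
have uE : mass m u P = (fine (mass m u P))%:E.
  by rewrite fineK// ge0_fin_numE ?mass_ge0// (u_lty DP).
have bE : \int[m]_(x in P) (b x * u x)%:E = (fine (\int[m]_(x in P) (b x * u x)%:E))%:E.
  by rewrite fineK//; exact: integrable_fin_num (bint DP).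
have u0 : (0 < fine (mass m u P))%R by rewrite fine_gt0// (u_gt0 DP) (u_lty DP).
have cuP : m.-integrable P (fun x => c%:E * (u x)%:E) by exact: integrableZl.
have -> : `|bavg P - c|%:E * mass m u P =
    `| \int[m]_(x in P) ((b x * u x)%:E - c%:E * (u x)%:E) |.
  rewrite integralB//; last exact: bint DP.
  rewrite integralZl// -/(mass m u P) uE bE -!EFinM -EFinB abse_EFin; congr EFin.
  rewrite -[X in (_ * X)%R]gtr0_norm// -normrM; congr `| _ |%R.
  by rewrite mulrBl divfK// gt_eqF.
apply: (le_trans (le_abse_integral _ _ _)) => //.
  apply: emeasurable_funB; first by case/integrableP: (bint DP).
  by case/integrableP: cuP.
rewrite le_eqVlt; apply/orP; left; apply/eqP; apply: eq_integral => x _.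
rewrite -EFinM -EFinB abse_EFin -EFinM -mulrBl normrM (gtr0_norm (x := u x))//.
by case: wu.
Qed.

(** A union of cubes of generation [k], that is, a set of the sigma-algebra of that generation. As a
    generation is countable, such a set is measurable and an integral inequality on it can be
    checked cube by cube. *)
Definition saturated k (A : set T) := forall x, A x -> exists P, [/\ D k P, P x & P `<=` A].

Let pieces k A : saturated k A -> exists G : nat -> set T,
  [/\ forall i, G i = set0 \/ D k (G i), trivIset [set: nat] G,
      forall i, G i `<=` A & A = \bigcup_i G i].
Proof.
move=> sA; have [G [G0D tG DG]] := enumD k.
pose H i := if `[< G i `<=` A >] then G i else set0.
have HG i : H i `<=` G i by rewrite /H; case: asboolP => [_ x|_ x].
exists H; split.
- by move=> i; rewrite /H; case: asboolP => _; [exact: G0D|left].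
- apply/trivIsetP => i j _ _ ij; move/trivIsetP : tG => /(_ i j I I ij) Gij.
  by apply: subsetI_eq0 Gij; exact: HG.
- by move=> i; rewrite /H; case: asboolP => [GA x|_ x]//; exact: GA.
- apply/seteqP; split=> [x Ax|x [i _]]; last by rewrite /H; case: asboolP => // GA; exact: GA.
  have [P [DP Px PA]] := sA _ Ax; have [i GP] := DG _ DP.
  by exists i => //; rewrite /H; case: asboolP; rewrite GP.
Qed.

Lemma saturated_measurable k A : saturated k A -> measurable A.
Proof.
move=> /pieces[G [GD _ _ ->]]; apply: bigcupT_measurable => i.
by have [->|/mD] := GD i.
Qed.

Lemma int_le_saturated k A (f g : T -> \bar R) : saturated k A -> nnmf f -> nnmf g ->
  (forall P, D k P -> P `<=` A -> \int[m]_(x in P) f x <= \int[m]_(x in P) g x) ->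
  \int[m]_(x in A) f x <= \int[m]_(x in A) g x.
Proof.
move=> /pieces[G [GD tG GA AE]] nf ng fg.
have mG i : measurable (G i) by have [->|/mD] := GD i.
rewrite AE !ge0_integral_bigcup//; try by [exact: nnmfS|move=> x _; exact: nnmf_ge0].
apply: lee_nneseries => [i _ _|i _]; first exact: int_ge0.
by have [->|DGi] := GD i; [rewrite !integral_set0|apply: fg].
Qed.

(** The conditional expectation of [b] on generation [k]. Off [X] there is no cube to select and the
    value is the constant [bavg set0]. *)
Definition bgen (k : int) (x : T) : R := bavg (xget set0 [set Q | D k Q /\ Q x]).

Lemma bgenE k Q x : D k Q -> Q x -> bgen k x = bavg Q.
Proof.
move=> DQ Qx; rewrite /bgen; case: xgetP => [P _ [DP Px]|/(_ Q) nQ]; last by exfalso; exact: nQ.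
have [->//|PQ] := pselect (P = Q).
by have /seteqP[/(_ x)] := disjD DP DQ PQ; case.
Qed.

Lemma bgen_saturated k l (Y : set R) : (k <= l)%R ->
  saturated l (X `&` bgen k @^-1` Y).
Proof.
move=> kl x [Xx bx]; have [P [DP Px]] := coverD l Xx.
have [Q [DQ Qx]] := coverD k Xx.
exists P; split=> // y Py; split; first exact: (DX DP).
have [PQ|PQ0] := nestD kl DQ DP.
  by rewrite /preimage /= (bgenE DQ (PQ _ Py)) -(bgenE DQ Qx).
by have /seteqP[/(_ x)] := PQ0; case.
Qed.

Lemma measurable_bgen k : measurable_fun [set: T] (bgen k).
Proof.
move=> _ Y mY; rewrite setTI.
have -> : bgen k @^-1` Y = (X `&` bgen k @^-1` Y) `|` (~` X `&` bgen k @^-1` Y).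
  by rewrite -setIUl setUv setTI.
have XE : saturated k X.
  move=> x Xx; have [P [DP Px]] := coverD k Xx.
  by exists P; split => //; exact: (DX DP).
apply: measurableU; first exact: saturated_measurable (bgen_saturated (lexx k)).
have mX := saturated_measurable XE.
have bX x : ~ X x -> bgen k x = bavg set0.
  move=> nXx; rewrite /bgen; case: xgetP => // P _ [DP Px].
  by exfalso; apply: nXx; exact: (DX DP).
have [Y0|Y0] := pselect (Y (bavg set0)).
  rewrite (_ : _ `&` _ = ~` X); first exact: measurableC.
  by apply/seteqP; split=> [x []//|x nXx]; split => //; rewrite /preimage /= bX.
rewrite (_ : _ `&` _ = set0)//; apply/seteqP; split=> // x [nXx].
by rewrite /preimage /= bX.
Qed.


Variables (F : nat -> set T) (beta Cd : R).
Hypotheses (mF : forall i, measurable (F i))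
  (DF : forall k Q, D k Q -> exists i, F i = Q).
Hypotheses (beta0 : (0 < beta)%R) (Cd0 : (0 <= Cd)%R).
Hypothesis osc : forall k Q, D k Q ->
  \int[m]_(x in Q) (`|b x - bavg Q|%:E * (u x)%:E) <= beta%:E * mass m u Q.
Hypothesis parent : forall k Q P, D k Q -> D (k + 1)%R P -> P `<=` Q ->
  mass m u Q <= Cd%:E * mass m u P.

Lemma bavg_parent k Q P : D k Q -> D (k + 1)%R P -> P `<=` Q ->
  (`|bavg P - bavg Q| <= Cd * beta)%R.
Proof.
move=> DQ DP PQ; have P0 := u_gt0 DP; have Poo := u_lty DP.
have PE : mass m u P = (fine (mass m u P))%:E by rewrite fineK// gt0_fin_numE.
have p0 : (0 < fine (mass m u P))%R by rewrite fine_gt0// P0 Poo.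
have h : `|bavg P - bavg Q|%:E * mass m u P <= (Cd * beta)%:E * mass m u P.
  apply: (le_trans (bavg_dist _ DP)).
  apply: (@le_trans _ _ (\int[m]_(x in Q) (`|b x - bavg Q|%:E * (u x)%:E))).
    have nb := nnmf_dist (bavg Q).
    by apply: int_subset => //; [exact: mD DP|exact: mD DQ|nnmf].
  apply: (le_trans (osc DQ)); rewrite mulrC EFinM -muleA.
  by rewrite lee_wpmul2l ?lee_fin ?(ltW beta0)//; exact: parent DQ DP PQ.
by move: h; rewrite PE -!EFinM lee_fin ler_pM2r.
Qed.

(** The stopping height plus the largest jump of the averages from a cube to its child. *)
Let kappa := (2 * beta + Cd * beta)%R.
Let kappa0 : (0 <= kappa)%R.
Proof. by rewrite addr_ge0 ?mulr_ge0 ?(ltW beta0). Qed.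

Section stopping.
Variables (k : int) (Q : set T) (DQ : D k Q).

(* Calderon-Zygmund stopping time at height [2 * beta]: by Chebyshev the stopped
   cubes carry at most half of the mass of [Q]. *)
Definition unstopped (i : nat) : set T := Q `&`
  [set x | forall j : nat, (j < i)%N ->
     (`|bgen (k + j.+1%:Z) x - bavg Q| <= 2 * beta)%R].

(** The points where the height is first exceeded in generation [k + i.+1]; the shift is there
    because generation [k] is [Q] itself, where the deviation is 0. *)
Definition stopped (i : nat) : set T := unstopped i `\` unstopped i.+1.

Lemma unstoppedS i : unstopped i.+1 `<=` unstopped i.
Proof. by move=> x [Qx h]; split=> // j ji; apply: h; exact: ltnW. Qed.

Lemma unstopped_sub i : unstopped i `<=` Q. Proof. by move=> x []. Qed.

Lemma generation_cube (j : nat) x : Q x -> exists P, [/\ D (k + j%:Z) P, P x & P `<=` Q].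
Proof.
move=> Qx; have [P [DP Px]] := coverD (k + j%:Z) (DX DQ Qx).
have kj : (k <= k + j%:Z)%R by rewrite lerDl.
exists P; split => //; have [//|PQ0] := nestD kj DQ DP.
by have /seteqP[/(_ x)] := PQ0; case.
Qed.

Lemma bgen_const (i j : nat) P x y : (j <= i)%N -> D (k + i%:Z) P -> P `<=` Q ->
  P x -> P y -> bgen (k + j%:Z) x = bgen (k + j%:Z) y.
Proof.
move=> ji DP PQ Px Py; have [P' [DP' P'x _]] := generation_cube j (PQ _ Px).
have ij : (k + j%:Z <= k + i%:Z)%R by rewrite lerD2l lez_nat.
have [PP'|PP'0] := nestD ij DP' DP.
  by rewrite (bgenE DP' P'x) (bgenE DP' (PP' _ Py)).
by have /seteqP[/(_ x)] := PP'0; case.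
Qed.

(** Membership depends only on averages over generations up to [k + i.+1], and these are constant on
    every cube of generation [k + i.+1]. *)
Lemma stopped_saturated i : saturated (k + i.+1%:Z) (stopped i).
Proof.
move=> x [[Qx xi] nx]; have [P [DP Px PQ]] := generation_cube i.+1 Qx.
exists P; split => // y Py; split.
  split; first exact: PQ.
  by move=> j ji; rewrite -(bgen_const (ltnW (ji : (j.+1 < i.+1)%N)) DP PQ Px Py); exact: xi.
move=> [_ yi]; apply: nx; split => // j ji.
by rewrite (bgen_const _ DP PQ Px Py)//; exact: yi.
Qed.

Lemma measurable_unstopped i : measurable (unstopped i).
Proof.
elim: i => [|i IH].
  have -> : unstopped 0 = Q by apply/seteqP; split=> [x []//|x Qx]; split.
  exact: mD DQ.
have -> : unstopped i.+1 = unstopped i `\` stopped i.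
  by rewrite /stopped setDD setIidr//; exact: unstoppedS.
by apply: measurableD => //; exact: saturated_measurable (@stopped_saturated i).
Qed.

Lemma stopped_bavg_gt i P : D (k + i.+1%:Z) P -> P `<=` stopped i ->
  (2 * beta <= `|bavg P - bavg Q|)%R.
Proof.
move=> DP PS; have P0 : P !=set0.
  apply/set0P/eqP => P0; have := u_gt0 DP.
  by rewrite P0 /mass integral_set0 ltxx.
have [x Px] := P0; have [[Qx xi] nx] := PS _ Px.
rewrite leNgt; apply/negP => lt; apply: nx; split => // j.
rewrite ltnS leq_eqVlt => /predU1P[->|]; last exact: xi.
by rewrite (bgenE DP Px) ltW.
Qed.

(* The average over a stopping cube is controlled through its unstopped parent. *)
Lemma stopped_bavg i P : D (k + i.+1%:Z) P -> P `<=` stopped i ->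
  (`|bavg P - bavg Q| <= kappa)%R.
Proof.
move=> DP PS; have P0 : P !=set0.
  apply/set0P/eqP => P0; have := u_gt0 DP.
  by rewrite P0 /mass integral_set0 ltxx.
have [x Px] := P0; have [[Qx xi] _] := PS _ Px.
have [P' [DP' P'x P'Q]] := generation_cube i Qx.
have PP' : P `<=` P'.
  have ij : (k + i%:Z <= k + i.+1%:Z)%R by rewrite lerD2l lez_nat.
  by have [//|PP'0] := nestD ij DP' DP; have /seteqP[/(_ x)] := PP'0; case.
have P'Qb : (`|bavg P' - bavg Q| <= 2 * beta)%R.
  (* The parent has generation [k + i]. For [i = 0] it is [Q], with deviation 0; otherwise it
     contains the point [x], which had not stopped by that generation. *)
  case: i xi DP PS DP' => [|i] xi DP PS DP'; last first.
    by rewrite -(bgenE DP' P'x); exact: xi.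
  have -> : P' = Q.
    apply: contrapT => P'nQ; rewrite addr0 in DP'.
    by have /seteqP[/(_ x)] := disjD DP' DQ P'nQ; case.
  by rewrite subrr normr0 mulr_ge0// ltW.
have DP1 : D (k + i%:Z + 1)%R P by rewrite -addrA -PoszD addn1.
have PP'b := bavg_parent DP' DP1 PP'.
rewrite (_ : bavg P - bavg Q = (bavg P - bavg P') + (bavg P' - bavg Q))%R; last first.
  by rewrite addrA subrK.
by rewrite (le_trans (ler_normD _ _))// /kappa addrC lerD.
Qed.

Lemma int_le_stopped (n : nat) (f g : T -> \bar R) : nnmf f -> nnmf g ->
  (forall i, (i < n)%N -> \int[m]_(x in stopped i) f x <= \int[m]_(x in stopped i) g x) ->
  \int[m]_(x in Q `\` unstopped n) f x <= \int[m]_(x in Q `\` unstopped n) g x.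
Proof.
move=> nf ng; elim: n => [|n IH] fg.
  have -> : unstopped 0 = Q by apply/seteqP; split=> [x []//|x Qx]; split.
  by rewrite setDv !integral_set0.
have mU := measurable_unstopped; have mQ := mD DQ.
have mS : measurable (stopped n) by apply: measurableD.
have QE : Q `\` unstopped n.+1 = (Q `\` unstopped n) `|` stopped n.
  apply/seteqP; split=> [x [Qx nx]|x [[Qx nx]|[/unstopped_sub Qx nx]]]; last 2 first.
  - by split=> // /unstoppedS.
  - by split.
  by have [ux|nux] := pselect (unstopped n x); [right|left].
have dis : (Q `\` unstopped n) `&` stopped n = set0.
  by apply/seteqP; split=> // x [[_ nx] []].
have mQU : measurable (Q `\` unstopped n) by apply: measurableD.
rewrite QE !int_setU//; apply: leeD; last exact: fg.
by apply: IH => i ni; apply: fg; exact: ltnW.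
Qed.

End stopping.

Variables (g : T -> R).
Hypothesis ng : nnmf (fun x => (g x)%:E).
Let M := dmax m u F (fun x => (g x)%:E).
Let nM : nnmf M. Proof. exact: nnmf_dmax. Qed.

(* Induction on [j] over the stopped cubes; the surplus [kappa * \int_Q g u] is
   absorbed because the unstopped part carries half of the mass of [Q] and [M]
   exceeds the average of [g] there. *)
Lemma int_bgen_dist (j : nat) k Q : D k Q ->
  \int[m]_(x in Q) (`|bgen (k + j%:Z) x - bavg Q|%:E * ((g x)%:E * (u x)%:E)) <=
  (2 * kappa)%:E * \int[m]_(x in Q) (M x * (u x)%:E).
Proof.
have [n] := ubnP j; elim: n j k Q => // n IH j k Q jn DQ.
case: j jn => [|j] jn.
  rewrite [X in X <= _](_ : _ = 0); first by rewrite mule_ge0 ?int_ge0 ?lee_fin ?mulr_ge0//; nnmf.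
  apply: integral0_eq => x Qx; rewrite addr0 (bgenE DQ Qx) subrr normr0 mul0e//.
have mU := measurable_unstopped DQ; have mQ := mD DQ.
pose dev x := `|bgen (k + j.+1%:Z) x - bavg Q|%:E * ((g x)%:E * (u x)%:E).
have nbg (c : R) : nnmf (fun x => `|bgen (k + j.+1%:Z) x - c|%:E).
  apply: nnmf_EFin => //; apply: measurableT_comp => //.
  by apply: measurable_funB; [exact: measurable_bgen|exact: measurable_cst].
have ngu : nnmf (fun x => (g x)%:E * (u x)%:E) by nnmf.
have ndev : nnmf dev by apply: nnmfM.
have nMu : nnmf (fun x => M x * (u x)%:E) by apply: nnmfM.
have kE0 : 0 <= kappa%:E by rewrite lee_fin.
have k2E0 : 0 <= (2 * kappa)%:E by rewrite lee_fin mulr_ge0.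
pose U := unstopped k Q j.+1.
have mUj : measurable U by exact: mU.
have UQ : U `<=` Q by exact: unstopped_sub.
have mQU : measurable (Q `\` U) by exact: measurableD.
have on_stopped : \int[m]_(x in Q `\` U) dev x <=
    \int[m]_(x in Q `\` U) ((2 * kappa)%:E * (M x * (u x)%:E) +
                          kappa%:E * ((g x)%:E * (u x)%:E)).
  have nrhs : nnmf (fun x => (2 * kappa)%:E * (M x * (u x)%:E) +
                          kappa%:E * ((g x)%:E * (u x)%:E)).
    by apply: nnmfD; apply: nnmfM => //; apply: nnmf_cst.
  apply: (int_le_stopped DQ) => // i ij.
  apply: (int_le_saturated (stopped_saturated DQ (i := i))) => // P DP PS.
  have mP := mD DP; have DPb := stopped_bavg DQ DP PS.
  (* Seen from the stopped cube [P], the final generation is only [j - i] steps down, so the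
     induction hypothesis applies on [P]; replacing the average of [P] by that of [Q] costs at most
     [kappa] times the integral of g u. *)
  have jE : (k + j.+1%:Z = k + i.+1%:Z + (j - i)%N%:Z)%R.
    by rewrite -addrA -PoszD; congr (_ + _%:Z)%R; lia.
  have ji : (j - i < n)%N by lia.
  have IHP := IH (j - i)%N _ _ ji DP; rewrite -jE in IHP.
  apply: (@le_trans _ _ (\int[m]_(x in P)
      (`|bgen (k + j.+1%:Z) x - bavg P|%:E * ((g x)%:E * (u x)%:E) +
       kappa%:E * ((g x)%:E * (u x)%:E)))).
    apply: int_le => //.
      by apply: nnmfD; apply: nnmfM => //; apply: nnmf_cst.
    move=> x Px; rewrite -ge0_muleDl; [|by rewrite lee_fin|by []].
    apply: lee_wpmul2r; first by case: ngu.
    rewrite -EFinD lee_fin; apply: le_trans (ler_distD (bavg P) _ _) _.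
    by rewrite lerD2l.
  rewrite intD//; [|exact: nnmfM|by apply: nnmfM => //; apply: nnmf_cst].
  rewrite intD//; [|by apply: nnmfM => //; apply: nnmf_cst|by apply: nnmfM => //; apply: nnmf_cst].
  by apply: leeD => //; rewrite intZl.
have on_unstopped : \int[m]_(x in U) dev x <= kappa%:E * \int[m]_(x in U) ((g x)%:E * (u x)%:E).
  rewrite -intZl//; apply: int_le => //; first by apply: nnmfM => //; apply: nnmf_cst.
  move=> x [Qx xj]; apply: lee_wpmul2r; first by case: ngu.
  rewrite lee_fin; apply: le_trans (xj j (ltnSn j)) _.
  by rewrite /kappa lerDl mulr_ge0 ?(ltW beta0).
have half : mass m u Q <= 2%:E * mass m u U.
  have Q0 := u_gt0 DQ; have Qoo := u_lty DQ.
  have nbQ := nnmf_dist (bavg Q).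
  have b2 : 0 <= (2 * beta)%:E by rewrite lee_fin mulr_ge0 ?(ltW beta0).
  have : \int[m]_(x in Q `\` U) ((2 * beta)%:E * (u x)%:E) <=
      \int[m]_(x in Q `\` U) (`|b x - bavg Q|%:E * (u x)%:E).
    apply: (int_le_stopped DQ); [by apply: nnmfM => //; apply: nnmf_cst|exact: nnmfM|].
    move=> i ij; apply: (int_le_saturated (stopped_saturated DQ (i := i))).
    - by apply: nnmfM => //; apply: nnmf_cst.
    - exact: nnmfM.
    move=> P DP PS; apply: le_trans (bavg_dist _ DP); rewrite intZl//; last exact: mD DP.
    by apply: lee_wpmul2r; [exact: mass_ge0|rewrite lee_fin; exact: stopped_bavg_gt DP PS].
  rewrite intZl// => h1.
  have h2 : \int[m]_(x in Q `\` U) (`|b x - bavg Q|%:E * (u x)%:E) <= beta%:E * mass m u Q.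
    apply: le_trans (osc DQ); apply: int_subset => //; exact: nnmfM.
  have := le_trans h1 h2; rewrite -/(mass m u (Q `\` U)).
  have QE : mass m u Q = mass m u U + mass m u (Q `\` U) by exact: int_setD.
  have Uoo : mass m u U < +oo by rewrite (le_lt_trans _ Qoo)// mass_le.
  have QUoo : mass m u (Q `\` U) < +oo.
    by rewrite (le_lt_trans _ Qoo)// mass_le//; exact: subDsetl.
  rewrite QE -(fineK (x := mass m u U)) ?ge0_fin_numE ?mass_ge0//.
  rewrite -(fineK (x := mass m u (Q `\` U))) ?ge0_fin_numE ?mass_ge0//.
  rewrite -!EFinD -!EFinM !lee_fin.
  by move: beta0; set B := beta; set x := fine _; set y := fine _; nra.
have [i FQ] := DF DQ.
have avgM : \int[m]_(x in Q) ((g x)%:E * (u x)%:E) <= 2%:E * \int[m]_(x in U) (M x * (u x)%:E).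
  have Q0 := u_gt0 DQ; have Qoo := u_lty DQ.
  rewrite -(wavgK _ wu Qoo Q0).
  have a0 : 0 <= wavg m u (fun x => (g x)%:E) Q by exact: wavg_ge0.
  apply: le_trans (lee_wpmul2r a0 half) _.
  rewrite -muleA; apply: lee_wpmul2l => //.
  rewrite muleC /mass -intZl//; apply: int_le => //; first by apply: nnmfM => //; apply: nnmf_cst.
  move=> x /UQ Qx; apply: lee_wpmul2r; first exact: nnmf_ge0 nu.
  by rewrite -FQ; apply: le_dmax; rewrite FQ.
have splitQ (f : T -> \bar R) : nnmf f ->
    \int[m]_(x in Q) f x = \int[m]_(x in U) f x + \int[m]_(x in Q `\` U) f x.
  by move=> nf; apply: int_setD.
rewrite -/dev splitQ//.
apply: (le_trans (leeD on_unstopped on_stopped)).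
(* The surpluses on [U] and on its complement recombine into kappa times the integral of g u over
   [Q]. By [avgM] this is at most 2 kappa times the integral of M u over [U], which is exactly the
   part missing from the right side; the constant therefore does not grow along the induction. *)
rewrite intD//; [|by apply: nnmfM => //; apply: nnmf_cst|by apply: nnmfM => //; apply: nnmf_cst].
rewrite !intZl// addrCA addrC -ge0_muleDr ?int_ge0// -splitQ//.
rewrite [in leRHS]splitQ// [leRHS]ge0_muleDr ?int_ge0//.
apply: leeD => //; apply: le_trans (lee_wpmul2l kE0 avgM) _.
by rewrite muleA -EFinM mulrC.
Qed.

Hypothesis bgen_cvg : forall k : int,
  {ae m, forall x, X x -> bgen (k + j%:Z) x @[j --> \oo] --> b x}.

(** Fatou's lemma along the generations, which asks no integrability of [g]. The pointwise lower
    limit serves as integrand because it is measurable, while convergence holds only almost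
    everywhere. *)
Lemma int_dist_bavg k Q : D k Q ->
  \int[m]_(x in Q) (`|b x - bavg Q|%:E * ((g x)%:E * (u x)%:E)) <=
  (2 * (2 * beta + Cd * beta))%:E * \int[m]_(x in Q) (M x * (u x)%:E).
Proof.
move=> DQ; have mQ := mD DQ.
have ngu : nnmf (fun x => (g x)%:E * (u x)%:E) by nnmf.
pose dev j x := `|bgen (k + j%:Z) x - bavg Q|%:E * ((g x)%:E * (u x)%:E).
have ndev j : nnmf (dev j).
  apply: nnmfM => //; apply: nnmf_EFin => //; apply: measurableT_comp => //.
  by apply: measurable_funB; [exact: measurable_bgen|exact: measurable_cst].
have nlim : nnmf (fun x => limn_einf (dev ^~ x)).
  split; last first.
    move=> x; rewrite limn_einf_lim; apply: lime_ge; first exact: is_cvg_einfs.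
    by apply: nearW => n; apply: le_ereal_inf_tmp => _ [i _ <-]; exact: (ndev i).2.
  apply: emeasurable_fun_cvg (measurable_fun_einfs (fun n => (ndev n).1)) _ => x _.
  by rewrite limn_einf_lim; exact: is_cvg_einfs.
apply: (@le_trans _ _ (\int[m]_(x in Q) limn_einf (dev ^~ x))).
  apply: ae_ge0_le_integral => //.
  - by move=> x _; apply: mule_ge0; [rewrite lee_fin|case: ngu].
  - by apply: nnmfS; apply: nnmfM => //; exact: nnmf_dist.
  - by move=> x _; case: nlim.
  - exact: nnmfS nlim.
  apply: filterS (bgen_cvg k) => x bx Qx.
  have dx : dev j x @[j --> \oo] --> `|b x - bavg Q|%:E * ((g x)%:E * (u x)%:E).
    rewrite /dev; under eq_fun do rewrite -!EFinM.
    rewrite -!EFinM; apply: cvg_EFin; first by apply: nearW.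
    apply: cvgMl => /=; apply: cvg_norm; apply: cvgB; last exact: cvg_cst.
    by apply: bx; exact: (DX DQ).
  by have [-> _] := cvg_limn_einf_sup dx.
apply: (le_trans (fatou _ _ _ _)) => //.
- by move=> j; exact: nnmfS.
- by move=> j x _; case: (ndev j).
rewrite limn_einf_lim; apply: lime_le; first exact: is_cvg_einfs.
apply: nearW => n; apply: (@le_trans _ _ (\int[m]_(x in Q) dev n x)).
  by apply: ereal_inf_lbound; exists n => /=.
exact: int_bgen_dist.
Qed.

End dyadic_oscillation.

(** * Duality and the two commutator operators *)

Lemma absorb_half (R : realType) (I J : \bar R) (K a b : R) :
  I \is a fin_num -> J \is a fin_num ->
  (I <= K%:E * (a%:E * J + b%:E * I))%E -> K * b = 2^-1 -> (I <= (2 * K * a)%:E * J)%E.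
Proof.
case: I J => [i| |] [j| |]// _ _ h Kb.
have {}h : i <= K * (a * j + b * i) by rewrite -lee_fin; exact: h.
rewrite -EFinM lee_fin.
have : K * (a * j + b * i) = K * a * j + i / 2 by rewrite mulrDr !mulrA Kb (mulrC i).
by move=> e; rewrite e in h; rewrite -!mulrA; move: h; rewrite -!mulrA; set y := K * _; lra.
Qed.

Section duality.
Context d (T : measurableType d) (R : realType) (m : {measure set T -> \bar R}).
Local Open Scope ereal_scope.
Variables (p q : R) (u w s : T -> R).
Hypotheses (p1 : (1 < p)%R) (pq : (p^-1 + q^-1 = 1)%R).
Hypotheses (wu : weight u) (ww : weight w) (ws : weight s).
Hypothesis uws : forall x, (u x = w x `^ p^-1 * s x `^ q^-1)%R.
Variable Z : nat -> set T.
Hypotheses (mZ : forall n, measurable (Z n))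
  (ndZ : forall n k, (n <= k)%N -> Z n `<=` Z k)
  (coverZ : forall x, exists n, Z n x)
  (Zoo : forall n, mass m w (Z n) < +oo).

Let p0 : (0 < p)%R. Proof. exact: lt_trans p1. Qed.
Let q0 : (0 < q)%R. Proof. exact: conjugate_gt0 pq. Qed.
Let q1 : (1 < q)%R. Proof. exact: conjugate_gt1 pq. Qed.
Let qp : (q^-1 + p^-1 = 1)%R. Proof. exact: conjugate_sym. Qed.
Let suw x : (u x = s x `^ q^-1 * w x `^ p^-1)%R. Proof. by rewrite mulrC. Qed.

Variables (A : T -> \bar R) (J : \bar R) (K B : R).
Hypotheses (nA : nnmf A) (J0 : 0 <= J) (Joo : J < +oo) (K0 : (0 < K)%R) (B0 : (0 < B)%R).
Hypothesis bilinear : forall (g : T -> R) (c : R), (0 < c)%R ->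
  nnmf (fun x => (g x)%:E) ->
  \int[m]_x (A x * ((g x)%:E * (u x)%:E)) <=
  K%:E * ((c `^ p)%:E * J + (c `^ (- q) * B)%:E *
     \int[m]_x (poweR (g x)%:E q * (s x)%:E)).

(** Cut both in height and in space, so that its p-th power has a finite w-integral although [A] may
    be infinite. *)
Definition truncation (n : nat) (x : T) : R :=
  (fine (mine (A x) n%:R%:E) * \1_(Z n) x)%R.

Lemma fine_min_nat_ge0 n x : (0 <= fine (mine (A x) n%:R%:E))%R.
Proof.
case: (A x) (nnmf_ge0 x nA) => [r r0| _|//]; last by rewrite minye /= ler0n.
by rewrite -EFin_min /= le_min -lee_fin r0 ler0n.
Qed.

Lemma truncation_ge0 n x : (0 <= truncation n x)%R.
Proof.
apply: mulr_ge0; first exact: fine_min_nat_ge0.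
by rewrite indicE; case: (_ \in _).
Qed.

Lemma measurable_truncation n : measurable_fun [set: T] (truncation n).
Proof.
apply: measurable_funM; last exact: measurable_indic.
apply: measurableT_comp => //; apply: measurable_mine; first by case: nA.
exact: measurable_cst.
Qed.

Lemma truncation_le n x : (truncation n x)%:E <= A x.
Proof.
rewrite /truncation indicE; case: (_ \in _); rewrite ?mulr1 ?mulr0 ?(nnmf_ge0 _ nA)//.
case: (A x) (nnmf_ge0 x nA) => [r r0| _|//]; last by rewrite leey.
by rewrite -EFin_min /= lee_fin ge_min lexx.
Qed.

Lemma truncation_le_nat n x : (truncation n x <= n%:R * \1_(Z n) x)%R.
Proof.
apply: ler_wpM2r; first by rewrite indicE; case: (_ \in _).
case: (A x) (nnmf_ge0 x nA) => [r r0| _|//].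
  by rewrite -EFin_min /= ge_min lexx orbT.
by rewrite minye.
Qed.

Lemma truncation_nd n k x : (n <= k)%N -> (truncation n x <= truncation k x)%R.
Proof.
move=> nk; apply: ler_pM.
- exact: fine_min_nat_ge0.
- by rewrite indicE; case: (_ \in _).
- case: (A x) (nnmf_ge0 x nA) => [r r0| _|//]; last by rewrite !minye /= ler_nat.
  rewrite -!EFin_min /= le_min !ge_min lexx /=.
  by rewrite ler_nat nk orbT.
rewrite !indicE; case: (boolP (x \in Z n)) => [/set_mem Zx|_]; last by case: (_ \in _).
by rewrite mem_set//; exact: ndZ Zx.
Qed.

(* Test on [g = A_n `^ (p - 1) * w / u], where [A_n] is the truncation, so that
   [g `^ q * s = A_n `^ p * w], and choose [c] so as to absorb half of the left side. *)
Lemma truncation_bound n :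
  \int[m]_x ((truncation n x `^ p)%:E * (w x)%:E) <= ((2 * K) `^ p * B `^ (p - 1))%:E * J.
Proof.
have [ns nw] := (weight_nnmf ws, weight_nnmf ww).
have npow r : nnmf (fun x => (truncation n x `^ r)%:E).
  apply: nnmf_EFin => [|x]; last exact: powR_ge0.
  exact: measurableT_comp (measurable_powR r) (measurable_truncation n).
have wwu := weight_div ww wu.
pose g x := (truncation n x `^ (p - 1) * (w x / u x))%R.
have ng : nnmf (fun x => (g x)%:E).
  apply: nnmf_EFin => [|x].
    apply: measurable_funM; last by case: wwu.
    exact: measurableT_comp (measurable_powR _) (measurable_truncation n).
  by rewrite mulr_ge0 ?powR_ge0//; case: wwu => _ /(_ x)/ltW.
set I := \int[m]_x _.
have I0 : 0 <= I by apply: int_ge0; exact: nnmfM.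
have Ioo : I < +oo.
  apply: (@le_lt_trans _ _ ((n%:R `^ p)%:E * mass m w (Z n))); last first.
    by rewrite lte_mul_pinfty ?lee_fin ?powR_ge0// ge0_fin_numE.
  have np0 : 0 <= (n%:R `^ p : R)%:E by rewrite lee_fin powR_ge0.
  rewrite /mass -(nnmf_int_indic m (mZ n) nw) -intZl//; last by nnmf.
  apply: int_le => //; [exact: nnmfM|by nnmf|move=> x _].
  rewrite muleCA muleC lee_wpmul2l ?(nnmf_ge0 _ nw)// -EFinM lee_fin.
  have := truncation_le_nat n x; have := truncation_ge0 n x.
  rewrite indicE; case: (_ \in _); rewrite ?mulr1 ?mulr0 => t0 tn.
    by rewrite ge0_ler_powR ?nnegrE ?(ltW p0).
  by rewrite (@le_anti _ _ (truncation n x) 0%R) ?tn// powR0 ?gt_eqF.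
have gI : \int[m]_x (poweR (g x)%:E q * (s x)%:E) = I.
  apply: eq_integral => x _; rewrite poweR_EFin -!EFinM; congr EFin.
  have [[_ /(_ x) w0] [_ /(_ x) u0]] := (ww, wu).
  rewrite /g powRM ?powR_ge0 ?divr_ge0 ?ltW// -powRrM (conjugate_mul p1 pq) -mulrA.
  congr (_ * _)%R; rewrite -[s x](triple_powl q1 qp ws ww suw x) mulrA.
  rewrite -powRM ?divr_ge0 ?(ltW w0) ?(ltW u0)//.
  have -> : (w x / u x * (u x / w x) = 1)%R by field; rewrite !gt_eqF.
  by rewrite powR1 mul1r.
have [Ifin Jfin] : (I \is a fin_num) /\ (J \is a fin_num) by rewrite !ge0_fin_numE.
pose c := ((2 * K * B) `^ q^-1)%R.
have KB0 : (0 < 2 * K * B)%R by rewrite !mulr_gt0.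
have c0 : (0 < c)%R by rewrite powR_gt0.
have := bilinear c0 ng; rewrite gI.
have -> : (c `^ (- q) * B = (2 * K)^-1)%R.
  rewrite powRN -powRrM mulVf ?gt_eqF// powRr1 ?(ltW KB0)//.
  by field; rewrite !gt_eqF.
have -> : (c `^ p = (2 * K * B) `^ (p - 1))%R.
  rewrite -powRrM; congr (_ `^ _)%R; rewrite mulrC.
  have -> : (q^-1 = 1 - p^-1)%R by rewrite -pq addrAC subrr add0r.
  by field; rewrite gt_eqF.
have IA : I <= \int[m]_x (A x * ((g x)%:E * (u x)%:E)).
  apply: int_le => //; [exact: nnmfM|by have nu := weight_nnmf wu; nnmf|move=> x _].
  have [[_ /(_ x) w0] [_ /(_ x) u0]] := (ww, wu).
  apply: (@le_trans _ _ ((truncation n x)%:E * ((g x)%:E * (u x)%:E))).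
    have -> : ((g x)%:E * (u x)%:E = (truncation n x `^ (p - 1) * w x)%:E).
      by rewrite -EFinM /g -mulrA divfK ?gt_eqF.
    rewrite -!EFinM lee_fin [leRHS]mulrA.
    by rewrite mulr_powRB1// truncation_ge0.
  apply: lee_wpmul2r; last exact: truncation_le.
  by rewrite mule_ge0 ?(nnmf_ge0 _ ng)// lee_fin ltW.
move=> /(le_trans IA) /(absorb_half Ifin Jfin) h; apply: le_trans (h _) _.
  by field; rewrite gt_eqF.
have K20 : (0 <= 2 * K)%R by rewrite mulr_ge0 ?ltW.
by rewrite powRM ?(ltW B0)// mulrA mulr_powRB1// mulr_gt0.
Qed.

(** A converse to Hölder's inequality: the bound for the truncations does not depend on [n] and
    passes to the limit by monotone convergence. *)
Lemma duality : \int[m]_x (poweR (A x) p * (w x)%:E) <=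
  ((2 * K) `^ p * B `^ (p - 1))%:E * J.
Proof.
have nw := weight_nnmf ww.
have nG n : nnmf (fun x => (truncation n x `^ p)%:E * (w x)%:E).
  apply: nnmfM => //; apply: nnmf_EFin => [|x]; last exact: powR_ge0.
  exact: measurableT_comp (measurable_powR p) (measurable_truncation n).
have ndG x : nondecreasing_seq (fun n => (truncation n x `^ p)%:E * (w x)%:E).
  move=> n k nk; apply: lee_wpmul2r; first exact: nnmf_ge0 nw.
  rewrite lee_fin; apply: ge0_ler_powR; rewrite ?nnegrE ?truncation_ge0 ?(ltW p0)//.
  exact: truncation_nd.
have cvg := @cvg_monotone_convergence _ _ _ m setT measurableT _ (fun n => (nG n).1)
  (fun n x _ => (nG n).2 x) (fun x _ => ndG x).
apply: (@le_trans _ _ (\int[m]_x limn (fun n => (truncation n x `^ p)%:E * (w x)%:E))).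
  apply: ge0_le_integral => //.
  - by move=> x _; rewrite mule_ge0 ?poweR_ge0 ?(nnmf_ge0 _ nw).
  - by apply: nnmfS; apply: nnmfM => //; apply: nnmf_poweR.
  - apply: emeasurable_fun_cvg (fun n => (nG n).1) _ => x _.
    by apply: ereal_nondecreasing_is_cvgn; exact: ndG.
  move=> x _; set L := limn _.
  have wx0 : (0 < w x)%R by case: ww.
  have GL n : (truncation n x `^ p)%:E * (w x)%:E <= L.
    apply: lime_ge; first by apply: ereal_nondecreasing_is_cvgn; exact: ndG.
    by exists n => // k /= nk; exact: ndG.
  have [n Zx] := coverZ x.
  have Zk k : (n <= k)%N -> (\1_(Z k) x : R)%R = 1%R.
    by move=> nk; rewrite indicE mem_set//; exact: ndZ nk _ Zx.
  move E : (A x) (nnmf_ge0 x nA) => [r| |] // r0.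
    pose k := maxn n (Num.bound r).
    apply: le_trans (GL k); apply: lee_wpmul2r; first by rewrite lee_fin ltW.
    rewrite poweR_EFin lee_fin /truncation E Zk ?leq_maxl// mulr1.
    rewrite min_l ?lexx//= lee_fin; apply: ltW; apply: (lt_le_trans (archi_boundP r0)).
    by rewrite ler_nat leq_maxr.
  suff -> : L = +oo by rewrite leey.
  (* Where [A x] is infinite the truncation at [k] is [k] itself. Being at least 1, [k] is at most
     its p-th power, so k >= |M| / w x suffices to exceed the level [M]. *)
  apply: eq_infty => M; pose k := maxn n (Num.bound (`|M| / w x)).+1.
  apply: le_trans (GL k); rewrite -EFinM lee_fin /truncation E Zk ?leq_maxl// mulr1 minye /=.
  have k1 : (1 <= k%:R :> R)%R by rewrite ler1n (leq_trans _ (leq_maxr _ _)).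
  have kM : (`|M| / w x <= k%:R)%R.
    have Mw0 : (0 <= `|M| / w x)%R by rewrite divr_ge0 ?(ltW wx0).
    apply: ltW; apply: (lt_le_trans (archi_boundP Mw0)).
    by rewrite ler_nat (leq_trans _ (leq_maxr _ _)).
  apply: (le_trans (ler_norm M)); rewrite -ler_pdivrMr//; apply: (le_trans kM).
  by apply: le1r_powR => //; exact: ltW.
rewrite -(cvg_lim _ cvg)//; apply: lime_le; first by apply/cvg_ex; eexists; exact: cvg.
by apply: nearW => n; exact: truncation_bound.
Qed.

End duality.

Lemma mule_shuffle (R : realType) (a c y v z : \bar R) :
  (a * (c * y * v * z) = c * v * (y * a * z))%E.
Proof.
rewrite -!muleA (muleCA a); congr (_ * _)%E.
by rewrite [LHS]muleCA [RHS]muleCA; congr (_ * _)%E; rewrite muleCA.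
Qed.

(** * The power of the A_p constant in the two operator norms *)

Section norm_constants.
Variables (R : realType) (p q W kap K c : R).
Hypotheses (p1 : 1 < p) (pq : p^-1 + q^-1 = 1) (W1 : 1 <= W) (kap0 : 0 < kap)
  (K0 : 0 < K) (c0 : 0 < c).

Let p0 : 0 < p. Proof. exact: lt_trans p1. Qed.
Let q0 : 0 < q. Proof. exact: conjugate_gt0 pq. Qed.
Let q1 : 1 < q. Proof. exact: conjugate_gt1 pq. Qed.
Let W0 : 0 < W. Proof. exact: lt_le_trans W1. Qed.

(** The form contributes W^e and the maximal operator one more W, since B = W^q c enters with the
    power p - 1 and q (p - 1) = p. Finally e + 1 <= 2 e. *)
Lemma op_arith (e : R) : 1 <= e ->
  (2 * (kap * (W `^ e * K))) `^ p * (W `^ q * c) `^ (p - 1) <=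
  (2 * K * (c `^ q^-1 + c `^ p^-1) * kap * W `^ (2 * e)) `^ p.
Proof.
move=> e1.
have cq0 : 0 <= c `^ q^-1 by exact: powR_ge0.
have We0 : 0 <= W `^ e by exact: powR_ge0.
have -> : (W `^ q * c) `^ (p - 1) = (W * c `^ q^-1) `^ p.
  rewrite (powRM _ (powR_ge0 _ _) (ltW c0)) (powRM _ (ltW W0) cq0) -!powRrM.
  have -> : q * (p - 1) = p by rewrite mulrC (conjugate_mul p1 pq).
  congr (_ * _ `^ _); rewrite -[X in _ = _ * X](conjugate_mul p1 pq) mulrCA.
  by rewrite mulVf ?mulr1// gt_eqF.
have l0 : 0 <= 2 * (kap * (W `^ e * K)) by rewrite !mulr_ge0 ?(ltW kap0) ?(ltW K0).
have r0 : 0 <= W * c `^ q^-1 by rewrite mulr_ge0 ?(ltW W0).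
rewrite -(powRM _ l0 r0); apply: (ge0_ler_powR (ltW p0)).
- by rewrite nnegrE mulr_ge0.
- by rewrite nnegrE !mulr_ge0 ?addr_ge0 ?powR_ge0 ?(ltW kap0) ?(ltW K0).
have -> : 2 * (kap * (W `^ e * K)) * (W * c `^ q^-1) =
    2 * K * c `^ q^-1 * kap * (W `^ e * W) by ring.
have We : W `^ e * W <= W `^ (2 * e).
  rewrite -[X in _ * X <= _](powRr1 (ltW W0)) -powRD ?(gt_eqF W0) ?implybT//.
  by rewrite ler_powR// mulr2n mulrDl mul1r lerD2l.
have K20 : 0 <= 2 * K by rewrite mulr_ge0 ?(ltW K0).
apply: ler_pM => //.
- by rewrite !mulr_ge0 ?(ltW kap0) ?(ltW K0).
- by rewrite mulr_ge0 ?(ltW W0).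
- by rewrite ler_pM2r//; apply: ler_wpM2l => //; rewrite lerDl powR_ge0.
Qed.

(** [V] is the A_q constant of the exchanged weights. The constant B = V^p c stands in front of the
    form and its inverse in the duality, which leaves B^(1/p) = V c^(1/p). The total power of W is
    (q - 1) max(1, p - 1) + (q - 1), that is max(q - 1, 1) + (q - 1), at most twice max(1, q -
    1). *)
Lemma star_arith (V := W `^ (q - 1)) :
  (2 * (kap * (V `^ Num.max 1 (p - 1) * K) * (V `^ p * c))) `^ p *
    (V `^ p * c)^-1 `^ (p - 1) <=
  (2 * K * (c `^ q^-1 + c `^ p^-1) * kap * W `^ (2 * Num.max 1 (q - 1))) `^ p.
Proof.
have V0 : 0 < V by exact: powR_gt0.
have pq1 : (q - 1) * (p - 1) = 1.
  by rewrite -(conjugate_inv p1 pq) mulVf// gt_eqF// subr_gt0.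
have q10 : 0 <= q - 1 by rewrite subr_ge0 ltW.
have We : V `^ Num.max 1 (p - 1) * V <= W `^ (2 * Num.max 1 (q - 1)).
  rewrite /V -powRrM -powRD ?(gt_eqF W0) ?implybT//.
  rewrite ler_powR// maxr_pMr// pq1 mulr1 maxC mulr2n mulrDl mul1r lerD2l.
  by rewrite le_max lexx orbT.
move: V V0 We => V V0 We; set B := V `^ p * c; set M := Num.max 1 (p - 1) in We *.
have B0 : 0 < B by rewrite mulr_gt0 ?powR_gt0.
have VM0 : 0 <= V `^ M by exact: powR_ge0.
have cp0 : 0 <= c `^ p^-1 by exact: powR_ge0.
have Bp0 : 0 <= B `^ p^-1 by exact: powR_ge0.
have KM0 : 0 <= 2 * (kap * (V `^ M * K)) by rewrite !mulr_ge0 ?(ltW kap0) ?(ltW K0).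
have -> : (2 * (kap * (V `^ M * K) * B)) `^ p * B^-1 `^ (p - 1) =
    (2 * (kap * (V `^ M * K)) * B `^ p^-1) `^ p.
  rewrite mulrA (powRM _ KM0 (ltW B0)) (powRM _ KM0 Bp0) -mulrA; congr (_ * _).
  rewrite -powRrM mulVf ?gt_eqF// -(powR_inv1 (ltW B0)) -powRrM -powRD.
    by congr (_ `^ _); ring.
  by rewrite (gt_eqF B0) implybT.
have -> : B `^ p^-1 = V * c `^ p^-1.
  rewrite /B (powRM _ (powR_ge0 _ _) (ltW c0)) -powRrM divff ?gt_eqF//.
  by rewrite powRr1// ltW.
apply: (ge0_ler_powR (ltW p0)).
- by rewrite nnegrE !mulr_ge0// ltW.
- by rewrite nnegrE !mulr_ge0 ?addr_ge0 ?powR_ge0 ?(ltW kap0) ?(ltW K0).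
have -> : 2 * (kap * (V `^ M * K)) * (V * c `^ p^-1) =
    2 * K * c `^ p^-1 * kap * (V `^ M * V) by ring.
have K20 : 0 <= 2 * K by rewrite mulr_ge0 ?(ltW K0).
apply: ler_pM => //.
- by rewrite !mulr_ge0 ?(ltW kap0) ?(ltW K0).
- by rewrite mulr_ge0// ltW.
- by rewrite ler_pM2r//; apply: ler_wpM2l => //; rewrite lerDr powR_ge0.
Qed.

End norm_constants.

(** * Nonnegative commutator operators, their common form and their norms *)

Section commutator_form.
Context d (T : measurableType d) (R : realType) (m : {measure set T -> \bar R}).
Local Open Scope ereal_scope.
Variables (u b : T -> R) (F E : nat -> set T) (k : nat -> nat) (bb : nat -> R).
Variables (L kap : R) (N : nat).
Hypotheses (wu : weight u) (mb : measurable_fun [set: T] b)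
  (mF : forall i, measurable (F i)) (nF : nested F)
  (uoo : forall i, mass m u (F i) < +oo)
  (mE : forall i, measurable (E i)) (EF : forall i, E i `<=` F (k i))
  (L0 : (0 <= L)%R) (EL : forall i, mass m u (F (k i)) <= L%:E * mass m u (E i))
  (ov : forall x, \sum_(i <oo) (\1_(E i) x : R)%:E <= N%:R%:E)
  (kap0 : (0 <= kap)%R)
  (JN : forall g : T -> R, nnmf (fun x => (g x)%:E) -> forall i,
    \int[m]_(x in F (k i)) (`|b x - bb i|%:E * ((g x)%:E * (u x)%:E)) <=
    kap%:E * \int[m]_(x in F (k i)) (dmax m u F (fun x => (g x)%:E) x * (u x)%:E)).

Let nu := weight_nnmf wu.

Lemma nnmf_osc i : nnmf (fun x => `|b x - bb i|%:E).
Proof.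
apply: nnmf_EFin => //; apply: measurableT_comp => //.
by apply: measurable_funB => //; exact: measurable_cst.
Qed.

Definition invU i : R := (fine (mass m u (F (k i))))^-1.

Lemma invU0 i : 0 <= (invU i)%:E.
Proof. by rewrite lee_fin invr_ge0 fine_ge0// mass_ge0. Qed.

(** The second argument carries the oscillation. Pairing [comm_op f] with g gives [cform f g], while
    pairing [comm_star f] with g gives [cform g f]. *)
Definition cform (f : T -> \bar R) (g : T -> R) : \bar R :=
  \sum_(i <oo) (invU i)%:E *
    (\int[m]_(x in F (k i)) (f x * (u x)%:E) *
     \int[m]_(x in F (k i)) (`|b x - bb i|%:E * ((g x)%:E * (u x)%:E))).

Definition comm_op (f : T -> \bar R) (x : T) : \bar R :=
  \sum_(i <oo) (invU i)%:E * `|b x - bb i|%:E *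
    \int[m]_(x in F (k i)) (f x * (u x)%:E) * (\1_(F (k i)) x)%:E.

Definition comm_star (g : T -> R) (x : T) : \bar R :=
  \sum_(i <oo) (invU i)%:E *
    \int[m]_(x in F (k i)) (`|b x - bb i|%:E * ((g x)%:E * (u x)%:E)) *
    (\1_(F (k i)) x)%:E.

Lemma nnmf_comm_op f : nnmf f -> nnmf (comm_op f).
Proof.
move=> nf; apply: nnmf_nneseries => i; apply: nnmfM; last exact: nnmf_indic.
apply: nnmfM; last by apply: nnmf_cst; apply: int_ge0; nnmf.
by apply: nnmfM; [apply: nnmf_cst; exact: invU0|exact: nnmf_osc].
Qed.

Lemma nnmf_comm_star g : nnmf (fun x => (g x)%:E) -> nnmf (comm_star g).
Proof.
move=> ng; apply: nnmf_nneseries => i; apply: nnmfM; last exact: nnmf_indic.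
have no := nnmf_osc i.
by apply: nnmf_cst; apply: mule_ge0; [exact: invU0|apply: int_ge0; nnmf].
Qed.

Lemma int_comm_op f g : nnmf f -> nnmf (fun x => (g x)%:E) ->
  \int[m]_x (comm_op f x * ((g x)%:E * (u x)%:E)) = cform f g.
Proof.
move=> nf ng; have no := nnmf_osc.
have fu0 i : 0 <= \int[m]_(x in F (k i)) (f x * (u x)%:E) by apply: int_ge0; nnmf.
have ni i : nnmf (fun x => (\1_(F (k i)) x : R)%:E) by exact: nnmf_indic.
pose t i x := (invU i)%:E * `|b x - bb i|%:E *
    \int[m]_(x in F (k i)) (f x * (u x)%:E) * (\1_(F (k i)) x)%:E.
have nt i : nnmf (t i).
  apply: nnmfM => //; apply: nnmfM; last exact: nnmf_cst.
  by apply: nnmfM => //; apply: nnmf_cst; exact: invU0.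
have -> : \int[m]_x (comm_op f x * ((g x)%:E * (u x)%:E)) =
    \int[m]_x (\sum_(i <oo) ((g x * u x)%:E * t i x)).
  apply: eq_integral => x _; rewrite nneseriesZl; last by move=> i _; case: (nt i).
  by rewrite -EFinM muleC.
have ngu : nnmf (fun x => (g x * u x)%:E).
  have -> : (fun x => (g x * u x)%:E) = (fun x => (g x)%:E * (u x)%:E).
    by apply/funext => x; rewrite EFinM.
  exact: nnmfM.
rewrite int_nneseries//; last by move=> i; exact: nnmfM.
apply: eq_eseriesr => i _.
have nogu : nnmf (fun x => `|b x - bb i|%:E * ((g x)%:E * (u x)%:E)) by nnmf.
rewrite muleA -(nnmf_int_indic m (mF (k i)) nogu) -intZl//; last 2 first.
- by nnmf.
- by apply: mule_ge0 => //; exact: invU0.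
apply: eq_integral => x _; rewrite /t EFinM; exact: mule_shuffle.
Qed.

Lemma int_comm_star f g : nnmf (fun x => (f x)%:E) -> nnmf (fun x => (g x)%:E) ->
  \int[m]_x (comm_star f x * ((g x)%:E * (u x)%:E)) = cform (fun x => (g x)%:E) f.
Proof.
move=> nf ng; have no := nnmf_osc.
have fu0 i : 0 <= \int[m]_(x in F (k i)) (`|b x - bb i|%:E * ((f x)%:E * (u x)%:E)).
  by apply: int_ge0; nnmf.
have ni i : nnmf (fun x => (\1_(F (k i)) x : R)%:E) by exact: nnmf_indic.
pose t i x := (invU i)%:E *
    \int[m]_(x in F (k i)) (`|b x - bb i|%:E * ((f x)%:E * (u x)%:E)) *
    (\1_(F (k i)) x)%:E.
have nt i : nnmf (t i).
  by apply: nnmfM => //; apply: nnmf_cst; apply: mule_ge0 => //; exact: invU0.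
have -> : \int[m]_x (comm_star f x * ((g x)%:E * (u x)%:E)) =
    \int[m]_x (\sum_(i <oo) ((g x * u x)%:E * t i x)).
  apply: eq_integral => x _; rewrite nneseriesZl; last by move=> i _; case: (nt i).
  by rewrite -EFinM muleC.
have ngu : nnmf (fun x => (g x * u x)%:E).
  have -> : (fun x => (g x * u x)%:E) = (fun x => (g x)%:E * (u x)%:E).
    by apply/funext => x; rewrite EFinM.
  exact: nnmfM.
have ngu' : nnmf (fun x => (g x)%:E * (u x)%:E) by exact: nnmfM.
rewrite int_nneseries//; last by move=> i; exact: nnmfM.
apply: eq_eseriesr => i _.
rewrite [X in _ = _ * X]muleC muleA -(nnmf_int_indic m (mF (k i)) ngu') -intZl//; last 2 first.
- by nnmf.
- by apply: mule_ge0 => //; exact: invU0.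
by apply: eq_integral => x _; rewrite /t EFinM muleCA.
Qed.

Section bound.
Variables (p q : R) (w s : T -> R) (W : R).
Hypotheses (p1 : (1 < p)%R) (pq : (p^-1 + q^-1 = 1)%R)
  (ww : weight w) (ws : weight s)
  (uws : forall x, (u x = w x `^ p^-1 * s x `^ q^-1)%R)
  (woo : forall i, mass m w (F i) < +oo) (soo : forall i, mass m s (F i) < +oo)
  (W1 : (1 <= W)%R)
  (Ap : forall i, (fine (mass m w (F i)) * fine (mass m s (F i)) `^ (p - 1)
    <= W * fine (mass m u (F i)) `^ p)%R).

Let p0 : (0 < p)%R. Proof. exact: lt_trans p1. Qed.
Let q0 : (0 < q)%R. Proof. exact: conjugate_gt0 pq. Qed.
Let W0 : (0 <= W)%R. Proof. exact: le_trans W1. Qed.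

Definition form_const : R :=
  (kap * (W `^ Num.max 1 (q - 1) *
    ((L `^ (p - 1) + L `^ (q - 1)) * (N%:R * (q `^ p + p `^ q)))))%R.

Lemma form_const_ge0 : (0 <= form_const)%R.
Proof.
by apply: mulr_ge0 => //; rewrite !mulr_ge0 ?addr_ge0 ?powR_ge0.
Qed.

Lemma cform_le f g : nnmf f -> nnmf (fun x => (g x)%:E) ->
  cform f g <= form_const%:E * (\int[m]_x (poweR (f x) p * (w x)%:E) +
    (W `^ q * (q `^ p * p `^ q))%:E * \int[m]_x (poweR (g x)%:E q * (s x)%:E)).
Proof.
move=> nf ng; have [nw ns] := (weight_nnmf ww, weight_nnmf ws); have no := nnmf_osc.
have nM := nnmf_dmax m wu mF ng.
have fu0 i : 0 <= \int[m]_(x in F (k i)) (f x * (u x)%:E) by apply: int_ge0; nnmf.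
have Mu0 i : 0 <= \int[m]_(x in F (k i)) (dmax m u F (fun x => (g x)%:E) x * (u x)%:E).
  by apply: int_ge0; nnmf.
have k0 : 0 <= kap%:E by rewrite lee_fin.
apply: (@le_trans _ _ (\sum_(i <oo) kap%:E * ((invU i)%:E *
    (\int[m]_(x in F (k i)) (f x * (u x)%:E) *
     \int[m]_(x in F (k i)) (dmax m u F (fun x => (g x)%:E) x * (u x)%:E))))).
  apply: lee_nneseries => [i _ _|i _].
    apply: mule_ge0; first exact: invU0.
    by apply: mule_ge0 => //; apply: int_ge0; nnmf.
  rewrite [leRHS]muleCA; apply: lee_wpmul2l; first exact: invU0.
  by rewrite [leRHS]muleCA; apply: lee_wpmul2l => //; exact: JN.
rewrite nneseriesZl; last by move=> i _; rewrite !mule_ge0// invU0.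
rewrite EFinM -muleA; apply: lee_wpmul2l => //.
apply: (le_trans (sparse_form p1 pq wu ww ws uws mF nF uoo woo soo W1 Ap mE EF L0 EL ov nf nM)).
apply: lee_wpmul2l; first by rewrite lee_fin !mulr_ge0 ?addr_ge0 ?powR_ge0.
rewrite leeD2l//.
exact: (buckley p1 pq wu ww ws uws mF nF uoo woo soo W0 Ap ng).
Qed.

Lemma cform_scale f g (c : R) : (0 < c)%R -> nnmf f -> nnmf (fun x => (g x)%:E) ->
  cform f g = cform (fun x => c%:E * f x) (fun x => c^-1 * g x)%R.
Proof.
move=> c0 nf ng; have no := nnmf_osc.
have cE0 : 0 <= c%:E by rewrite lee_fin ltW.
have cV0 : 0 <= c^-1%:E by rewrite lee_fin invr_ge0 ltW.
apply: eq_eseriesr => i _; congr (_ * _).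
have -> : \int[m]_(x in F (k i)) (c%:E * f x * (u x)%:E) =
    c%:E * \int[m]_(x in F (k i)) (f x * (u x)%:E).
  by rewrite -intZl//; [apply: eq_integral => x _; rewrite muleA|nnmf].
have -> : \int[m]_(x in F (k i)) (`|b x - bb i|%:E * ((c^-1 * g x)%:E * (u x)%:E)) =
    c^-1%:E * \int[m]_(x in F (k i)) (`|b x - bb i|%:E * ((g x)%:E * (u x)%:E)).
  rewrite -intZl//; last by nnmf.
  apply: eq_integral => x _.
  have -> : (c^-1 * g x)%:E * (u x)%:E = c^-1%:E * ((g x)%:E * (u x)%:E).
    by rewrite EFinM muleA.
  by rewrite muleCA.
by rewrite muleACA -EFinM divff ?gt_eqF// mul1e.
Qed.

(** The invariance of the form under (f, g) -> (c f, g / c) supplies the free parameter that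
    [duality] optimizes in place of Hölder's inequality. *)
Lemma cform_le_scaled f g (c : R) : (0 < c)%R -> nnmf f -> nnmf (fun x => (g x)%:E) ->
  cform f g <= form_const%:E * ((c `^ p)%:E * \int[m]_x (poweR (f x) p * (w x)%:E) +
    (c `^ (- q) * (W `^ q * (q `^ p * p `^ q)))%:E *
      \int[m]_x (poweR (g x)%:E q * (s x)%:E)).
Proof.
move=> c0 nf ng; have [nw ns] := (weight_nnmf ww, weight_nnmf ws).
have cE0 : 0 <= c%:E by rewrite lee_fin ltW.
have cV0 : (0 <= c^-1)%R by rewrite invr_ge0 ltW.
have nf' : nnmf (fun x => c%:E * f x) by nnmf.
have ng' : nnmf (fun x => (c^-1 * g x)%:E).
  have -> : (fun x => (c^-1 * g x)%:E) = (fun x => c^-1%:E * (g x)%:E).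
    by apply/funext => x; rewrite EFinM.
  by apply: nnmfM => //; apply: nnmf_cst; rewrite lee_fin.
rewrite (cform_scale c0 nf ng); apply: (le_trans (cform_le nf' ng')).
apply: lee_wpmul2l; first by rewrite lee_fin form_const_ge0.
apply: leeD.
  rewrite -intZl; [|by []|by nnmf|by rewrite lee_fin powR_ge0].
  apply: int_le => //; [by nnmf|by nnmf; rewrite lee_fin powR_ge0|move=> x _].
  by rewrite poweRM ?(nnmf_ge0 _ nf)// poweR_EFin muleA.
rewrite [X in _ <= X * _](_ : _ =
    (W `^ q * (q `^ p * p `^ q))%:E * (c `^ (- q))%:E); last by rewrite -EFinM mulrC.
rewrite -muleA; apply: lee_wpmul2l.
  by rewrite lee_fin !mulr_ge0 ?powR_ge0.
rewrite -intZl; [|by []|by nnmf|by rewrite lee_fin powR_ge0].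
apply: int_le => //; [by nnmf|by nnmf; rewrite lee_fin powR_ge0|move=> x _].
have gx0 : (0 <= g x)%R by rewrite -lee_fin (nnmf_ge0 _ ng).
rewrite !poweR_EFin powRM// EFinM -(powR_inv1 (ltW c0)) -powRrM mulN1r.
by rewrite muleA.
Qed.

End bound.

Section norm_bounds.
Variables (p q : R) (w s : T -> R) (W : R) (Z : nat -> set T).
Hypotheses (p1 : (1 < p)%R) (pq : (p^-1 + q^-1 = 1)%R)
  (ww : weight w) (ws : weight s)
  (uws : forall x, (u x = w x `^ p^-1 * s x `^ q^-1)%R)
  (woo : forall i, mass m w (F i) < +oo) (soo : forall i, mass m s (F i) < +oo)
  (W1 : (1 <= W)%R)
  (Ap : forall i, (fine (mass m w (F i)) * fine (mass m s (F i)) `^ (p - 1)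
    <= W * fine (mass m u (F i)) `^ p)%R).
Hypotheses (mZ : forall n, measurable (Z n))
  (ndZ : forall n k, (n <= k)%N -> Z n `<=` Z k)
  (coverZ : forall x, exists n, Z n x)
  (Zoo : forall n, mass m w (Z n) < +oo).
Hypotheses (kap_gt0 : (0 < kap)%R) (L_gt0 : (0 < L)%R) (N_gt0 : (0 < N)%N).

Let p0 : (0 < p)%R. Proof. exact: lt_trans p1. Qed.
Let q0 : (0 < q)%R. Proof. exact: conjugate_gt0 pq. Qed.
Let q1 : (1 < q)%R. Proof. exact: conjugate_gt1 pq. Qed.
Let qp : (q^-1 + p^-1 = 1)%R. Proof. exact: conjugate_sym. Qed.
Let suw x : (u x = s x `^ q^-1 * w x `^ p^-1)%R. Proof. by rewrite mulrC. Qed.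
Let W_gt0 : (0 < W)%R. Proof. exact: lt_le_trans W1. Qed.
Let W' := (W `^ (q - 1))%R.
Let W'1 : (1 <= W')%R.
Proof. by rewrite /W' -[leLHS](powRr0 W) ler_powR// subr_ge0 ltW. Qed.
Let Ap' i : (fine (mass m s (F i)) * fine (mass m w (F i)) `^ (q - 1)
    <= W' * fine (mass m u (F i)) `^ q)%R.
Proof. exact: (Ap_dual p1 pq wu ww ws W1 Ap). Qed.

(** Unchanged when [p] and [q] are exchanged: the last factor adds the power 1/q that the operator
    produces and the power 1/p that its adjoint produces. *)
Definition op_const : R :=
  (2 * ((L `^ (p - 1) + L `^ (q - 1)) * (N%:R * (q `^ p + p `^ q))) *
   ((q `^ p * p `^ q) `^ q^-1 + (q `^ p * p `^ q) `^ p^-1))%R.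

Let e := Num.max 1%R (q - 1)%R.
Let c0 := ((q `^ p * p `^ q))%R.
Let c0_gt0 : (0 < c0)%R. Proof. by rewrite mulr_gt0 ?powR_gt0. Qed.
Let K2 := ((L `^ (p - 1) + L `^ (q - 1)) * (N%:R * (q `^ p + p `^ q)))%R.
Let K2_gt0 : (0 < K2)%R.
Proof. by rewrite !mulr_gt0 ?addr_gt0 ?powR_gt0 ?ltr0n. Qed.
Let e1 : (1 <= e)%R. Proof. by rewrite le_max lexx. Qed.

Lemma comm_op_bound f : nnmf f -> \int[m]_x (poweR (f x) p * (w x)%:E) < +oo ->
  \int[m]_x (poweR (comm_op f x) p * (w x)%:E) <=
  ((op_const * kap * W `^ (2 * e)) `^ p)%:E * \int[m]_x (poweR (f x) p * (w x)%:E).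
Proof.
move=> nf foo; have nw := weight_nnmf ww.
have f0 : 0 <= \int[m]_x (poweR (f x) p * (w x)%:E) by apply: int_ge0; nnmf.
have K_gt0 : (0 < form_const p q W)%R.
  by apply: mulr_gt0 => //; apply: mulr_gt0 => //; rewrite powR_gt0.
have B_gt0 : (0 < W `^ q * (q `^ p * p `^ q))%R.
  by apply: mulr_gt0 => //; rewrite powR_gt0.
have dual := duality p1 pq wu ww ws uws mZ ndZ coverZ Zoo (nnmf_comm_op nf) f0 foo K_gt0 B_gt0.
apply: le_trans (dual _) _ => [g c cgt0 ng|].
  by rewrite int_comm_op//; exact: (cform_le_scaled p1 pq ww ws uws woo soo W1 Ap cgt0 nf ng).
apply: lee_wpmul2r => //; rewrite lee_fin.
rewrite /form_const /op_const.
by apply: (op_arith p1 pq W1 kap_gt0 K2_gt0 c0_gt0 e1).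
Qed.

(** In [cform g f] the maximal operator falls on f, which lives in L^p(w), so the form bound is used
    with both weights and exponents exchanged and with scale 1/c. The constant [B] then multiplies
    the integral of f^p; it is pulled out of the sum, and 1/B remains on the test function. *)
Lemma comm_star_bound (f : T -> R) : nnmf (fun x => (f x)%:E) ->
  \int[m]_x (poweR (f x)%:E p * (w x)%:E) < +oo ->
  \int[m]_x (poweR (comm_star f x) p * (w x)%:E) <=
  ((op_const * kap * W `^ (2 * e)) `^ p)%:E * \int[m]_x (poweR (f x)%:E p * (w x)%:E).
Proof.
move=> nf foo; have nw := weight_nnmf ww.
have f0 : 0 <= \int[m]_x (poweR (f x)%:E p * (w x)%:E) by apply: int_ge0; nnmf.
pose B := (W' `^ p * (p `^ q * q `^ p))%R.
have B_gt0 : (0 < B)%R by rewrite !mulr_gt0 ?powR_gt0.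
pose Kf := form_const q p W'.
have Kf_gt0 : (0 < Kf)%R.
  by rewrite /Kf /form_const !mulr_gt0 ?addr_gt0 ?powR_gt0 ?ltr0n.
have K_gt0 : (0 < Kf * B)%R by exact: mulr_gt0.
have BV_gt0 : (0 < B^-1)%R by rewrite invr_gt0.
have dual := duality p1 pq wu ww ws uws mZ ndZ coverZ Zoo (nnmf_comm_star nf) f0 foo K_gt0 BV_gt0.
apply: le_trans (dual _) _ => [g c cgt0 ng|].
  rewrite int_comm_star//.
  have cV : (0 < c^-1)%R by rewrite invr_gt0.
  apply: (le_trans (cform_le_scaled q1 qp ws ww suw soo woo W'1 Ap' cV ng nf)).
  rewrite -/B -/Kf addeC (EFinM Kf) -muleA; apply: lee_wpmul2l; first by rewrite lee_fin ltW.
  have cp0 : 0 <= (c `^ p)%:E by rewrite lee_fin powR_ge0.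
  have cq0 : 0 <= (c `^ (- q) * B^-1)%:E by rewrite lee_fin mulr_ge0 ?powR_ge0// ltW.
  have G0 : 0 <= \int[m]_x (poweR (g x)%:E q * (s x)%:E).
    by have ns := weight_nnmf ws; apply: int_ge0; nnmf.
  rewrite [leRHS]ge0_muleDr ?mule_ge0//; apply: leeD.
    rewrite muleA -EFinM -(powR_inv1 (ltW cgt0)) -powRrM mulN1r opprK.
    by rewrite mulrC.
  rewrite muleA -EFinM -(powR_inv1 (ltW cgt0)) -powRrM mulN1r.
  by rewrite mulrCA divff ?gt_eqF// mulr1.
apply: lee_wpmul2r => //; rewrite lee_fin.
rewrite /Kf /form_const /B /op_const (addrC (L `^ (q - 1))%R) (addrC (p `^ q))%R.
rewrite (mulrC (p `^ q) (q `^ p))%R.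
exact: (star_arith p1 pq W1 kap_gt0 K2_gt0 c0_gt0).
Qed.

End norm_bounds.
End commutator_form.

(** * Dyadic cubes of the half-line *)

Section half_line.
Variables (R : realType) (lam : R).
Hypothesis lam0 : 0 < lam.
Local Notation leb := (@lebesgue_measure R).

Lemma RpE (x : R) : Rp x <-> 0 < x.
Proof. by rewrite /Rp /= in_itv /= andbT. Qed.

Lemma measurable_Rp : measurable (@Rp R).
Proof. exact: measurable_itv. Qed.

(* The density of [mu], extended by [1] outside [Rp] so as to be positive. *)
Definition udens (x : R) : R := if 0 < x then dens lam x else 1.

Lemma weight_udens : weight udens.
Proof.
split=> [|x]; last by rewrite /udens; case: ifP => // x0; exact: powR_gt0.
apply: measurable_fun_ifT => //.
- by apply: measurable_fun_ltr => //; exact: measurable_cst.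
- exact: measurable_powR.
Qed.

Lemma udensE x : Rp x -> udens x = dens lam x.
Proof. by move=> /RpE x0; rewrite /udens x0. Qed.

Lemma muI_mass (A : set R) : A `<=` Rp -> muI lam A = mass leb udens A.
Proof. by move=> ARp; apply: eq_integral => x /set_mem /ARp /udensE ->. Qed.

Lemma rball_itv (z r : R) : rball z r = `]Num.max 0 (z - r), z + r[%classic.
Proof.
apply/seteqP; split=> y.
  move=> [/RpE y0]; rewrite ltr_distlC => /andP[h1 h2].
  by rewrite /= in_itv /= gt_max y0 h1 h2.
rewrite /= in_itv /= gt_max => /andP[/andP[y0 h1] h2].
by split; [exact/RpE|rewrite ltr_distlC h1 h2].
Qed.

Lemma rball_interval (z r : R) : Rp z -> 0 < r -> interval_Rp (rball z r).
Proof.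
move=> /RpE z0 r0; exists (Num.max 0 (z - r)), (z + r); split; [|split].
- by rewrite le_max lexx.
- by rewrite gt_max addr_gt0//= ltrBlDr -addrA ltrDl addr_gt0.
- exact: rball_itv.
Qed.

Lemma measurable_rball (z r : R) : measurable (rball z r).
Proof. by rewrite rball_itv; exact: measurable_itv. Qed.

Lemma rball_lebesgue (z r : R) : 0 < r -> (leb (rball z r) <= (r *+ 2)%:E)%E.
Proof.
move=> r0; rewrite -(lebesgue_measure_ball z (ltW r0)).
apply: le_measure; rewrite ?inE; [exact: measurable_rball|exact: measurable_ball|].
by move=> y [_ yr]; rewrite -ball_normE.
Qed.

(** The origin may cut the ball on its left, but never the right half, where moreover the density is
    at least its value at [z + r / 2]. *)
Lemma lebesgue_half_rball (z r : R) : 0 < z -> 0 < r ->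
  `[z + r / 2, z + r[%classic `<=` rball z r /\
  (leb `[z + r / 2, z + r[%classic = (r / 2)%:E).
Proof.
move=> z0 r0; split.
  move=> y /=; rewrite in_itv /= => /andP[zy yr]; split.
    by apply/RpE; apply: lt_le_trans zy; rewrite addr_gt0// divr_gt0.
  by rewrite ltr_distlC yr andbT; move: zy r0; set t := r; lra.
rewrite lebesgue_measure_itv /= lte_fin.
have -> : z + r / 2 < z + r by move: r0; set t := r; lra.
by rewrite -EFinD; congr EFin; field.
Qed.

Lemma mass_rball_le (z r : R) : 0 < z -> 0 < r ->
  (mass leb udens (rball z r) <= (r *+ 2 * (z + r) `^ (2 * lam))%:E)%E.
Proof.
move=> z0 r0; have nu := weight_nnmf weight_udens.
have c0 : (0 <= ((z + r) `^ (2 * lam))%:E)%E by rewrite lee_fin powR_ge0.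
apply: (@le_trans _ _ (\int[leb]_(x in rball z r) (cst ((z + r) `^ (2 * lam))%:E x))%E).
  apply: int_le => //; first exact: measurable_rball.
  move=> x [Rx xr]; rewrite udensE// lee_fin /dens.
  move/RpE: Rx => x0; apply: ge0_ler_powR; rewrite ?nnegrE ?mulr_ge0 ?(ltW lam0) ?(ltW x0)//.
    by rewrite addr_ge0// ltW.
  by move: xr; rewrite ltr_distlC => /andP[_ /ltW].
rewrite integral_cst; last exact: measurable_rball.
by rewrite [(r *+ 2 * _)%R]mulrC EFinM; apply: lee_wpmul2l => //; exact: rball_lebesgue.
Qed.

Lemma mass_ge_rball (z r : R) (P : set R) : 0 < z -> 0 < r -> measurable P ->
  rball z r `<=` P -> ((r / 2 * (z + r / 2) `^ (2 * lam))%:E <= mass leb udens P)%E.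
Proof.
move=> z0 r0 mP rP; have nu := weight_nnmf weight_udens.
have [hs hl] := lebesgue_half_rball z0 r0.
have c0 : (0 <= ((z + r / 2) `^ (2 * lam))%:E)%E by rewrite lee_fin powR_ge0.
have mh : measurable (`[z + r / 2, z + r[%classic : set R) by exact: measurable_itv.
rewrite mulrC EFinM -hl -(integral_cst leb mh).
apply: (@le_trans _ _ (mass leb udens `[z + r / 2, z + r[%classic)); last first.
  by apply: int_subset => // x /hs /rP.
apply: int_le => //.
move=> x xh; have [Rx _] := hs _ xh; rewrite udensE// lee_fin /dens.
move/RpE: Rx => x0; apply: ge0_ler_powR; rewrite ?nnegrE ?mulr_ge0 ?(ltW lam0) ?(ltW x0)//.
  by rewrite addr_ge0 ?divr_ge0 ?(ltW z0) ?(ltW r0).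
by move: xh; rewrite /= in_itv /= => /andP[].
Qed.

(** The lengths 2 k r and r / 2 give 4 k. The density costs the other factor: the right end z + k r
    of the large ball is below z' + 2 k r, hence below (1 + 4 k)(z' + r / 2). *)
Definition doubling_const (k : R) : R := 4 * k * (1 + 4 * k) `^ (2 * lam).

Lemma doubling (z z' r k : R) (P : set R) : 0 < z -> 0 < z' -> 0 < r -> 0 < k ->
  `|z - z'| < k * r -> measurable P -> rball z' r `<=` P ->
  (mass leb udens (rball z (k * r)) <= (doubling_const k)%:E * mass leb udens P)%E.
Proof.
move=> z0 z'0 r0 k0 zz' mP rP; have kr0 : 0 < k * r by exact: mulr_gt0.
apply: (le_trans (mass_rball_le z0 kr0)).
have d0 : 0 <= doubling_const k by rewrite !mulr_ge0 ?powR_ge0 ?(ltW k0).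
apply: le_trans (lee_wpmul2l (_ : 0 <= (doubling_const k)%:E)%E (mass_ge_rball z'0 r0 mP rP)); last first.
  by rewrite lee_fin.
rewrite -EFinM lee_fin.
have -> : doubling_const k * (r / 2 * (z' + r / 2) `^ (2 * lam)) =
    (k * r) *+ 2 * ((1 + 4 * k) * (z' + r / 2)) `^ (2 * lam).
  rewrite powRM; last 2 first.
  - by rewrite addr_ge0 ?mulr_ge0 ?(ltW k0).
  - by rewrite addr_ge0 ?divr_ge0 ?(ltW z'0) ?(ltW r0).
  by rewrite /doubling_const; set A := (1 + _) `^ _; set B := (z' + _) `^ _; field.
apply: ler_wpM2l; first by rewrite mulrn_wge0// ltW.
apply: ge0_ler_powR; rewrite ?nnegrE ?mulr_ge0 ?(ltW lam0)//.
- by rewrite addr_ge0// ltW.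
- by rewrite addr_ge0 ?mulr_ge0 ?(ltW k0).
- by rewrite addr_ge0 ?divr_ge0 ?(ltW z'0) ?(ltW r0).
have : z < z' + k * r by move: zz'; rewrite ltr_distlC => /andP[]; lra.
by move: z'0 r0 k0; set a := z; set b := z'; set c := r; set e := k; nra.
Qed.

End half_line.

(** * Enumerating disjoint families and counting overlaps *)

Section enumeration.

(** Each member sits at the single index given by an injection into the naturals, and all other
    indices receive the empty set; this gives a disjoint sequence even if [A] is finite. *)
Lemma disjoint_enumeration T (A : set (set T)) : countable A ->
  (forall Q Q', A Q -> A Q' -> Q <> Q' -> Q `&` Q' = set0) ->
  exists G : nat -> set T,
    [/\ forall i, G i = set0 \/ A (G i), trivIset [set: nat] G &
        forall Q, A Q -> exists i, G i = Q].
Proof.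
move=> /countable_injP[f finj] disA.
pose G i := xget set0 [set Q | A Q /\ f Q = i].
have GP i : G i = set0 \/ A (G i) /\ f (G i) = i.
  by rewrite /G; case: xgetP => [Q _ [AQ fQ]|_]; [right|left].
exists G; split.
- by move=> i; have [|[]] := GP i; [left|right].
- apply/trivIsetP => i j _ _ ij.
  have [->|[Ai fi]] := GP i; first by rewrite set0I.
  have [->|[Aj fj]] := GP j; first by rewrite setI0.
  by apply: disA => // Gij; move: ij; rewrite -fi -fj Gij eqxx.
- move=> Q AQ; exists (f Q); rewrite /G; case: xgetP => [P _ [AP fP]|/(_ Q)[]//].
  by apply: finj; rewrite ?inE.
Qed.

(** A partial sum counts the selected indices whose set contains [x]; by injectivity they name
    distinct members of [S], of which there are at most [N]. *)
Lemma bounded_overlap_series (R : realType) T (S : set (set T)) (E : set T -> set T)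
    (F : nat -> set T) (P : pred nat) (N : nat) (x : T) :
  (forall i, P i -> S (F i)) -> {in P &, injective F} ->
  ([set Q | S Q /\ E Q x] #<= `I_N)%card ->
  (\sum_(i <oo) (\1_(if P i then E (F i) else set0) x : R)%:E <= N%:R%:E)%E.
Proof.
move=> PS Finj SN; apply: lime_le.
  by apply: is_cvg_nneseries => i _ _; rewrite lee_fin indicE; case: (_ \in _).
apply: nearW => n.
pose l := [seq i <- iota 0 n | P i & x \in E (F i)].
have -> : (\sum_(0 <= i < n) (\1_(if P i then E (F i) else set0) x : R)%:E)%E =
    ((size l)%:R%:E)%E.
  rewrite /l size_filter -sum1_count sumEFin natr_sum; congr EFin.
  rewrite [RHS]big_mkcond /index_iota subn0; apply: eq_bigr => i _; rewrite indicE.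
  by case: (P i) => /=; [case: (x \in _)|rewrite in_set0].
rewrite lee_fin ler_nat.
have lP j : (j < size l)%N -> [/\ P (nth 0%N l j) & E (F (nth 0%N l j)) x].
  by move=> jl; have := mem_nth 0%N jl; rewrite mem_filter => /andP[/andP[Pj /set_mem]].
have linj : {in `I_(size l) &, injective (fun j => F (nth 0%N l j))}.
  move=> j j'; rewrite !inE /= => jl j'l Fjj'.
  have [Pj _] := lP _ jl; have [Pj' _] := lP _ j'l.
  apply/eqP; rewrite -(nth_uniq 0%N jl j'l) ?filter_uniq ?iota_uniq//.
  by apply/eqP; exact: Finj.
rewrite -card_le_II -(card_le_eql (inj_card_eq linj)).
apply: card_le_trans SN; apply: subset_card_le => Q [j /= jl <-].
by have [Pj Ej] := lP _ jl; split => //; exact: PS.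
Qed.

End enumeration.

(** * Doubling and countability for a dyadic system *)

Section dyadic.
Variables (R : realType) (lam : R) (D : int -> set (set R)) (z : int -> set R -> R)
  (delta c0 C0 : R).
Hypotheses (lam0 : 0 < lam) (DD : dyadic_system D z delta c0 C0).
Local Notation leb := (@lebesgue_measure R).
Local Notation u := (udens lam).

Lemma dyadic_delta : 0 < delta < 1. Proof. by case: DD. Qed.
Lemma dyadic_c0 : 0 < c0. Proof. by case: DD => _ /andP[]. Qed.
Lemma dyadic_C0 : 0 < C0. Proof. by case: DD => _ /andP[c0_gt0 cC] _ _ _; exact: lt_le_trans cC. Qed.
Lemma dyadic_measurable k Q : D k Q -> measurable Q.
Proof. by case: DD => _ _ + _ _ => /[apply] -[]. Qed.
Lemma dyadic_Rp k Q : D k Q -> Q `<=` Rp.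
Proof. by case: DD => _ _ + _ _ => /[apply] -[]. Qed.
Lemma dyadic_cover k x : Rp x -> exists Q, D k Q /\ Q x.
Proof. by case: DD => _ _ _ + _ => /[apply]. Qed.
Lemma dyadic_disjoint k Q Q' : D k Q -> D k Q' -> Q <> Q' -> Q `&` Q' = set0.
Proof. by case: DD => _ _ _ _ [+ _ _ _]; apply. Qed.
Lemma dyadic_nested (k l : int) Q P : k <= l -> D k Q -> D l P ->
  P `<=` Q \/ P `&` Q = set0.
Proof. by case: DD => _ _ _ _ [_ + _ _]; apply. Qed.
Lemma dyadic_center k Q : D k Q -> 0 < z k Q.
Proof. by case: DD => _ _ _ _ [_ _ + _] => /[apply] -[/RpE]. Qed.
Lemma dyadic_inner k Q : D k Q -> rball (z k Q) (c0 * delta ^ k) `<=` Q.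
Proof. by case: DD => _ _ _ _ [_ _ + _] => /[apply] -[]. Qed.
Lemma dyadic_outer k Q : D k Q -> Q `<=` rball (z k Q) (C0 * delta ^ k).
Proof. by case: DD => _ _ _ _ [_ _ + _] => /[apply] -[]. Qed.

Lemma delta_gt0 (k : int) : 0 < delta ^ k.
Proof. by apply: exprz_gt0; have /andP[] := dyadic_delta. Qed.

(** The argument is the ratio of the outer radius of a cube to the inner radius of a cube one
    generation below. *)
Definition dyadic_const : R := doubling_const lam (C0 / (c0 * delta)).

Lemma dyadic_const_gt0 : 0 < dyadic_const.
Proof.
have [/andP[d0 _] c00 C00] := And3 dyadic_delta dyadic_c0 dyadic_C0.
have r0 : 0 < C0 / (c0 * delta) by rewrite divr_gt0 ?mulr_gt0.
rewrite /dyadic_const /doubling_const; move: r0; set r := C0 / _ => r0.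
apply: mulr_gt0; first exact: mulr_gt0.
by apply: powR_gt0; apply: addr_gt0 => //; exact: mulr_gt0.
Qed.

Lemma dyadic_self k Q : D k Q -> Q (z k Q).
Proof.
move=> DQ; apply: (dyadic_inner DQ); split; first exact/RpE/(dyadic_center DQ).
by rewrite subrr normr0 mulr_gt0 ?dyadic_c0 ?delta_gt0.
Qed.

(** One statement for two uses: [l = k] compares a cube with its enclosing ball, [l = k + 1]
    compares a parent with its child. *)
Lemma dyadic_doubling (k l : int) Q P : D k Q -> D l P -> P `<=` Q -> l <= k + 1 ->
  (mass leb u (rball (z k Q) (C0 * delta ^ k)) <= dyadic_const%:E * mass leb u P)%E.
Proof.
move=> DQ DP PQ lk; have [/andP[d0 d1] c00 C00] := And3 dyadic_delta dyadic_c0 dyadic_C0.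
have dk := delta_gt0 k; have dn0 : delta != 0 by rewrite gt_eqF.
have r0 : 0 < c0 * delta ^ (k + 1) by rewrite mulr_gt0 ?delta_gt0.
have rE : C0 * delta ^ k = C0 / (c0 * delta) * (c0 * delta ^ (k + 1)).
  by rewrite expfzDr// expr1z; field; rewrite !gt_eqF.
rewrite rE; apply: (doubling lam0 (dyadic_center DQ) (dyadic_center DP) r0).
- by rewrite divr_gt0 ?mulr_gt0.
- by rewrite -rE; have [_] := dyadic_outer DQ (PQ _ (dyadic_self DP)).
- exact: dyadic_measurable DP.
apply: subset_trans (dyadic_inner DP) => y [Ry yr]; split=> //.
apply: (lt_le_trans yr); apply: ler_wpM2l; first exact: ltW.
rewrite -(subrK l (k + 1)) expfzDr//.
have : 0 <= k + 1 - l by rewrite subr_ge0.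
case: (k + 1 - l) => // n _; rewrite -[leRHS]mul1r ler_wpM2r ?(ltW (delta_gt0 _))//.
by rewrite -exprnP exprn_ile1// ltW.
Qed.

Lemma dyadic_mass_gt0 k Q : D k Q -> (0 < mass leb u Q)%E.
Proof.
move=> DQ; have r0 : 0 < c0 * delta ^ k by rewrite mulr_gt0 ?dyadic_c0 ?delta_gt0.
apply: lt_le_trans (mass_ge_rball lam0 (dyadic_center DQ) r0 (dyadic_measurable DQ) (dyadic_inner DQ)).
rewrite lte_fin mulr_gt0 ?powR_gt0 ?divr_gt0//.
by rewrite addr_gt0 ?divr_gt0 ?(dyadic_center DQ).
Qed.

Lemma dyadic_mass_lty k Q : D k Q -> (mass leb u Q < +oo)%E.
Proof.
move=> DQ; have r0 : 0 < C0 * delta ^ k by rewrite mulr_gt0 ?dyadic_C0 ?delta_gt0.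
have h := mass_le leb (dyadic_measurable DQ) (measurable_rball _ _) (weight_udens lam) (dyadic_outer DQ).
apply: le_lt_trans (le_trans h (mass_rball_le lam0 (dyadic_center DQ) r0)) _.
exact: ltry.
Qed.

(** The inner balls of the cubes of one generation are disjoint, open and nonempty, so separability
    of the line leaves only countably many. Outside [D k] the set [setT] is a harmless open nonempty
    default. *)
Lemma dyadic_countable k : countable (D k).
Proof.
have r0 : 0 < c0 * delta ^ k by rewrite mulr_gt0 ?dyadic_c0 ?delta_gt0.
pose B Q : set R := if `[< D k Q >] then rball (z k Q) (c0 * delta ^ k) else setT.
apply: (@separated_open_countable R _ B).
- move=> Q; rewrite /B; case: asboolP => _; last exact: openT.
  by rewrite rball_itv; exact: interval_open.
- move=> Q; rewrite /B; case: asboolP => DQ; last by exists 0.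
  exists (z k Q); split; first exact/RpE/(dyadic_center DQ).
  by rewrite subrr normr0.
- move=> Q Q' DQ DQ' [x []]; rewrite /B !asboolT// => Qx Q'x.
  apply: contrapT => QQ'; have := dyadic_disjoint DQ DQ' QQ'.
  by rewrite -subset0 => /(_ x); apply; split; [exact: (dyadic_inner DQ)|exact: (dyadic_inner DQ')].
Qed.

Lemma dyadic_enum k : exists G : nat -> set R,
  [/\ forall i, G i = set0 \/ D k (G i), trivIset [set: nat] G &
      forall Q, D k Q -> exists i, G i = Q].
Proof. by apply: disjoint_enumeration; [exact: dyadic_countable|exact: dyadic_disjoint]. Qed.

(** Index 0 is reserved for the empty set, to which indices outside the sparse family will be sent.
    A cube may occur at several indices, as a set that is a cube of several generations does;
    [nested] permits this. *)
Lemma dyadic_enum_all : exists F : nat -> set R,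
  [/\ F 0%N = set0, forall i, F i = set0 \/ dcube D (F i), nested F &
      forall Q, dcube D Q -> exists i, F i = Q].
Proof.
have [G GP] := choice dyadic_enum.
pose F n := if n is j.+1 then
  (if unpickle j is Some (k, i) then G k i else set0) else set0.
have FP n : F n = set0 \/ exists k, D k (F n).
  case: n => [|n]; first by left.
  rewrite /F; case: (unpickle n) => [[k i]|]; last by left.
  by have [/(_ i)[->|DG] _ _] := GP k; [left|right; exists k].
exists F; split => //.
- by move=> i j; have [->|[k DFi]] := FP i; [by constructor 1|];
  have [->|[l DFj]] := FP j; [by constructor 2|];
  have [kl|/ltW lk] := leP k l;
  [have [ji|ji0] := dyadic_nested kl DFi DFj; [by constructor 2|by constructor 3; rewrite setIC]
  |have [ij|ij0] := dyadic_nested lk DFj DFi; [by constructor 1|by constructor 3]].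
- move=> Q [k DQ]; have [_ _ /(_ _ DQ)[i GQ]] := GP k.
  by exists (pickle (k, i)).+1; rewrite /F pickleK.
Qed.

End dyadic.

Lemma ae_impl2 d (T : measurableType d) (R : realType) (m : {measure set T -> \bar R})
    (P Q S : T -> Prop) :
  {ae m, forall x, P x} -> {ae m, forall x, Q x} ->
  (forall x, P x -> Q x -> S x) -> {ae m, forall x, S x}.
Proof. by move=> h1 h2 PQS; apply: filterS2 h1 h2; exact: PQS. Qed.

Lemma ae_impl d (T : measurableType d) (R : realType) (m : {measure set T -> \bar R})
    (P S : T -> Prop) :
  {ae m, forall x, P x} -> (forall x, P x -> S x) -> {ae m, forall x, S x}.
Proof. by move=> h1 PS; apply: filterS h1; exact: PS. Qed.

(** The integral of a nonnegative function is the supremum over the simple functions below it, hence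
    monotone without any measurability. It is used for [sigmaw] and for the sparse operators
    themselves. *)
Lemma int_le_unmeasurable d (T : measurableType d) (R : realType)
    (m : {measure set T -> \bar R}) (A : set T) (f g : T -> \bar R) :
  (forall x, A x -> 0 <= f x)%E -> (forall x, A x -> f x <= g x)%E ->
  (\int[m]_(x in A) f x <= \int[m]_(x in A) g x)%E.
Proof.
move=> f0 fg; have g0 x : A x -> (0 <= g x)%E by move=> Ax; exact: le_trans (f0 _ Ax) (fg _ Ax).
rewrite !ge0_integralE//; apply: le_ereal_sup => _ [h /= hf <-].
exists h => //= x; apply: (le_trans (hf x)).
by rewrite !patchE; case: ifPn => // /set_mem; exact: fg.
Qed.

Lemma cvg_fine_div (R : realType) (f g : nat -> \bar R) (a c : R) : c != 0 ->
  f @ \oo --> a%:E -> g @ \oo --> c%:E ->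
  fine (f n) / fine (g n) @[n --> \oo] --> a / c.
Proof.
move=> c0 fa gc; apply: cvgM; first exact: fine_cvg.
by apply: cvgV => //; exact: fine_cvg.
Qed.

(** * Differentiation of integrals along the dyadic cubes *)

Section differentiation.
Variables (R : realType) (lam : R) (D : int -> set (set R)) (z : int -> set R -> R)
  (delta c0 C0 : R).
Hypotheses (lam0 : 0 < lam) (DD : dyadic_system D z delta c0 C0).
Local Notation leb := (@lebesgue_measure R).
Local Notation u := (udens lam).

Lemma locally_integrable_Rp (h : R -> R) :
  (forall B, interval_Rp B -> leb.-integrable B (EFin \o h)) ->
  measurable_fun [set: R] h -> locally_integrable [set: R] (h \_ Rp).
Proof.
move=> hi mh; split; last 2 first.
- exact: openT.
- move=> K _ cK; have mK := compact_measurable cK.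
  have [M [Mr MK]] := compact_bounded cK.
  pose c := `|M| + 2; have c0' : 0 < c by rewrite ltr_wpDl.
  pose B : set R := `]0, c[%classic.
  have iB : interval_Rp B by exists 0, c.
  have mB : measurable B by exact: measurable_itv.
  have KB : K `&` Rp `<=` B.
    move=> x [Kx /RpE x0]; rewrite /B /= in_itv /= x0 /=.
    have Mc : M < `|M| + 1 by rewrite (le_lt_trans (ler_norm M))// ltrDl.
    have := MK _ Mc _ Kx => /= xM; apply: (le_lt_trans (ler_norm x)).
    by apply: (le_lt_trans xM); rewrite /c ltrD2l ltr1n.
  have mKR : measurable (K `&` Rp) by apply: measurableI => //; exact: measurable_Rp.
  have nh : nnmf (fun x => `|h x|%:E).
    by apply: nnmf_EFin => //; exact: measurableT_comp.
  have -> : (\int[leb]_(x in K) `|(h \_ Rp) x|%:E = \int[leb]_(x in K `&` Rp) `|h x|%:E)%E.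
    rewrite integral_mkcondr; apply: eq_integral => x _.
    by rewrite !patchE; case: ifP => //; rewrite normr0.
  apply: (@le_lt_trans _ _ (\int[leb]_(x in B) `|h x|%:E)%E); first exact: int_subset.
  by have /integrableP[_] := hi _ iB.
apply: (measurable_restrictT h (@measurable_Rp R)).1; exact: measurable_funTS.
Qed.

Definition dyadic_cube (l : int) (x : R) : set R := xget set0 [set Q | D l Q /\ Q x].

Lemma dyadic_cubeP l x : Rp x -> D l (dyadic_cube l x) /\ dyadic_cube l x x.
Proof.
move=> Rx; rewrite /dyadic_cube; case: xgetP => [Q _ []//|nQ].
by have [Q DQ] := dyadic_cover DD l Rx; have := nQ Q.
Qed.

Lemma dyadic_nicely_shrinking (k : int) (x : R) : Rp x ->
  nicely_shrinking x (fun n => dyadic_cube (k + n%:Z) x).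
Proof.
move=> Rx; have Qx l := dyadic_cubeP l Rx.
have [/andP[d0 d1] c00 C00] := And3 (dyadic_delta DD) (dyadic_c0 DD) (dyadic_C0 DD).
have r0 (n : nat) : 0 < 2 * C0 * delta ^ (k + n%:Z).
  by rewrite !mulr_gt0// (delta_gt0 DD).
split; first by move=> n; exact: (dyadic_measurable DD (Qx _).1).
(* A ball of radius 2 C0 delta^l about any point of the cube contains the cube and has length 4 C0
   delta^l; half of the inner ball has length c0 delta^l / 2. The ratio is 8 C0 / c0. *)
exists (8 * C0 / c0, fun n => PosNum (r0 n)); split => /=.
- by rewrite divr_gt0// mulr_gt0.
- have -> : (fun n : nat => 2 * C0 * delta ^ (k + n%:Z)) = geometric (2 * C0 * delta ^ k) delta.
    by apply/funext => n; rewrite /= expfzDr ?gt_eqF// mulrA.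
  by apply: cvg_geometric; rewrite gtr0_norm.
- move=> n y Qy; rewrite -ball_normE /=.
  have [_ xz] := dyadic_outer DD (Qx (k + n%:Z)).1 (Qx _).2.
  have [_ yz] := dyadic_outer DD (Qx (k + n%:Z)).1 Qy.
  move: xz yz; set c := z _ _; set r := C0 * _ => xz yz.
  rewrite (_ : 2 * C0 * _ = r + r); last by rewrite /r -mulrA mulr2n mulrDl mul1r.
  rewrite (_ : x - y = (x - c) + (c - y)); last by rewrite addrA subrK.
  by rewrite (le_lt_trans (ler_normD _ _))// ltrD// distrC.
move=> n; rewrite lebesgue_measure_ball; last exact: ltW (r0 n).
have DQ := (Qx (k + n%:Z)).1.
have dn := delta_gt0 DD (k + n%:Z).
have rr : 0 < c0 * delta ^ (k + n%:Z) by rewrite mulr_gt0.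
have [hs hl] := lebesgue_half_rball (dyadic_center DD DQ) rr.
have Qhalf : (((c0 * delta ^ (k + n%:Z)) / 2)%:E <= leb (dyadic_cube (k + n%:Z) x))%E.
  rewrite -hl; apply: le_measure; rewrite ?inE.
  - exact: measurable_itv.
  - exact: (dyadic_measurable DD DQ).
  - by move=> y /hs; exact: (dyadic_inner DD DQ).
have K0 : (0 <= (8 * C0 / c0)%:E)%E by rewrite lee_fin divr_ge0 ?mulr_ge0// ltW.
apply: le_trans (lee_wpmul2l K0 Qhalf).
rewrite -EFinM lee_fin /= le_eqVlt; apply/orP; left; apply/eqP.
by rewrite mulr2n; set t := delta ^ _; field; rewrite gt_eqF.
Qed.

(** The averages are quotients of the Lebesgue means of b u and of u, both of which converge by
    Lebesgue's differentiation theorem; the limit is b u / u. *)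
Lemma dyadic_bgen_cvg (b : R -> R) : measurable_fun [set: R] b ->
  (forall B, interval_Rp B -> leb.-integrable B (fun x => (b x * u x)%:E)) ->
  (forall k Q, D k Q -> leb.-integrable Q (fun x => (b x * u x)%:E)) ->
  forall k : int, {ae leb, forall x, Rp x ->
    bgen leb D u b (k + j%:Z) x @[j --> \oo] --> b x}.
Proof.
move=> mb bI bQ k; have [mu u0] := weight_udens lam.
have loc1 : locally_integrable [set: R] ((fun x => b x * u x) \_ Rp).
  by apply: locally_integrable_Rp => //; exact: measurable_funM.
have loc2 : locally_integrable [set: R] (u \_ Rp).
  apply: locally_integrable_Rp => // B [a [c [a0 [ac ->]]]].
  have c_gt0 : 0 < c by apply: le_lt_trans ac.
  apply/integrableP; split; first exact/measurable_funTS/measurable_EFinP.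
  have nu := weight_nnmf (weight_udens lam).
  have mI : measurable (`]a, c[%classic : set R) by exact: measurable_itv.
  have sub : `]a, c[%classic `<=` rball c c.
    move=> x /=; rewrite in_itv /= => /andP[ax xc]; split.
      by apply/RpE; exact: le_lt_trans ax.
    by rewrite gtr0_norm ?subr_gt0// ltrBlDr ltrDl (le_lt_trans a0).
  under eq_integral => x _ do rewrite gee0_abs ?(nnmf_ge0 _ nu)//.
  apply: le_lt_trans (mass_le leb mI (measurable_rball _ _) (weight_udens lam) sub) _.
  exact: le_lt_trans (mass_rball_le lam0 c_gt0 c_gt0) (ltry _).
have h1 := lebesgue_differentiation loc1; have h2 := lebesgue_differentiation loc2.
apply: (ae_impl2 h1 h2) => x lx1 lx2 Rx.
(* The differentiation theorem asks for a nicely shrinking sequence at every real point, so balls of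
   radius 1 / (n + 1) are supplied outside the half-line. *)
pose E (y : R) (n : nat) : set R :=
  if 0 < y then dyadic_cube (k + n%:Z) y else ball y (n.+1%:R^-1).
have nE y : nicely_shrinking y (E y).
  have [y0|y0] := boolP (0 < y).
    rewrite (_ : E y = fun n => dyadic_cube (k + n%:Z) y); last first.
      by apply/funext => n; rewrite /E y0.
    exact/dyadic_nicely_shrinking/RpE.
  rewrite (_ : E y = fun n => ball y (n.+1%:R^-1)); last first.
    by apply/funext => n; rewrite /E (negPf y0).
  split; first by move=> n; exact: measurable_ball.
  have r0 (n : nat) : 0 < (n.+1%:R^-1 : R) by rewrite invr_gt0.
  exists (1, fun n => PosNum (r0 n)); split => //=.
  - exact: cvg_harmonic.
  - by move=> n; exact: subset_refl.
  - by move=> n; rewrite mul1e.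
have EQ n : E x n = dyadic_cube (k + n%:Z) x by rewrite /E; move/RpE: Rx => ->.
have c1 := nice_lebesgue_differentiation nE loc1 lx1.
have c2 := nice_lebesgue_differentiation nE loc2 lx2.
have f1 : ((fun y => b y * u y) \_ Rp) x = b x * u x by rewrite patchE mem_set.
have f2 : (u \_ Rp) x = u x by rewrite patchE mem_set.
rewrite f1 in c1; rewrite f2 in c2.
have int1 n : (\int[leb]_(y in E x n) (((fun y => b y * u y) \_ Rp) y)%:E =
    \int[leb]_(y in dyadic_cube (k + n%:Z) x) (b y * u y)%:E)%E.
  rewrite EQ; apply: eq_integral => y /set_mem Qy; rewrite patchE mem_set//.
  exact: (dyadic_Rp DD (dyadic_cubeP (k + n%:Z) Rx).1).
have int2 n : (\int[leb]_(y in E x n) ((u \_ Rp) y)%:E =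
    mass leb u (dyadic_cube (k + n%:Z) x))%E.
  rewrite EQ; apply: eq_integral => y /set_mem Qy; rewrite patchE mem_set//.
  exact: (dyadic_Rp DD (dyadic_cubeP (k + n%:Z) Rx).1).
have ux0 : u x != 0 by rewrite gt_eqF.
have lim := cvg_fine_div ux0 c1 c2.
rewrite mulfK// in lim; apply: cvg_trans lim; apply: near_eq_cvg; apply: nearW => n /=.
rewrite int1 int2 /bgen -/(dyadic_cube (k + n%:Z) x).
have [DQ _] := dyadic_cubeP (k + n%:Z) Rx.
have Qfin : leb (E x n) \is a fin_num by exact: nicely_shrinking_fin_num (nE x) n.
have Q0 : (0 < leb (E x n))%E by exact: nicely_shrinking_gt0 (nE x) n.
have mQ0 : 0 < fine (leb (E x n)) by rewrite fine_gt0// Q0 ltey_eq Qfin.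
have bfin : (\int[leb]_(y in dyadic_cube (k + n%:Z) x) (b y * u y)%:E)%E \is a fin_num.
  have mQ := dyadic_measurable DD DQ; have bq := bQ _ _ DQ.
  by apply: integrable_fin_num bq.
have ufin : mass leb u (dyadic_cube (k + n%:Z) x) \is a fin_num.
  by rewrite gt0_fin_numE ?(dyadic_mass_gt0 lam0 DD DQ) ?(dyadic_mass_lty lam0 DD DQ).
rewrite -(fineK Qfin) inver gt_eqF// /bavg.
rewrite -(fineK bfin) -(fineK ufin) -!EFinM /=.
have um0 : 0 < fine (mass leb u (dyadic_cube (k + n%:Z) x)).
  by rewrite fine_gt0// (dyadic_mass_gt0 lam0 DD DQ) (dyadic_mass_lty lam0 DD DQ).
move: mQ0 um0; set a := fine _; set c := fine _; set e := fine _ => a0 c_gt0.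
by field; rewrite !gt_eqF.
Qed.

End differentiation.

(** * Weights and functions of bounded mean oscillation on the half-line *)

(** As both integrals are positive, an infinite one would make the whole product infinite; the bound
    therefore also yields local integrability of the two weights. *)
Lemma Ap_arith (R : realType) (p U A : R) (X Y : \bar R) : 1 < p -> 0 < U ->
  (0 < X)%E -> (0 < Y)%E ->
  ((U^-1)%:E * X * poweR ((U^-1)%:E * Y) (p - 1) <= A%:E)%E ->
  [/\ (X < +oo)%E, (Y < +oo)%E & fine X * fine Y `^ (p - 1) <= A * U `^ p].
Proof.
move=> p1 U0 X0 Y0; have p10 : 0 < p - 1 by rewrite subr_gt0.
have Ui0 : (0 < (U^-1)%:E)%E by rewrite lte_fin invr_gt0.
have Yp : (0 < poweR ((U^-1)%:E * Y) (p - 1))%E by apply: poweR_gt0; exact: mule_gt0.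
have UX : (0 < (U^-1)%:E * X)%E by exact: mule_gt0.
case: Y Y0 Yp => [y| |]// Y0 Yp; last first.
  by rewrite gt0_muley// poweRyr ?gt_eqF// gt0_muley.
case: X X0 UX => [x| |]// X0 UX; last by rewrite gt0_muley// gt0_mulye.
rewrite -!EFinM lee_fin /= => h; split; rewrite ?ltry//.
rewrite !lte_fin in X0 Y0.
have -> : x * y `^ (p - 1) = U^-1 * x * (U^-1 * y) `^ (p - 1) * U `^ p.
  have UpE : U `^ p = U * U `^ (p - 1).
    rewrite -[X in X * _](powRr1 (ltW U0)) -powRD ?(gt_eqF U0) ?implybT//.
    by congr (_ `^ _); ring.
  have Vp : U^-1 `^ (p - 1) * U `^ (p - 1) = 1.
    by rewrite -powRM ?invr_ge0 ?(ltW U0)// mulVf ?gt_eqF// powR1.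
  rewrite powRM ?invr_ge0 ?(ltW U0) ?(ltW Y0)// UpE.
  move: (U^-1 `^ _) (U `^ _) (y `^ _) Vp => a c e ac.
  rewrite (_ : U^-1 * x * (a * e) * (U * c) = (a * c) * (U^-1 * U) * x * e); last by ring.
  by rewrite ac mulVf ?gt_eqF// !mul1r.
by rewrite ler_wpM2r ?powR_ge0.
Qed.

Section weights.
Variables (R : realType) (lam p : R) (w : R -> R).
Hypotheses (lam0 : 0 < lam) (p1 : 1 < p) (Aw : Ap_weight lam p w).
Local Notation leb := (@lebesgue_measure R).
Local Notation u := (udens lam).
Let p0 : 0 < p. Proof. exact: lt_trans p1. Qed.
Let p10 : 0 < p - 1. Proof. by rewrite subr_gt0. Qed.

Lemma conjugate_pq : p^-1 + (p / (p - 1))^-1 = 1.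
Proof. by rewrite invf_div -{1}(mul1r p^-1) -mulrDl addrC subrK divff ?gt_eqF. Qed.

(* Since [sigmaw] is infinite where [w] vanishes, either the zeros of [w] are
   negligible and [wt] may replace [w], or [w] vanishes almost everywhere. *)
Definition wt (x : R) : R := if (w \_ Rp) x == 0 then 1 else (w \_ Rp) x.

(** Solved from u = wt^(1/p) st^(1/p'), so that this identity holds on the whole line and not only
    where [w] is positive. *)
Definition st (x : R) : R := (u x * wt x `^ (- p^-1)) `^ (p / (p - 1)).

Lemma measurable_wRp : measurable_fun [set: R] (w \_ Rp).
Proof. by case: Aw => mw _ _; exact: (measurable_restrictT w (@measurable_Rp R)).1. Qed.

Lemma weight_wt : weight wt.
Proof.
have mw := measurable_wRp; split.
  apply: measurable_fun_ifT => //.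
  by apply: measurable_fun_eqr => //; exact: measurable_cst.
move=> x; rewrite /wt; case: eqP => // /eqP wx; rewrite lt_neqAle eq_sym wx /=.
rewrite patchE; case: ifPn => // /set_mem Rx; case: Aw => _ + _; exact.
Qed.

Lemma weight_st : weight st.
Proof.
have [[mw w0] [mu u0]] := (weight_wt, weight_udens lam); split; last first.
  by move=> x; rewrite powR_gt0// mulr_gt0// powR_gt0.
have mwp : measurable_fun [set: R] (fun x => wt x `^ (- p^-1)).
  exact: measurableT_comp (measurable_powR _) mw.
exact: measurableT_comp (measurable_powR _) (measurable_funM mu mwp).
Qed.

Lemma u_wt_st x : u x = wt x `^ p^-1 * st x `^ (p / (p - 1))^-1.
Proof.
have [[_ /(_ x) w0] [_ /(_ x) u0]] := (weight_wt, weight_udens lam).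
rewrite /st -powRrM divff; last by rewrite gt_eqF// divr_gt0.
rewrite powRr1 ?mulr_ge0 ?powR_ge0 ?ltW// mulrCA -powRD ?(gt_eqF w0) ?implybT//.
by rewrite subrr powRr0 mulr1.
Qed.

Lemma wtE x : Rp x -> w x != 0 -> wt x = w x.
Proof. by move=> Rx wx; rewrite /wt patchE mem_set// (negPf wx). Qed.

Lemma stE x : Rp x -> w x != 0 -> (st x)%:E = sigmaw lam p w x.
Proof.
move=> Rx wx; have [_ /(_ x) w0] := weight_wt; have [_ /(_ x) u0] := weight_udens lam.
rewrite /sigmaw (negPf wx) /st wtE//; rewrite wtE// in w0; congr EFin.
rewrite powRM ?powR_ge0 ?ltW// -powRrM udensE// /dens -powRrM.
congr (_ * _ `^ _); rewrite mulNr mulrA mulVf ?gt_eqF// mul1r//.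
Qed.

Definition zeros : set R := Rp `&` [set x | w x = 0].

Lemma measurable_zeros : measurable zeros.
Proof.
case: Aw => mw _ _; have := mw (@measurable_Rp R) [set 0] (measurable_set1 0).
by congr measurable.
Qed.

Lemma interval_measurable (B : set R) : interval_Rp B -> measurable B.
Proof. by move=> [a [c [_ [_ ->]]]]; exact: measurable_itv. Qed.

Lemma interval_subRp (B : set R) : interval_Rp B -> B `<=` Rp.
Proof.
move=> [a [c [a0 [_ ->]]]] x; rewrite /= in_itv /= => /andP[ax _].
by apply/RpE; exact: le_lt_trans ax.
Qed.

Lemma interval_gt0 (B : set R) : interval_Rp B -> (0 < leb B)%E.
Proof.
by move=> [a [c [_ [ac ->]]]]; rewrite lebesgue_measure_itv /= lte_fin ac -EFinD lte_fin subr_gt0.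
Qed.

Lemma interval_mass_lty (B : set R) : interval_Rp B -> (mass leb u B < +oo)%E.
Proof.
move=> iB; have mB := interval_measurable iB; have := iB => -[a [c [a0 [ac BE]]]].
have c_gt0 : 0 < c by apply: le_lt_trans ac.
have sub : B `<=` rball c c.
  move=> x; rewrite BE /= in_itv /= => /andP[ax xc]; split.
    by apply/RpE; exact: le_lt_trans ax.
  by rewrite gtr0_norm ?subr_gt0// ltrBlDr ltrDl (le_lt_trans a0).
apply: le_lt_trans (mass_le leb mB (measurable_rball _ _) (weight_udens lam) sub) _.
exact: le_lt_trans (mass_rball_le lam0 c_gt0 c_gt0) (ltry _).
Qed.

Lemma Ap_const_ge0 : (0 <= Ap_const lam p w)%E.
Proof.
have iB : interval_Rp (`]0, 1[%classic : set R) by exists 0, 1.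
apply: le_trans (ereal_sup_ubound _); last by exists `]0, 1[%classic.
have U0 : (0 <= ((fine (muI lam `]0, 1[%classic))^-1)%:E)%E.
  rewrite lee_fin invr_ge0 fine_ge0// (muI_mass lam (interval_subRp iB)) mass_ge0//.
  exact: (weight_udens lam).
apply: mule_ge0; last exact: poweR_ge0.
apply: mule_ge0 => //; apply: integral_ge0 => x Bx; rewrite lee_fin.
by case: Aw => _ + _; apply; exact: interval_subRp iB _ Bx.
Qed.

Lemma Ap_interval (B : set R) : interval_Rp B ->
  (((fine (mass leb u B))^-1)%:E * (\int[leb]_(x in B) (w x)%:E) *
    poweR (((fine (mass leb u B))^-1)%:E * (\int[leb]_(x in B) sigmaw lam p w x)) (p - 1)
  <= (fine (Ap_const lam p w))%:E)%E.
Proof.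
move=> iB; rewrite -(muI_mass lam (interval_subRp iB)).
have B0 := Ap_const_ge0.
rewrite fineK; last by rewrite ge0_fin_numE//; case: Aw.
by apply: ereal_sup_ubound; exists B.
Qed.

Lemma sigmaw_ge0 x : (0 <= sigmaw lam p w x)%E.
Proof. by rewrite /sigmaw; case: ifP => // _; rewrite lee_fin mulr_ge0 ?powR_ge0. Qed.

(** An interval meeting the zeros in positive measure has an infinite integral of [sigmaw]. The A_p
    product over it stays finite only if the integral of [w] is 0. All larger intervals starting at
    0 share this, and they exhaust the half-line. *)
Lemma w_ae0 : (0 < leb zeros)%E -> {ae leb, forall x, Rp x -> w x = 0}.
Proof.
move=> z0; have mz := measurable_zeros.
pose I (n : nat) : set R := `]0, n.+1%:R[%classic.
have iI n : interval_Rp (I n) by exists 0, n.+1%:R.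
have mI n := interval_measurable (iI n).
have cover x : Rp x -> exists n0, forall n, (n0 <= n)%N -> I n x.
  move=> /RpE x0; exists (Num.bound x) => n nx; rewrite /I /= in_itv /= x0 /=.
  by apply: (lt_le_trans (archi_boundP (ltW x0))); rewrite ler_nat (leq_trans nx).
have [n0 n0P] : exists n0, (0 < leb (zeros `&` I n0))%E.
  apply: contrapT => nn; move: z0; apply/negP; rewrite -leNgt.
  have -> : zeros = \bigcup_n (zeros `&` I n).
    apply/seteqP; split=> [x zx|x [n _ []]//].
    by have [n /(_ n (leqnn n)) Ix] := cover _ zx.1; exists n.
  apply: (le_trans (measure_sigma_subadditive _ _ _ _)) => //.
  - by move=> n; exact: measurableI mz (mI n).
  - by apply: bigcupT_measurable => n; exact: measurableI mz (mI n).
  - exact: subset_refl.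
  rewrite eseries0// => n _ _; apply/eqP; rewrite eq_le measure_ge0 andbT leNgt.
  by apply/negP => h; apply: nn; exists n.
have wI0 n : (n0 <= n)%N -> (\int[leb]_(x in I n) (w x)%:E = 0)%E.
  move=> n0n; have := Ap_interval (iI n).
  have -> : (\int[leb]_(x in I n) sigmaw lam p w x = +oo)%E.
    apply/eqP; rewrite -leye_eq.
    have <- : (\int[leb]_(x in I n `&` zeros) (cst +oo x) = +oo)%E.
      rewrite integral_cst; last exact: measurableI (mI n) mz.
      rewrite gt0_mulye// setIC; apply: (lt_le_trans n0P).
      apply: le_measure; rewrite ?inE; [exact: measurableI mz (mI _)|exact: measurableI mz (mI _)|].
      move=> x [zx]; rewrite /I /= !in_itv /= => /andP[-> xn]; split => //=.
      by apply: (lt_le_trans xn); rewrite ler_nat ltnS.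
    rewrite integral_mkcondr; apply: int_le_unmeasurable => x Ix; rewrite patchE.
      by case: ifP => // _; exact: leey.
    case: ifPn => [/set_mem[_ /= wx]|_]; first by rewrite /sigmaw wx eqxx.
    exact: sigmaw_ge0.
  have U0 : 0 < (fine (mass leb u (I n)))^-1.
    rewrite invr_gt0 fine_gt0// interval_mass_lty// andbT.
    apply: mass_gt0; [exact: mI|exact: (weight_udens lam)|].
    exact: (interval_gt0 (iI n)).
  rewrite gt0_muley ?lte_fin// poweRyr ?gt_eqF//.
  have w0 : (0 <= \int[leb]_(x in I n) (w x)%:E)%E.
    apply: integral_ge0 => x Ix; rewrite lee_fin; case: Aw => _ + _; apply.
    exact: interval_subRp Ix.
  move: w0; rewrite le_eqVlt => /predU1P[//|w0].
  by rewrite gt0_muley ?leye_eq// mule_gt0// lte_fin.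
have ae n : {ae leb, forall x, I (n0 + n)%N x -> w x = 0}.
  have wI := wI0 _ (leq_addr n n0).
  have mw : measurable_fun (I (n0 + n)%N) (fun x => (w x)%:E).
    apply/measurable_EFinP; case: Aw => mw _ _.
    by apply: (measurable_funS _ _ mw); [exact: measurable_Rp|exact: interval_subRp].
  have [h _] := ae_eq_integral_abs leb (mI (n0 + n)%N) mw.
  apply: (ae_impl (h _)) => [|x /= wx Ix]; last by apply: EFin_inj; exact: wx.
  rewrite -[RHS]wI; apply: eq_integral => x /set_mem Ix; rewrite gee0_abs// lee_fin.
  by case: Aw => _ + _; apply; exact: interval_subRp Ix.
apply: (ae_impl (ae_foralln ae)) => x wx Rx.
have [m0 mP] := cover _ Rx; apply: (wx m0); apply: mP; exact: leq_addl.
Qed.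

Lemma st_le x : Rp x -> ((st x)%:E <= sigmaw lam p w x)%E.
Proof.
move=> Rx; have [wx|wx] := eqVneq (w x) 0; last by rewrite stE.
by rewrite /sigmaw wx eqxx leey.
Qed.

Section null_zeros.
Hypothesis z0 : leb zeros = 0%E.

Lemma wt_ae : {ae leb, forall x, Rp x -> w x = wt x}.
Proof.
exists zeros; split => //; first exact: measurable_zeros.
move=> x /= /not_implyP[Rx wx]; split => //=; apply: contrapT => /eqP wx0.
by apply: wx; rewrite wtE.
Qed.

Lemma int_wt (A : set R) (h : R -> \bar R) : measurable A -> A `<=` Rp -> nnmf h ->
  (\int[leb]_(x in A) (h x * (w x)%:E) = \int[leb]_(x in A) (h x * (wt x)%:E))%E.
Proof.
move=> mA AR nh; have nw := weight_nnmf weight_wt.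
have nwR : nnmf (fun x => ((w \_ Rp) x)%:E).
  apply: nnmf_EFin; first exact: measurable_wRp.
  by move=> x; rewrite patchE; case: ifPn => // /set_mem; case: Aw => _ + _; exact.
have -> : (\int[leb]_(x in A) (h x * (w x)%:E) =
    \int[leb]_(x in A) (h x * ((w \_ Rp) x)%:E))%E.
  by apply: eq_integral => x /set_mem /AR Rx; rewrite patchE mem_set.
have n1 : nnmf (fun x => h x * ((w \_ Rp) x)%:E)%E by exact: nnmfM.
have n2 : nnmf (fun x => h x * (wt x)%:E)%E by exact: nnmfM.
apply: ge0_ae_eq_integral => //; try exact: nnmfS.
- by move=> x _; exact: nnmf_ge0 n1.
- by move=> x _; exact: nnmf_ge0 n2.
apply: (ae_impl wt_ae) => x wx /AR Rx; rewrite patchE mem_set//.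
by rewrite (wx Rx).
Qed.

Lemma Ap_mass (B : set R) : interval_Rp B ->
  [/\ (mass leb wt B < +oo)%E, (mass leb st B < +oo)%E &
    fine (mass leb wt B) * fine (mass leb st B) `^ (p - 1) <=
    fine (Ap_const lam p w) * fine (mass leb u B) `^ p].
Proof.
move=> iB; have mB := interval_measurable iB; have BR := interval_subRp iB.
have B0 := interval_gt0 iB.
have X0 : (0 < mass leb wt B)%E by apply: mass_gt0 => //; exact: weight_wt.
have Y0 : (0 < mass leb st B)%E by apply: mass_gt0 => //; exact: weight_st.
have U0 : 0 < fine (mass leb u B).
  rewrite fine_gt0// interval_mass_lty// andbT.
  by apply: mass_gt0 => //; exact: weight_udens.
apply: Ap_arith => //; apply: le_trans (Ap_interval iB).
have Ui0 : (0 <= ((fine (mass leb u B))^-1)%:E)%E by rewrite lee_fin invr_ge0 ltW.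
have <- : mass leb wt B = (\int[leb]_(x in B) (w x)%:E)%E.
  have n1 : nnmf (fun _ : R => 1%E : \bar R) by exact: nnmf_cst.
  have := int_wt mB BR n1.
  under eq_integral do rewrite mul1e.
  by under [in X in _ = X -> _]eq_integral do rewrite mul1e.
apply: lee_wpmul2l; first by rewrite mule_ge0// ltW.
have sB : (mass leb st B <= \int[leb]_(x in B) sigmaw lam p w x)%E.
  apply: int_le_unmeasurable => x Bx; last exact/st_le/BR.
  by rewrite lee_fin ltW//; case: weight_st.
apply: (gt0_ler_poweR (ltW p10)).
- by rewrite in_itv /= leey andbT mule_ge0// ltW.
- by rewrite in_itv /= leey andbT mule_ge0// (le_trans _ sB)// ltW.
by apply: lee_wpmul2l.
Qed.

End null_zeros.
End weights.

(** * From intervals to dyadic cubes: oscillation and weights *)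

Section cubes.
Variables (R : realType) (lam : R) (D : int -> set (set R)) (z : int -> set R -> R)
  (delta c0 C0 : R).
Hypotheses (lam0 : 0 < lam) (DD : dyadic_system D z delta c0 C0).
Local Notation leb := (@lebesgue_measure R).
Local Notation u := (udens lam).
Local Notation Cd := (dyadic_const lam delta c0 C0).

Definition cube_ball (k : int) (Q : set R) : set R := rball (z k Q) (C0 * delta ^ k).

Lemma cube_ball_interval k Q : D k Q -> interval_Rp (cube_ball k Q).
Proof.
move=> DQ; apply: rball_interval; first exact/RpE/(dyadic_center DD DQ).
by rewrite mulr_gt0 ?(dyadic_C0 DD) ?(delta_gt0 DD).
Qed.

Lemma cube_sub_ball k Q : D k Q -> Q `<=` cube_ball k Q.
Proof. by move=> DQ; have QB := dyadic_outer DD DQ. Qed.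

Lemma cube_ball_mass k Q : D k Q -> (mass leb u (cube_ball k Q) <= Cd%:E * mass leb u Q)%E.
Proof.
move=> DQ; apply: (dyadic_doubling lam0 DD DQ DQ); first exact: subset_refl.
by rewrite lerDl.
Qed.

Lemma cube_fine_mass k Q : D k Q -> 0 < fine (mass leb u Q).
Proof.
by move=> DQ; rewrite fine_gt0// (dyadic_mass_gt0 lam0 DD DQ) (dyadic_mass_lty lam0 DD DQ).
Qed.

Section oscillation.
Variables (b : R -> R) (beta : R).
Hypotheses (Bb : BMO lam b) (bbeta : fine (bmo_norm lam b) <= beta) (beta0 : 0 < beta).

Let bt := b \_ Rp.

Lemma measurable_bRp : measurable_fun [set: R] bt.
Proof. by case: Bb => mb _ _; exact: (measurable_restrictT b (@measurable_Rp R)).1. Qed.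

Lemma bRpE (A : set R) : A `<=` Rp -> forall x, x \in A -> bt x * u x = b x * dens lam x.
Proof.
move=> AR x /set_mem Ax; have Rx := AR _ Ax.
by rewrite udensE// /bt patchE mem_set.
Qed.

Lemma interval_integrable B : interval_Rp B ->
  leb.-integrable B (fun x => (bt x * u x)%:E).
Proof.
move=> iB; case: Bb => _ /(_ _ iB) + _; apply: eq_integrable.
  exact: interval_measurable.
by move=> x xB; rewrite (bRpE (interval_subRp iB)).
Qed.

Lemma cube_integrable k Q : D k Q -> leb.-integrable Q (fun x => (bt x * u x)%:E).
Proof.
move=> DQ; have iB := cube_ball_interval DQ.
apply: integrableS (interval_integrable iB).
- exact: interval_measurable.
- by have mQ := dyadic_measurable DD DQ.
- exact: cube_sub_ball DQ.
Qed.

Lemma bavg_avg A : A `<=` Rp -> bavg leb u bt A = avg lam A b.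
Proof.
move=> AR; rewrite /bavg /avg muI_mass// /intmu; congr (fine _ / _).
by apply: eq_integral => x xA; rewrite (bRpE AR).
Qed.

Lemma interval_osc B : interval_Rp B ->
  (\int[leb]_(x in B) (`|bt x - avg lam B b|%:E * (u x)%:E) <= beta%:E * mass leb u B)%E.
Proof.
move=> iB; have BR := interval_subRp iB; have mB := interval_measurable iB.
have U0 : 0 < fine (mass leb u B).
  rewrite fine_gt0// (interval_mass_lty lam0 iB) andbT.
  by apply: mass_gt0 => //; [exact: (weight_udens lam)|exact: interval_gt0 iB].
have Uf : mass leb u B \is a fin_num.
  by rewrite ge0_fin_numE ?(interval_mass_lty lam0 iB)// mass_ge0//; exact: (weight_udens lam).
have -> : (\int[leb]_(x in B) (`|bt x - avg lam B b|%:E * (u x)%:E) =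
    \int[leb]_(x in B) (`|b x - avg lam B b| * dens lam x)%:E)%E.
  apply: eq_integral => x /set_mem Bx; rewrite /bt patchE mem_set ?udensE//; last exact: BR.
  exact: BR.
set I := (\int[leb]_(x in B) _)%E.
have I0 : (0 <= I)%E.
  by apply: integral_ge0 => x _; rewrite lee_fin mulr_ge0// powR_ge0.
have h : ((fine (mass leb u B))^-1%:E * I <= bmo_norm lam b)%E.
  by apply: ereal_sup_ubound; exists B => //; rewrite muI_mass.
have n0 : (0 <= bmo_norm lam b)%E by apply: le_trans h; rewrite mule_ge0// lee_fin invr_ge0 ltW.
have nf : bmo_norm lam b \is a fin_num by rewrite ge0_fin_numE//; case: Bb.
rewrite -(fineK Uf) -lee_pdivrMr// muleC; apply: (le_trans h).
by rewrite -(fineK nf) lee_fin.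
Qed.

(** The oscillation is bounded on the enclosing interval at the price of the doubling constant;
    replacing the average over the interval by the one over the cube doubles the bound. *)
Lemma cube_osc k Q : D k Q ->
  (\int[leb]_(x in Q) (`|bt x - bavg leb u bt Q|%:E * (u x)%:E) <=
   (2 * (Cd * beta))%:E * mass leb u Q)%E.
Proof.
move=> DQ; have iB := cube_ball_interval DQ; have mQ := dyadic_measurable DD DQ.
have mB := interval_measurable iB.
have nu := weight_nnmf (weight_udens lam).
pose c := avg lam (cube_ball k Q) b.
have nd (r : R) : nnmf (fun x => `|bt x - r|%:E) by apply: nnmf_dist; exact: measurable_bRp.
have ndu (r : R) : nnmf (fun x => `|bt x - r|%:E * (u x)%:E)%E by exact: nnmfM.
have cd : (`|bavg leb u bt Q - c|%:E * mass leb u Q <=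
    \int[leb]_(x in Q) (`|bt x - c|%:E * (u x)%:E))%E.
  apply: (@bavg_dist _ _ _ leb D u bt _ (weight_udens lam) _ _ _ k Q c DQ).
  - by move=> l P DP; have mP := dyadic_measurable DD DP.
  - exact: (dyadic_mass_gt0 lam0 DD).
  - exact: (dyadic_mass_lty lam0 DD).
  - exact: cube_integrable.
have oscQ : (\int[leb]_(x in Q) (`|bt x - c|%:E * (u x)%:E) <= (Cd * beta)%:E * mass leb u Q)%E.
  apply: (@le_trans _ _ (\int[leb]_(x in cube_ball k Q) (`|bt x - c|%:E * (u x)%:E))%E).
    exact: (int_subset leb mQ mB (ndu c) (cube_sub_ball DQ)).
  apply: (le_trans (interval_osc iB)); rewrite mulrC EFinM -muleA.
  by apply: lee_wpmul2l; [rewrite lee_fin ltW|exact: cube_ball_mass].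
apply: (@le_trans _ _ (\int[leb]_(x in Q) (`|bt x - c|%:E * (u x)%:E +
    `|bavg leb u bt Q - c|%:E * (u x)%:E))%E).
  have n2 : nnmf (fun x => `|bt x - c|%:E * (u x)%:E + `|bavg leb u bt Q - c|%:E * (u x)%:E)%E.
    by apply: nnmfD => //; apply: nnmfM => //; exact: nnmf_cst.
  apply: (int_le leb mQ (ndu _) n2) => x _; rewrite -ge0_muleDl; [|by rewrite lee_fin|by rewrite lee_fin].
  apply: lee_wpmul2r; first by case: nu => _; apply.
  rewrite -EFinD lee_fin (distrC (bavg _ _ _ _)).
  by rewrite (le_trans _ (ler_normD _ _))// addrA subrK.
have n3 : nnmf (fun x => `|bavg leb u bt Q - c|%:E * (u x)%:E)%E by apply: nnmfM => //; exact: nnmf_cst.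
rewrite (intD leb mQ (ndu c) n3).
rewrite intZl// -/(mass leb u Q).
rewrite (_ : 2 * (Cd * beta) = Cd * beta + Cd * beta); last by rewrite mulr2n mulrDl mul1r.
have Cb : (0 <= (Cd * beta)%:E)%E by rewrite lee_fin ltW// mulr_gt0// (dyadic_const_gt0 lam DD).
rewrite EFinD ge0_muleDl//.
by apply: leeD => //; exact: le_trans cd _.
Qed.

(** The constant of [int_dist_bavg] for the oscillation bound [2 * (Cd * beta)] of [cube_osc]. It is
    linear in [beta], hence the linear dependence on the BMO norm. *)
Definition kappa : R := 2 * (2 * (2 * (Cd * beta)) + Cd * (2 * (Cd * beta))).

Lemma kappa_gt0 : 0 < kappa.
Proof.
have C0' := dyadic_const_gt0 lam DD; have Cb := mulr_gt0 C0' beta0.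
apply: mulr_gt0 => //; apply: addr_gt0; first by do 2 apply: mulr_gt0 => //.
by apply: mulr_gt0 => //; exact: mulr_gt0.
Qed.

Lemma cube_john_nirenberg (F : nat -> set R) : (forall i, measurable (F i)) ->
  (forall Q, dcube D Q -> exists i, F i = Q) ->
  forall g : R -> R, nnmf (fun x => (g x)%:E) -> forall k Q, D k Q ->
  (\int[leb]_(x in Q) (`|bt x - bavg leb u bt Q|%:E * ((g x)%:E * (u x)%:E)) <=
   kappa%:E * \int[leb]_(x in Q) (dmax leb u F (fun x => (g x)%:E) x * (u x)%:E))%E.
Proof.
move=> mF DF g ng k Q DQ; have C0' := dyadic_const_gt0 lam DD.
apply: (@int_dist_bavg _ _ _ leb D (@Rp R)) DQ.
- by move=> l P DP; have mP := dyadic_measurable DD DP.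
- exact: dyadic_Rp DD.
- exact: dyadic_cover DD.
- exact: dyadic_disjoint DD.
- exact: dyadic_nested DD.
- exact: dyadic_enum DD.
- exact: (weight_udens lam).
- exact: (dyadic_mass_gt0 lam0 DD).
- exact: (dyadic_mass_lty lam0 DD).
- exact: measurable_bRp.
- exact: cube_integrable.
- by [].
- by move=> l P DP; apply: DF; exists l.
- by apply: mulr_gt0 => //; exact: mulr_gt0.
- exact: ltW.
- exact: cube_osc.
- move=> l P P' DP DP' PP'; apply: (@le_trans _ _ (mass leb u (cube_ball l P))).
    have mP := dyadic_measurable DD DP.
    have mB := interval_measurable (cube_ball_interval DP).
    exact: (mass_le leb mP mB (weight_udens lam) (cube_sub_ball DP)).
  exact: (dyadic_doubling lam0 DD DP DP' PP').
- by [].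
- apply: (dyadic_bgen_cvg lam0 DD); first exact: measurable_bRp.
  + exact: interval_integrable.
  + exact: cube_integrable.
Qed.

End oscillation.

Section weight_on_cubes.
Variables (p : R) (w : R -> R).
Hypotheses (p1 : 1 < p) (Aw : Ap_weight lam p w) (z0 : leb (zeros w) = 0%E).
Let W := fine (Ap_const lam p w) * Cd `^ p.

(** The masses of both weights increase from the cube to its enclosing interval, and returning from
    the interval to the cube in the u-mass costs Cd^p. *)
Lemma cube_Ap k Q : D k Q ->
  [/\ (mass leb (wt w) Q < +oo)%E, (mass leb (st lam p w) Q < +oo)%E &
    fine (mass leb (wt w) Q) * fine (mass leb (st lam p w) Q) `^ (p - 1) <=
    W * fine (mass leb u Q) `^ p].
Proof.
move=> DQ; have iB := cube_ball_interval DQ; have mQ := dyadic_measurable DD DQ.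
have mB := interval_measurable iB; have QB := cube_sub_ball DQ.
have [wB sB h] := Ap_mass lam0 p1 Aw z0 iB.
have wQB := mass_le leb mQ mB (weight_wt Aw) QB.
have sQB := mass_le leb mQ mB (weight_st Aw) QB.
have wQ := le_lt_trans wQB wB; have sQ := le_lt_trans sQB sB.
split; [exact: wQ|exact: sQ|].
have fw A : (mass leb (wt w) A < +oo)%E -> mass leb (wt w) A \is a fin_num.
  by move=> ?; rewrite ge0_fin_numE// mass_ge0//; exact: weight_wt Aw.
have fs A : (mass leb (st lam p w) A < +oo)%E -> mass leb (st lam p w) A \is a fin_num.
  by move=> ?; rewrite ge0_fin_numE// mass_ge0//; exact: weight_st Aw.
have fwQB : fine (mass leb (wt w) Q) <= fine (mass leb (wt w) (cube_ball k Q)).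
  by apply: fine_le wQB; exact: fw.
have fsQB : fine (mass leb (st lam p w) Q) <= fine (mass leb (st lam p w) (cube_ball k Q)).
  by apply: fine_le sQB; exact: fs.
have w0 : 0 <= fine (mass leb (wt w) Q) by rewrite fine_ge0// mass_ge0//; exact: weight_wt Aw.
have s0 : 0 <= fine (mass leb (st lam p w) Q) by rewrite fine_ge0// mass_ge0//; exact: weight_st Aw.
have p10 : 0 <= p - 1 by rewrite subr_ge0 ltW.
apply: (@le_trans _ _ (fine (mass leb (wt w) (cube_ball k Q)) *
    fine (mass leb (st lam p w) (cube_ball k Q)) `^ (p - 1))).
  apply: ler_pM; [exact: w0|exact: powR_ge0|exact: fwQB|].
  by apply: (ge0_ler_powR p10); rewrite ?nnegrE// (le_trans s0).
apply: (le_trans h); rewrite /W -mulrA -powRM ?fine_ge0 ?mass_ge0//; last 2 first.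
- exact: ltW (dyadic_const_gt0 lam DD).
- exact: (weight_udens lam).
apply: ler_wpM2l.
  by rewrite fine_ge0// (Ap_const_ge0 Aw).
have CM := cube_ball_mass DQ.
have uQ0 := cube_fine_mass DQ.
have uQf : mass leb u Q \is a fin_num.
  by rewrite gt0_fin_numE ?(dyadic_mass_gt0 lam0 DD DQ) ?(dyadic_mass_lty lam0 DD DQ).
have p0 : 0 <= p by rewrite ltW// (lt_trans _ p1).
apply: (ge0_ler_powR p0).
- by rewrite nnegrE fine_ge0// mass_ge0//; exact: (weight_udens lam).
- by rewrite nnegrE mulr_ge0 ?(ltW uQ0)// ltW// (dyadic_const_gt0 lam DD).
rewrite -lee_fin fineK; last first.
  rewrite ge0_fin_numE ?(interval_mass_lty lam0 iB)// mass_ge0//; exact: (weight_udens lam).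
by rewrite EFinM (fineK uQf).
Qed.

(** Hölder on a single cube gives u(Q)^p <= w(Q) s(Q)^(p-1), which is at most W u(Q)^p. *)
Lemma cube_Ap_ge1 : 1 <= W.
Proof.
have R1 : Rp (1 : R) by exact/RpE.
have [Q [DQ _]] := dyadic_cover DD 0 R1.
have [wQ sQ h] := cube_Ap DQ; have mQ := dyadic_measurable DD DQ.
have p0 : 0 < p by apply: lt_trans p1.
have hol : (mass leb u Q <= (fine (mass leb (wt w) Q) `^ p^-1 *
    fine (mass leb (st lam p w) Q) `^ (p / (p - 1))^-1)%:E)%E.
  apply: (mass_hoelder p1 (conjugate_pq p1)) => //.
  - exact: (weight_udens lam).
  - exact: weight_wt Aw.
  - exact: weight_st Aw.
  - by move=> x; exact: u_wt_st.
have uQf : mass leb u Q \is a fin_num.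
  by rewrite gt0_fin_numE ?(dyadic_mass_gt0 lam0 DD DQ) ?(dyadic_mass_lty lam0 DD DQ).
move: hol h; rewrite -(fineK uQf) lee_fin /=; have := cube_fine_mass DQ.
have : 0 <= fine (mass leb (wt w) Q) by rewrite fine_ge0// mass_ge0//; exact: weight_wt Aw.
have : 0 <= fine (mass leb (st lam p w) Q) by rewrite fine_ge0// mass_ge0//; exact: weight_st Aw.
move: (fine _) (fine _) (fine _) => U X Y Y0 X0 U0 hol h.
have Up : 0 < U `^ p by exact: powR_gt0.
rewrite -(ler_pM2r Up) mul1r; apply: le_trans h.
apply: le_trans (ge0_ler_powR (ltW p0) _ _ hol) _; rewrite ?nnegrE ?mulr_ge0 ?powR_ge0 ?(ltW U0)//.
rewrite powRM ?powR_ge0// -!powRrM mulVf ?gt_eqF// powRr1//.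
by rewrite invf_div divfK ?gt_eqF.
Qed.

End weight_on_cubes.

End cubes.

(** * The sparse operators on the half-line *)

Lemma abse_ssum_le (R : realType) (S : set (set R)) (t : set R -> R) :
  (`|ssum S t| <= \esum_(Q in S) `|t Q|%:E)%E.
Proof.
rewrite /ssum; apply: (le_trans (lee_abs_sub _ _)).
have p0 Q : (0 <= (Num.max (t Q) 0)%:E)%E by rewrite lee_fin le_max lexx orbT.
have n0 Q : (0 <= (Num.max (- t Q) 0)%:E)%E by rewrite lee_fin le_max lexx orbT.
rewrite !gee0_abs ?esum_ge0// -esumD//.
rewrite le_eqVlt; apply/orP; left; apply/eqP; apply: eq_esum => Q _.
rewrite -EFinD; congr EFin; case: (lerP 0 (t Q)) => tQ.
  by rewrite ger0_norm// max_r ?addr0// oppr_le0.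
by rewrite ltr0_norm// max_l ?add0r// oppr_ge0 ltW.
Qed.

(** [P] keeps the first index at which each member of [S] occurs: the sparse sum counts a cube once,
    although [F] may repeat it. *)
Lemma injective_subenumeration T (S : set T) (F : nat -> T) :
  (forall Q, S Q -> exists i, F i = Q) ->
  exists P : pred nat, [/\ forall n, P n -> S (F n), {in P &, injective F} &
    S = [set F n | n in [set n | P n]]].
Proof.
move=> FS; exists (fun n => `[< S (F n) /\ forall j, (j < n)%N -> F j <> F n >]).
split=> [n /asboolP[]//|n l|].
  rewrite !unfold_in => /asboolP[_ nF] /asboolP[_ lF] Fnl.
  by case: (ltngtP n l) => // h; [have := lF _ h|have := nF _ h; rewrite -Fnl].
apply/seteqP; split=> [Q SQ|_ [n /asboolP[Sn _] <-]//].
have [i FiQ] := FS _ SQ.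
have ex : exists i, `[< F i = Q >] by exists i; exact/asboolP.
case: (ex_minnP ex) => n /asboolP FnQ nmin; exists n => //=; apply/asboolP.
rewrite FnQ; split=> // j jn FjQ; have := nmin j; rewrite leqNgt jn.
by move=> /(_ (asboolT FjQ)).
Qed.

Lemma esum_subenumeration (R : realType) (T : choiceType) (F : nat -> T) (P : pred nat)
    (a : T -> \bar R) :
  (forall Q, 0 <= a Q)%E -> {in P &, injective F} ->
  (\esum_(Q in [set F n | n in [set n | P n]]) a Q =
   \sum_(i <oo) (if P i then a (F i) else 0))%E.
Proof.
move=> a0 Finj; rewrite -eseries_mkcond -esum_pred_image// => n l.
by rewrite !inE => Pn Pl; exact: Finj.
Qed.

(** * Pointwise domination of the sparse operators by nonnegative ones *)

Section domination.
Variables (R : realType) (lam : R) (D : int -> set (set R)) (z : int -> set R -> R)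
  (delta c0 C0 : R).
Hypotheses (lam0 : 0 < lam) (DD : dyadic_system D z delta c0 C0).
Local Notation leb := (@lebesgue_measure R).
Local Notation u := (udens lam).
Variables (S : set (set R)) (F : nat -> set R) (P : pred nat) (b f : R -> R).
Hypotheses (SD : S `<=` dcube D) (PS : forall n, P n -> S (F n))
  (Finj : {in P &, injective F}) (FP : S = [set F n | n in [set n | P n]])
  (mb : measurable_fun Rp b) (mf : measurable_fun Rp f).
Let bt := b \_ Rp.
Let ft x := `|(f \_ Rp) x|.
Let k n := if P n then n else 0%N.
Let bb n := bavg leb u bt (F (k n)).

(** No integrability is assumed: [fine] sends an infinite value to 0, which only helps the
    inequality. *)
Lemma abs_intmu (Q : set R) (h : R -> R) : measurable Q -> Q `<=` Rp ->
  measurable_fun Rp h ->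
  (`|fine (intmu lam Q h)|%:E <= \int[leb]_(x in Q) (`|h x|%:E * (u x)%:E))%E.
Proof.
move=> mQ QR mh; have [mu u0] := weight_udens lam.
have fine_le_abs (y : \bar R) : (`|fine y|%:E <= `|y|)%E.
  by case: y => [r| |] //=; rewrite normr0 leey.
apply: (le_trans (fine_le_abs _)).
have -> : intmu lam Q h = (\int[leb]_(x in Q) (h x * u x)%:E)%E.
  by apply: eq_integral => x /set_mem /QR /udensE ->.
have mhu : measurable_fun Q (fun x => (h x * u x)%:E).
  apply/measurable_EFinP/measurable_funM; last exact: measurable_funTS.
  by apply: (measurable_funS _ QR mh); exact: measurable_Rp.
apply: (le_trans (le_abse_integral leb mQ mhu)).
rewrite le_eqVlt; apply/orP; left; apply/eqP; apply: eq_integral => x _.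
by rewrite abse_EFin normrM (gtr0_norm (u0 x)) EFinM.
Qed.

Let udens_ge0 x : (0 <= (u x)%:E)%E.
Proof. by have [_ /(_ x)/ltW u0] := weight_udens lam; rewrite lee_fin. Qed.

Let invU_ge0 i : (0 <= (invU leb u F k i)%:E)%E.
Proof. by rewrite lee_fin invr_ge0 fine_ge0//; apply: integral_ge0 => x _; exact: udens_ge0. Qed.

Lemma AS_le x : Rp x ->
  (`|AS lam S b f x| <= comm_op leb u bt F k bb (fun x => (ft x)%:E) x)%E.
Proof.
move=> Rx; apply: (le_trans (abse_ssum_le _ _)).
rewrite FP esum_subenumeration//; apply: lee_nneseries => [i _ _|i _].
  by case: ifP => // _; rewrite lee_fin.
rewrite /comm_op; case: ifPn => Pi; last first.
  apply: mule_ge0; last by rewrite lee_fin indicE; case: (_ \in _).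
  apply: mule_ge0; first by apply: mule_ge0; [exact: invU_ge0|rewrite lee_fin].
  by apply: integral_ge0 => y _; apply: mule_ge0; [rewrite lee_fin /ft|exact: udens_ge0].
have [l DQ] := SD (PS Pi); have mQ := dyadic_measurable DD DQ.
have QR := dyadic_Rp DD DQ; have uQ := cube_fine_mass lam0 DD DQ.
rewrite /invU /bb /k Pi bavg_avg// muI_mass// /bt patchE mem_set//.
set Q := F i in DQ mQ QR uQ *.
have I_le : (`|fine (intmu lam Q f)|%:E <= \int[leb]_(x in Q) ((ft x)%:E * (u x)%:E))%E.
  apply: (le_trans (abs_intmu mQ QR mf)); rewrite le_eqVlt; apply/orP; left; apply/eqP.
  by apply: eq_integral => y /set_mem /QR Ry; rewrite /ft patchE mem_set.
rewrite !normrM normr_id (gtr0_norm (_ : 0 < (fine (mass leb u Q))^-1)) ?invr_gt0//.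
rewrite (ger0_norm (_ : 0 <= \1_Q x)); last by rewrite indicE; case: (_ \in _).
rewrite !EFinM; apply: lee_wpmul2r; first by rewrite lee_fin indicE; case: (_ \in _).
apply: lee_wpmul2l => //; rewrite mule_ge0// lee_fin// invr_ge0; exact: ltW.
Qed.

Lemma ASstar_le x : Rp x ->
  (`|ASstar lam S b f x| <= comm_star leb u bt F k bb ft x)%E.
Proof.
move=> Rx; apply: (le_trans (abse_ssum_le _ _)).
rewrite FP esum_subenumeration//; apply: lee_nneseries => [i _ _|i _].
  by case: ifP => // _; rewrite lee_fin.
rewrite /comm_star; case: ifPn => Pi; last first.
  apply: mule_ge0; last by rewrite lee_fin indicE; case: (_ \in _).
  apply: mule_ge0; first exact: invU_ge0.
  apply: integral_ge0 => y _; apply: mule_ge0; first by rewrite lee_fin.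
  by apply: mule_ge0; [rewrite lee_fin /ft|exact: udens_ge0].
have [l DQ] := SD (PS Pi); have mQ := dyadic_measurable DD DQ.
have QR := dyadic_Rp DD DQ; have uQ := cube_fine_mass lam0 DD DQ.
rewrite /invU /bb /k Pi bavg_avg// muI_mass//.
set Q := F i in DQ mQ QR uQ *; set c := avg lam Q b.
have mh : measurable_fun Rp (fun t => `|b t - c| * f t).
  apply: measurable_funM => //; apply: measurableT_comp => //.
  by apply: measurable_funB => //; exact: measurable_cst.
have I_le : (`|fine (intmu lam Q (fun t => `|b t - c| * f t))|%:E <=
    \int[leb]_(x in Q) (`|bt x - c|%:E * ((ft x)%:E * (u x)%:E)))%E.
  apply: (le_trans (abs_intmu mQ QR mh)); rewrite le_eqVlt; apply/orP; left; apply/eqP.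
  apply: eq_integral => y /set_mem /QR Ry; rewrite /ft /bt !patchE mem_set//.
  by rewrite normrM normr_id EFinM muleA.
rewrite !normrM (gtr0_norm (_ : 0 < (fine (mass leb u Q))^-1)) ?invr_gt0//.
rewrite (ger0_norm (_ : 0 <= \1_Q x)); last by rewrite indicE; case: (_ \in _).
rewrite !EFinM; apply: lee_wpmul2r; first by rewrite lee_fin indicE; case: (_ \in _).
by apply: lee_wpmul2l => //; rewrite lee_fin invr_ge0 ltW.
Qed.

End domination.

(** * Exchanging [w] for a strictly positive weight *)

Section weighted_integrals.
Variables (R : realType) (lam p : R) (w : R -> R).
Hypotheses (p1 : 1 < p) (Aw : Ap_weight lam p w).
Local Notation leb := (@lebesgue_measure R).

Lemma LpwE_le (g G : R -> \bar R) : (forall x, Rp x -> `|g x| <= G x)%E ->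
  (LpwE p w g <= \int[leb]_(x in Rp) (poweR (G x) p * (w x)%:E))%E.
Proof.
move=> gG; have w0 x : Rp x -> (0 <= (w x)%:E)%E.
  by move=> Rx; rewrite lee_fin; case: Aw => _ + _; exact.
have p0 : 0 <= p by rewrite ltW// (lt_trans _ p1).
apply: int_le_unmeasurable => x Rx; first by rewrite mule_ge0 ?poweR_ge0 ?w0.
apply: lee_wpmul2r; first exact: w0.
apply: (gt0_ler_poweR p0); rewrite ?in_itv /= ?leey ?andbT ?abse_ge0//.
- exact: le_trans (gG _ Rx).
- exact: gG.
Qed.

Lemma int_w_ae0 (h : R -> \bar R) : {ae leb, forall x, Rp x -> w x = 0} -> nnmf h ->
  (\int[leb]_(x in Rp) (h x * (w x)%:E) = 0)%E.
Proof.
move=> w0 nh; have mR : measurable (@Rp R) by exact: measurable_Rp.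
have mw : measurable_fun (@Rp R) (fun x => (w x)%:E) by apply/measurable_EFinP; case: Aw.
rewrite (@ge0_ae_eq_integral _ _ _ leb _ _ (cst 0%E))//.
- by rewrite integral0.
- by apply: emeasurable_funM => //; exact: nnmfS.
- by move=> x Rx; rewrite mule_ge0 ?(nnmf_ge0 _ nh)// lee_fin; case: Aw => _ + _; exact.
- by apply: (ae_impl w0) => x wx Rx; rewrite wx// mule0.
Qed.

Hypothesis z0 : leb (zeros w) = 0%E.

Lemma Lpw_wt (f : R -> R) : measurable_fun Rp f ->
  Lpw p w f = (\int[leb]_x (poweR (`|(f \_ Rp) x|)%:E p * (wt w x)%:E))%E.
Proof.
move=> mf; have mR : measurable (@Rp R) by exact: measurable_Rp.
have nf : nnmf (fun x => poweR (`|(f \_ Rp) x|)%:E p).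
  apply: nnmf_poweR; apply: nnmf_EFin => //; apply: measurableT_comp => //.
  exact: (measurable_restrictT f mR).1.
have -> : Lpw p w f = (\int[leb]_(x in Rp) (poweR (`|(f \_ Rp) x|)%:E p * (w x)%:E))%E.
  by apply: eq_integral => x xR; rewrite patchE xR poweR_EFin EFinM.
rewrite (int_wt Aw z0 mR (@subset_refl _ _) nf) integral_mkcond.
apply: eq_integral => x _; rewrite [LHS]patchE; case: ifPn => // xR.
rewrite patchE (negPf xR) normr0 poweR0r ?mul0e// gt_eqF//.
exact: lt_trans p1.
Qed.

Lemma int_wt_le (G : R -> \bar R) : nnmf G ->
  (\int[leb]_(x in Rp) (poweR (G x) p * (w x)%:E) <=
   \int[leb]_x (poweR (G x) p * (wt w x)%:E))%E.
Proof.
move=> nG; have mR : measurable (@Rp R) by exact: measurable_Rp.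
have nGp : nnmf (fun x => poweR (G x) p) by exact: nnmf_poweR.
have nwt := weight_nnmf (weight_wt Aw).
rewrite (int_wt Aw z0 mR (@subset_refl _ _) nGp).
have nGw : nnmf (fun x => poweR (G x) p * (wt w x)%:E)%E by exact: nnmfM.
have mT : measurable [set: R] by exact: measurableT.
exact: (int_subset leb mR mT nGw (@subsetT _ _)).
Qed.

(** Supplies the sets on which [duality] truncates. On the half-line the A_p condition makes [wt]
    integrable on each interval []0, n.+1[], and outside [wt] equals 1. *)
Lemma wt_exhaustion : 0 < lam -> exists Z : nat -> set R,
  [/\ forall n, measurable (Z n), forall n l, (n <= l)%N -> Z n `<=` Z l,
      forall x, exists n, Z n x & forall n, (mass leb (wt w) (Z n) < +oo)%E].
Proof.
move=> lam0; pose A (n : nat) : set R := `]- n%:R, 0%R]%classic.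
pose I (n : nat) : set R := `]0, n.+1%:R[%classic.
have mA n : measurable (A n) by exact: measurable_itv.
have iI n : interval_Rp (I n) by exists 0, n.+1%:R.
have mI n := interval_measurable (iI n).
have nwt := weight_nnmf (weight_wt Aw).
exists (fun n => A n `|` I n); split.
- by move=> n; exact: measurableU.
- move=> n l nl x [|]; rewrite /A /I /= !in_itv /= => /andP[h1 h2]; [left|right].
    by rewrite h2 andbT (le_lt_trans _ h1)// lerN2 ler_nat.
  by rewrite h1 (lt_le_trans h2)// ler_nat ltnS.
- move=> x; have [x0|x0] := ltP 0 x.
    exists (Num.bound x); right; rewrite /I /= in_itv /= x0.
    by rewrite (lt_trans (archi_boundP (ltW x0)))// ltr_nat.
  exists (Num.bound (- x)); left; rewrite /A /= in_itv /= x0 andbT ltrNl.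
  by rewrite archi_boundP// oppr_ge0.
- move=> n; rewrite /mass (int_setU leb (mA n) (mI n) nwt); last first.
    rewrite -subset0 => x []; rewrite /A /I /= !in_itv /= => /andP[_ x0] /andP[].
    by rewrite ltNge x0.
  have [wI _ _] := Ap_mass lam0 p1 Aw z0 (iI n).
  apply: lte_add_pinfty; last exact: wI.
  have -> : (\int[leb]_(x in A n) (wt w x)%:E = \int[leb]_(x in A n) (cst 1%E x))%E.
    apply: eq_integral => x /set_mem; rewrite /A /= in_itv /= => /andP[_ x0].
    rewrite /wt patchE (_ : x \in Rp = false) ?eqxx//.
    by apply/negbTE/negP => /set_mem /RpE; rewrite ltNge x0.
  rewrite integral_cst; last exact: mA.
  rewrite mul1e; suff lA : leb (A n) = (n%:R)%:E.
    by apply: le_lt_trans (ltry (n%:R)); rewrite -lA.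
  rewrite /A lebesgue_measure_itv /= lte_fin; case: ltP => h.
    by rewrite -EFinB sub0r opprK.
  by apply/esym/eqP; rewrite eqe; move: h; rewrite oppr_ge0 lern0 => /eqP ->.
Qed.

End weighted_integrals.

Section sparse_operators.
Variables (R : realType) (lam p Lam : R) (D : int -> set (set R)) (z : int -> set R -> R)
  (delta c0 C0 : R) (N : nat).
Hypotheses (lam0 : 0 < lam) (p1 : 1 < p) (Lam0 : 0 < Lam)
  (DD : dyadic_system D z delta c0 C0).
Local Notation leb := (@lebesgue_measure R).
Local Notation u := (udens lam).
Local Notation Cd := (dyadic_const lam delta c0 C0).
Local Notation q := (p / (p - 1)).
Local Notation e := (2 * Num.max 1 (p - 1)^-1).

(** [N.+1] keeps the constant positive when [N = 0], [kappa] is taken at oscillation 1, and the last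
    factor pays for passing from the A_p constant on intervals to the one on cubes. *)
Definition sparse_const : R :=
  op_const Lam^-1 N.+1 p q * kappa lam delta c0 C0 1 * (Cd `^ p) `^ e.

Let p0 : 0 < p. Proof. exact: lt_trans p1. Qed.
Let q0 : 0 < q. Proof. by rewrite divr_gt0 ?subr_gt0. Qed.
Let q1E : q - 1 = (p - 1)^-1.
Proof. by have p10 : p - 1 != 0 by [rewrite gt_eqF// subr_gt0]; field. Qed.

Lemma sparse_const_gt0 : 0 < sparse_const.
Proof.
have Cd0 := dyadic_const_gt0 lam DD.
have k0 := kappa_gt0 lam DD (@ltr01 R).
have o0 : 0 < op_const Lam^-1 N.+1 p q.
  have L0 : 0 < Lam^-1 by rewrite invr_gt0.
  rewrite /op_const; move: q q0 (Lam^-1) L0 => r r0 L L0.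
  by do ![apply: mulr_gt0 => //|apply: addr_gt0 => //|apply: powR_gt0 => //].
by apply: mulr_gt0; [exact: mulr_gt0|rewrite powR_gt0// powR_gt0].
Qed.

Lemma sparse_constE (A beta : R) : 0 <= A ->
  op_const Lam^-1 N.+1 p q * kappa lam delta c0 C0 beta * (A * Cd `^ p) `^ (2 * Num.max 1 (q - 1)) =
  sparse_const * beta * A `^ e.
Proof.
move=> A0; rewrite q1E powRM ?powR_ge0// /sparse_const /kappa.
by ring.
Qed.

Section bounds.
Variables (S : set (set R)) (b w : R -> R) (beta : R) (E : set R -> set R)
  (F : nat -> set R) (P : pred nat).
Hypotheses (Bb : BMO lam b) (bbeta : fine (bmo_norm lam b) <= beta) (beta0 : 0 < beta)
  (Aw : Ap_weight lam p w) (SD : S `<=` dcube D)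
  (SE : forall Q, S Q ->
     [/\ measurable (E Q), E Q `<=` Q & (Lam%:E * muI lam Q <= muI lam (E Q))%E])
  (SN : forall x, ([set Q | S Q /\ E Q x] #<= `I_N)%card)
  (F0 : F 0%N = set0) (FD : forall i, F i = set0 \/ dcube D (F i)) (nF : nested F)
  (DF : forall Q, dcube D Q -> exists i, F i = Q)
  (PS : forall n, P n -> S (F n)) (Finj : {in P &, injective F}).
Let bt := b \_ Rp.
Let k n := if P n then n else 0%N.
Let bb n := bavg leb u bt (F (k n)).
Let G n := if P n then E (F n) else set0.
Let W := fine (Ap_const lam p w) * Cd `^ p.

Let FkP i : F (k i) = set0 \/ (P i /\ dcube D (F i)).
Proof. by rewrite /k; case: ifP => Pi; [right; split=> //; exact: SD (PS Pi)|left]. Qed.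

Let mF i : measurable (F i).
Proof.
have [->|[l DQ]] := FD i; first exact: measurable0.
by have mQ := dyadic_measurable DD DQ.
Qed.

Let mass0 (s : R -> R) : mass leb s set0 = 0%E.
Proof. exact: integral_set0. Qed.

Let mass_lty (s : R -> R) : (forall l Q, D l Q -> (mass leb s Q < +oo)%E) ->
  forall i, (mass leb s (F i) < +oo)%E.
Proof. by move=> h i; have [->|[l DQ]] := FD i; [rewrite mass0|exact: h DQ]. Qed.

Let mG i : measurable (G i).
Proof. by rewrite /G; case: ifP => // Pi; have [] := SE (PS Pi). Qed.

Let GF i : G i `<=` F (k i).
Proof. by rewrite /G /k; case: ifP => [Pi|_]; [have [] := SE (PS Pi)|exact: sub0set]. Qed.

Let GL i : (mass leb u (F (k i)) <= (Lam^-1)%:E * mass leb u (G i))%E.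
Proof.
rewrite /G /k; case: ifP => Pi; last by rewrite F0 !mass0 mule0.
have [_ EQ h] := SE (PS Pi); have [l DQ] := SD (PS Pi); have QR := dyadic_Rp DD DQ.
rewrite (muI_mass lam QR) (muI_mass lam (subset_trans EQ QR)) in h.
rewrite -[leLHS]mul1e -(mulVf (lt0r_neq0 Lam0)) EFinM -muleA.
by apply: lee_wpmul2l => //; rewrite lee_fin invr_ge0 ltW.
Qed.

Let ov x : (\sum_(i <oo) (\1_(G i) x : R)%:E <= N.+1%:R%:E)%E.
Proof.
have h := bounded_overlap_series R PS Finj (SN x).
by apply: (le_trans h); rewrite lee_fin ler_nat.
Qed.

Let kap_gt0 : 0 < kappa lam delta c0 C0 beta.
Proof. exact: (kappa_gt0 lam DD beta0). Qed.

Let JN (g : R -> R) : nnmf (fun x => (g x)%:E) -> forall i,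
  (\int[leb]_(x in F (k i)) (`|bt x - bb i|%:E * ((g x)%:E * (u x)%:E)) <=
   (kappa lam delta c0 C0 beta)%:E *
   \int[leb]_(x in F (k i)) (dmax leb u F (fun x => (g x)%:E) x * (u x)%:E))%E.
Proof.
move=> ng i; rewrite /bb; have [->|[Pi [l DQ]]] := FkP i.
  by rewrite !integral_set0 mule0.
rewrite /k Pi.
exact: (cube_john_nirenberg lam0 DD Bb bbeta beta0 mF DF ng DQ).
Qed.

Let wu := weight_udens lam.
Let mbt : measurable_fun [set: R] bt. Proof. exact: measurable_bRp Bb. Qed.
Let uoo := mass_lty (dyadic_mass_lty lam0 DD).
Let L_gt0 : 0 < Lam^-1. Proof. by rewrite invr_gt0. Qed.

Section null_zeros.
Hypothesis z0 : leb (zeros w) = 0%E.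

Let woo : forall i, (mass leb (wt w) (F i) < +oo)%E.
Proof. by apply: mass_lty => l Q DQ; have [] := cube_Ap lam0 DD p1 Aw z0 DQ. Qed.

Let soo : forall i, (mass leb (st lam p w) (F i) < +oo)%E.
Proof. by apply: mass_lty => l Q DQ; have [] := cube_Ap lam0 DD p1 Aw z0 DQ. Qed.

Let W1 : 1 <= W. Proof. exact: (cube_Ap_ge1 lam0 DD p1 Aw z0). Qed.

Let Ap i : fine (mass leb (wt w) (F i)) * fine (mass leb (st lam p w) (F i)) `^ (p - 1)
  <= W * fine (mass leb u (F i)) `^ p.
Proof.
have [->|[l DQ]] := FD i; last by have [] := cube_Ap lam0 DD p1 Aw z0 DQ.
by rewrite !mass0 mul0r mulr_ge0 ?powR_ge0// (le_trans _ W1).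
Qed.

Variable f : R -> R.
Hypotheses (mf : measurable_fun Rp f) (foo : (Lpw p w f < +oo)%E).
Let ft x := `|(f \_ Rp) x|.

Lemma nnmf_norm_patch : nnmf (fun x => (ft x)%:E).
Proof.
rewrite /ft; apply: nnmf_EFin => //; apply: measurableT_comp => //.
exact: (measurable_restrictT f (@measurable_Rp R)).1.
Qed.

Let A0 : 0 <= fine (Ap_const lam p w).
Proof. by rewrite fine_ge0// (Ap_const_ge0 Aw). Qed.

Lemma comm_op_wt_bound :
  (\int[leb]_x (poweR (comm_op leb u bt F k bb (fun x => (ft x)%:E) x) p * (wt w x)%:E) <=
   ((sparse_const * beta * fine (Ap_const lam p w) `^ e) `^ p)%:E * Lpw p w f)%E.
Proof.
have [Z [mZ ndZ coverZ Zoo]] := wt_exhaustion p1 Aw z0 lam0.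
have lE := Lpw_wt p1 Aw z0 mf; have := foo; rewrite lE => foo'.
rewrite -(sparse_constE beta A0).
apply: (@comm_op_bound _ _ _ leb u bt F G k bb (Lam^-1) _ N.+1 wu mbt mF nF uoo mG GF
  (ltW L_gt0) GL ov (ltW kap_gt0) JN p q (wt w) (st lam p w) W Z p1 (conjugate_pq p1)
  (weight_wt Aw) (weight_st Aw) (u_wt_st p1 Aw) woo soo W1 Ap mZ ndZ coverZ Zoo kap_gt0 L_gt0
  isT _ nnmf_norm_patch foo').
Qed.

Lemma comm_star_wt_bound :
  (\int[leb]_x (poweR (comm_star leb u bt F k bb ft x) p * (wt w x)%:E) <=
   ((sparse_const * beta * fine (Ap_const lam p w) `^ e) `^ p)%:E * Lpw p w f)%E.
Proof.
have [Z [mZ ndZ coverZ Zoo]] := wt_exhaustion p1 Aw z0 lam0.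
have lE := Lpw_wt p1 Aw z0 mf; have := foo; rewrite lE => foo'.
rewrite -(sparse_constE beta A0).
apply: (@comm_star_bound _ _ _ leb u bt F G k bb (Lam^-1) _ N.+1 wu mbt mF nF uoo mG GF
  (ltW L_gt0) GL ov (ltW kap_gt0) JN p q (wt w) (st lam p w) W Z p1 (conjugate_pq p1)
  (weight_wt Aw) (weight_st Aw) (u_wt_st p1 Aw) woo soo W1 Ap mZ ndZ coverZ Zoo kap_gt0 L_gt0
  isT _ nnmf_norm_patch foo').
Qed.

End null_zeros.
Variable f : R -> R.
Hypotheses (FP : S = [set F n | n in [set n | P n]])
  (mf : measurable_fun Rp f) (foo : (Lpw p w f < +oo)%E).
Let K := sparse_const * beta * fine (Ap_const lam p w) `^ e.

Let mb : measurable_fun Rp b. Proof. by case: Bb. Qed.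

(** If the zeros of [w] are negligible, [wt] replaces [w]; if not, [w] vanishes almost everywhere
    and the left side is 0. *)
Let comm_bound (H : R -> \bar R) : nnmf H ->
  (leb (zeros w) = 0%E ->
    (\int[leb]_x (poweR (H x) p * (wt w x)%:E) <= (K `^ p)%:E * Lpw p w f)%E) ->
  (\int[leb]_(x in Rp) (poweR (H x) p * (w x)%:E) <= (K `^ p)%:E * Lpw p w f)%E.
Proof.
move=> nH h; have [z0|z0] := eqVneq (leb (zeros w)) 0%E.
  apply: (@le_trans _ _ (\int[leb]_x (poweR (H x) p * (wt w x)%:E))%E); last exact: h.
  exact: (int_wt_le Aw z0 nH).
have z1 : (0 < leb (zeros w))%E by rewrite lt0e z0 measure_ge0.
have w0 := w_ae0 lam0 p1 Aw z1; have nHp : nnmf (fun x => poweR (H x) p) by exact: nnmf_poweR.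
rewrite (int_w_ae0 Aw w0 nHp) mule_ge0// ?lee_fin ?powR_ge0//.
apply: integral_ge0 => x Rx; rewrite lee_fin mulr_ge0 ?powR_ge0//.
by case: Aw => _ + _; exact.
Qed.

Lemma AS_bound : (LpwE p w (AS lam S b f) <= (K `^ p)%:E * Lpw p w f)%E.
Proof.
apply: (@le_trans _ _ (\int[leb]_(x in Rp)
    (poweR (comm_op leb u bt F k bb (fun x => `|(f \_ Rp) x|%:E) x) p * (w x)%:E))%E).
  by apply: (LpwE_le p1 Aw) => x Rx; exact: (AS_le lam0 DD b SD PS Finj FP mf).
apply: comm_bound.
  by apply: (nnmf_comm_op leb _ _ wu mbt mF); exact: (nnmf_norm_patch mf).
by move=> z0; exact: (comm_op_wt_bound z0 mf foo).
Qed.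

Lemma ASstar_bound : (LpwE p w (ASstar lam S b f) <= (K `^ p)%:E * Lpw p w f)%E.
Proof.
apply: (@le_trans _ _ (\int[leb]_(x in Rp)
    (poweR (comm_star leb u bt F k bb (fun x => `|(f \_ Rp) x|%R) x) p * (w x)%:E))%E).
  by apply: (LpwE_le p1 Aw) => x Rx; exact: (ASstar_le lam0 DD SD PS Finj FP mb mf).
apply: comm_bound.
  by apply: (nnmf_comm_star leb _ _ wu mbt mF); exact: (nnmf_norm_patch mf).
by move=> z0; exact: (comm_star_wt_bound z0 mf foo).
Qed.

End bounds.
End sparse_operators.

(** The stopping height must be positive, while the BMO norm of [b] may be 0; this case is reached
    by letting [t] decrease to 0, which needs [y] finite. *)
Lemma le_powR_limit (R : realType) (p M beta : R) (x y : \bar R) :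
  0 < p -> 0 <= M -> 0 <= beta -> (0 <= y < +oo)%E ->
  (forall t : R, beta <= t -> 0 < t -> (x <= ((t * M) `^ p)%:E * y)%E) ->
  (x <= ((beta * M) `^ p)%:E * y)%E.
Proof.
move=> p0 M0 b0 /andP[y0 yoo] h.
have [b_gt0|b_le0] := ltP 0 beta; first exact: h.
have -> : beta = 0 by apply/eqP; rewrite eq_le b_le0.
rewrite mul0r powR0 ?gt_eqF// mul0e.
have yE : y = (fine y)%:E by rewrite fineK// ge0_fin_numE.
pose c := M `^ p * fine y + 1.
have c0 : 0 < c by rewrite ltr_wpDl// mulr_ge0 ?powR_ge0// fine_ge0.
apply/lee_addgt0Pr => eps eps0; rewrite add0e.
have t0 : 0 < (eps / c) `^ p^-1 by rewrite powR_gt0// divr_gt0.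
apply: (le_trans (h _ (le_trans b_le0 (ltW t0)) t0)).
rewrite yE -EFinM lee_fin powRM ?(ltW t0)// -powRrM mulVf ?gt_eqF// powRr1; last first.
  by rewrite ltW// divr_gt0.
by rewrite -mulrA mulrAC ler_pdivrMr// ler_pM2l// lerDl.
Qed.

Theorem theorem1p6 (R : realType) (lam p Lam : R)
    (D : int -> set (set R)) (z : int -> set R -> R) (delta c0 C0 : R) (N : nat) :
  0 < lam -> 1 < p -> 0 < Lam < 1 -> dyadic_system D z delta c0 C0 ->
  exists C : R, 0 < C /\
    forall (S : set (set R)) (b w : R -> R),
      sparse lam D Lam N S -> BMO lam b -> Ap_weight lam p w ->
      let K := C * fine (bmo_norm lam b) *
               fine (Ap_const lam p w) `^ (2 * Num.max 1 (p - 1)^-1) in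
      forall f : R -> R, measurable_fun Rp f -> (Lpw p w f < +oo)%E ->
        (LpwE p w (AS lam S b f) <= (K `^ p)%:E * Lpw p w f)%E /\
        (LpwE p w (ASstar lam S b f) <= (K `^ p)%:E * Lpw p w f)%E.
Proof.
move=> lam0 p1 /andP[Lam0 _] DD.
exists (sparse_const lam p Lam delta c0 C0 N); split.
  exact: (sparse_const_gt0 lam N p1 Lam0 DD).
move=> S b w [SD [E [SE SN]]] Bb Aw K f mf foo.
have [F [F0 FD nF DF]] := dyadic_enum_all DD.
have [P [PS Finj FP]] := injective_subenumeration (fun Q SQ => DF Q (SD Q SQ)).
have p0 : 0 < p by exact: lt_trans p1.
have C0' := sparse_const_gt0 lam N p1 Lam0 DD.
pose M := sparse_const lam p Lam delta c0 C0 N *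
  fine (Ap_const lam p w) `^ (2 * Num.max 1 (p - 1)^-1).
have M0 : 0 <= M by rewrite mulr_ge0 ?powR_ge0// ltW.
have n0 : 0 <= fine (bmo_norm lam b).
  rewrite fine_ge0//; apply: le_trans (ereal_sup_ubound _); last first.
    by exists `]0, 1[%classic; [exists 0, 1|].
  apply: mule_ge0.
    rewrite lee_fin invr_ge0 fine_ge0//; apply: integral_ge0 => x _.
    by rewrite lee_fin powR_ge0.
  by apply: integral_ge0 => x _; rewrite lee_fin mulr_ge0 ?powR_ge0.
have Lp0 : (0 <= Lpw p w f < +oo)%E.
  rewrite foo andbT; apply: integral_ge0 => x Rx.
  by rewrite lee_fin mulr_ge0 ?powR_ge0//; case: Aw => _ + _; exact.
have KE t : sparse_const lam p Lam delta c0 C0 N * t *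
    fine (Ap_const lam p w) `^ (2 * Num.max 1 (p - 1)^-1) = t * M by rewrite mulrCA mulrA mulrAC.
(* Every positive [t] above the BMO norm is an admissible oscillation bound. *)
rewrite /K KE; split; apply: le_powR_limit => // t bt t0; rewrite -KE.
- exact: (AS_bound lam0 p1 Lam0 DD Bb bt t0 Aw SD SE SN F0 FD nF DF PS Finj FP mf foo).
- exact: (ASstar_bound lam0 p1 Lam0 DD Bb bt t0 Aw SD SE SN F0 FD nF DF PS Finj FP mf foo).
Qed.
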